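(* Let $(G_n)_{n\in\mathbb N}$, $G_n=(V_n,E_n)$, be a sequence of finite random simple graphs that locally converges to the unimodular Galton–Watson tree $\mathcal T(P,\rho)$, where the degree distribution $P$ has finite second moment $\sum_k k^2P_k<\infty$ (equivalently $\overline\rho=\sum_k k\rho_k<\infty$). Then almost surely, for all $x>0$, $$\varepsilon_{G_n}(x):= x\frac{\partial}{\partial x}\frac{\log Z_{G_n}(x)}{|V_n|}=\frac{1}{|V_n|}\sum_{v\in V_n}\mathcal R_x(G_n,v)\xrightarrow[n\to\infty]{}\mathbb E[Y(x)],$$ and the function $x\mapsto\mathbb E[Y(x)]$ is analytic on $(0,\infty)$. Here $Y(x)\overset{\mathcal D}{=}\frac{x^2}{x^2+\sum_{i=1}^\Delta X_i}$, where $\Delta\sim P$ is independent of $(X_i)_{i\in\mathbb N}$, the $X_i$ are i.i.d. copies of $X$, and the distribution of $X$ is the unique solution supported in $[0,1]$ of $X\overset{\mathcal D}{=}\frac{x^2}{x^2+\sum_{i=1}^K X_i}$ with $K\sim\rho$ independent of $(X_i)_{i\in\mathbb N}$.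
   Context: Monomer-dimer model: for a finite simple graph $G=(V,E)$ and $x>0$, $Z_G(x)=\sum_D x^{|V|-2|D|}$ over all matchings $D\subseteq E$, $\mu_{G,x}(D)=x^{|V|-2|D|}/Z_G(x)$, and $\mathcal R_x(G,o)$ is the $\mu_{G,x}$-probability that $o$ is not covered by an edge of $D$. $[G,v]_r$ is the subgraph induced by vertices at distance $\le r$ from $v$. Galton–Watson tree $\mathcal T(P,\rho)$ rooted at $o$: the root has $\Delta\sim P$ children, each further vertex has an independent $\rho$-distributed number of children; $\mathcal T(P,\rho,r)$ is the subtree of the first $r$ generations. It is unimodular if $0<\overline P:=\sum_k kP_k<\infty$ and $\rho_k=(k+1)P_{k+1}/\overline P$ for all $k$. The random graphs $G_n$ are defined on a common probability space; $(G_n)$ locally converges to $\mathcal T(P,\rho)$ if for every $r\in\mathbb N$ and every finite rooted tree $(T,o)$ with at most $r$ generations, $\frac{1}{|V_n|}\sum_{v\in V_n}\mathbb 1\big(([G_n,v]_r,v)\cong(T,o)\big)\to\mathbb P\big((\mathcal T(P,\rho,r),o)\cong(T,o)\big)$ almost surely, where $\cong$ is isomorphism of rooted graphs. *)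

(* Defs.v *)
From HB Require Import structures.
From mathcomp Require Import all_boot all_order all_algebra.
From mathcomp Require Import finmap.
From mathcomp Require Import all_classical all_reals all_analysis.
Unset Printing Implicit Defensive.
Import Order.TTheory GRing.Theory Num.Theory.
Import numFieldNormedType.Exports.
Local Open Scope classical_set_scope.
Local Open Scope ring_scope.

Record simple_graph := FGraph {
  nv : nat;
  adj : rel 'I_nv;
  adj_sym : symmetric adj;
  adj_irr : irreflexive adj }.
Arguments adj {_}.

Definition rooted_iso {A B : Type} (VA : A -> Prop) (adjA : A -> A -> bool) (ra : A)
  (VB : B -> Prop) (adjB : B -> B -> bool) (rb : B) : Prop :=
  exists f : A -> B,
    [/\ forall a, VA a -> VB (f a),
        forall a a', VA a -> VA a' -> f a = f a' -> a = a',
        forall b, VB b -> exists2 a, VA a & f a = b,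
        f ra = rb &
        forall a a', VA a -> VA a' -> adjA a a' = adjB (f a) (f a')].

Definition ball_step {G : simple_graph} (S : {set 'I_(nv G)}) : {set 'I_(nv G)} :=
  S :|: [set w | [exists u in S, adj u w]]%SET.
Definition gball {G : simple_graph} (v : 'I_(nv G)) (r : nat) : {set 'I_(nv G)} :=
  iter r (@ball_step G) [set v]%SET.

(** * Finite rooted (plane) trees in Ulam--Harris form: a finite set of words,
    root = [::], parent of (rcons u i) = u, children of u labelled 0..k-1. *)
Definition word := seq nat.

Definition is_ptree (t : {fset word}) : Prop :=
  [::] \in t /\
  forall (u : word) (i : nat), rcons u i \in t ->
    u \in t /\ forall j, (j < i)%N -> rcons u j \in t.

Definition tadj (u w : word) : bool :=
  ((size w == (size u).+1) && (take (size u) w == u)) ||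
  ((size u == (size w).+1) && (take (size w) u == w)).

Definition height_le (t : {fset word}) (r : nat) : Prop :=
  forall w, w \in t -> (size w <= r)%N.

Definition nchild (t : {fset word}) (u : word) : nat :=
  count (fun w : word => (size w == (size u).+1) && (take (size u) w == u))
        (enum_fset t).

(** Law of the (plane, Ulam--Harris) Galton--Watson tree T(P,rho) truncated to its
    first r generations: probability that the truncation equals the plane tree t
    (of height <= r): product over vertices of depth < r of the offspring
    probability (P at the root, rho elsewhere). *)
Definition gw_weight {R : realType} (P rho : nat -> R) (r : nat) (t : {fset word}) : R :=
  \prod_(u <- enum_fset t | (size u < r)%N) (if u == [::] then P else rho) (nchild t u).

Definition gw_prob {R : realType} (P rho : nat -> R) (r : nat) (T : {fset word}) : \bar R :=
  \esum_(t in [set t : {fset word} | [/\ is_ptree t, height_le t r &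
             rooted_iso (fun w => w \in t) tadj [::] (fun w => w \in T) tadj [::]]])
     (gw_weight P rho r t)%:E.

Definition loc_freq {R : realType} (G : simple_graph) (r : nat) (T : {fset word}) : R :=
  (#|[set v : 'I_(nv G) |
       `[< rooted_iso (fun x => x \in gball v r) (@adj G) v
                      (fun w => w \in T) tadj [::] >] ]|)%:R / (nv G)%:R.

(** a matching: a set of edges {u,v} (stored as (u,v) with u < v), pairwise disjoint *)
Definition is_matching {G : simple_graph} (D : {set 'I_(nv G) * 'I_(nv G)}) : bool :=
  [forall e in D, (e.1 < e.2)%N && adj e.1 e.2] &&
  [forall e in D, forall e' in D, (e != e') ==>
     [&& e.1 != e'.1, e.1 != e'.2, e.2 != e'.1 & e.2 != e'.2]].

Definition covers {G : simple_graph} (D : {set 'I_(nv G) * 'I_(nv G)}) (v : 'I_(nv G)) : bool :=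
  [exists e in D, (e.1 == v) || (e.2 == v)].

Definition mdZ {R : realType} (G : simple_graph) (x : R) : R :=
  \sum_(D : {set 'I_(nv G) * 'I_(nv G)} | is_matching D) x ^+ (nv G - 2 * #|D|).

Definition mdR {R : realType} (G : simple_graph) (x : R) (o : 'I_(nv G)) : R :=
  (\sum_(D : {set 'I_(nv G) * 'I_(nv G)} | is_matching D && ~~ covers D o)
       x ^+ (nv G - 2 * #|D|)) / mdZ G x.

Definition mean_R {R : realType} (G : simple_graph) (x : R) : R :=
  (\sum_(v : 'I_(nv G)) mdR G x v) / (nv G)%:R.

(** k-fold iterated integral against mu: E[F(X_1,...,X_k)] with X_i iid ~ mu *)
Fixpoint iint {R : realType} (mu : probability R R) (k : nat) (F : seq R -> \bar R)
  : \bar R :=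
  match k with
  | 0 => F [::]
  | k'.+1 => (\int[mu]_y iint mu k' (fun s => F (y :: s)))%E
  end.

(** Law of  x^2 / (x^2 + sum_{i=1}^K X_i),  K ~ offs independent of X_i iid ~ mu,
    evaluated at the set A. *)
Definition rde_rhs {R : realType} (offs : nat -> R) (x : R) (mu : probability R R)
  (A : set R) : \bar R :=
  (\sum_(k <oo) ((offs k)%:E *
     iint mu k (fun s => (\1_A (x ^+ 2 / (x ^+ 2 + \sum_(y <- s) y)))%:E)))%E.

Definition is_rde_sol {R : realType} (rho : nat -> R) (x : R) (mu : probability R R)
  : Prop :=
  mu [set y : R | 0 <= y <= 1] = 1%E /\
  forall A : set R, measurable A -> mu A = rde_rhs rho x mu A.

Definition EY {R : realType} (P : nat -> R) (x : R) (mu : probability R R) : \bar R :=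
  (\sum_(k <oo) ((P k)%:E *
     iint mu k (fun s => (x ^+ 2 / (x ^+ 2 + \sum_(y <- s) y))%:E)))%E.

Definition real_analytic_on {R : realType} (U : set R) (f : R -> R) : Prop :=
  forall a, U a -> exists2 r : R, 0 < r &
    exists c : nat -> R, forall y, `|y - a| < r ->
      (fun N => \sum_(n < N) c n * (y - a) ^+ n) @ \oo --> f y.

(* Main.v *)
Require Import Defs.
From HB Require Import structures.
From mathcomp Require Import all_boot all_order all_algebra.
From mathcomp Require Import finmap.
From mathcomp Require Import all_classical all_reals all_analysis.
From mathcomp Require Import complex measurable_realfun ring lra.
Set Implicit Arguments.
Unset Strict Implicit.
Import Order.TTheory GRing.Theory Num.Theory.
Import numFieldNormedType.Exports.
Local Open Scope ring_scope.

(** The cavity recursion expresses the monomer probability of a vertex as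
    [x^2 / (x^2 + S)], [S] being the sum of the monomer probabilities of its
    neighbours once the vertex is deleted.  Unrolling it along self-avoiding
    walks and truncating at depth [r] gives upper bounds for even [r] and lower
    bounds for odd [r]; these only see the ball of radius [r], so local
    convergence identifies the limits of their averages with the expectations
    of the same truncated recursion on the Galton--Watson tree.  The truncated
    laws are monotone for the stochastic order along even and along odd depths.
    That both limits agree follows from unimodularity: the expected probability
    that the root is covered equals [Pbar] times the expectation of a function
    symmetric in the two messages along an edge, one of even and one of odd
    depth.  Hence the odd and even limits have the same [E[Y]], and a strictly
    monotone functional that agrees on two ordered laws forces them to be equal.

    For analyticity, Heilmann--Lieb shows that the zeros of [Z_G] lie in the
    closed left half-plane, so [mean_R G] has at [a > 0] a Taylor series whose
    truncation at order [M] has error at most [2 (|h|/a)^M] uniformly in [G];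
    this survives pointwise limits. *)

(** * Partition functions of induced subgraphs *)

Section matchings.
Context {G : simple_graph}.
Local Notation V := 'I_(nv G).
Local Open Scope set_scope.
Implicit Types (D : {set V * V}) (S : {set V}) (o v w : V) (e : V * V).

Definition incident e v : bool := (e.1 == v) || (e.2 == v).

Definition covered D : {set V} := [set v | covers D v].

Definition edge o v : V * V := if (o < v)%N then (o, v) else (v, o).

Lemma coveredP D v : reflect (exists2 e, e \in D & incident e v) (v \in covered D).
Proof. by rewrite inE; exact: exists_inP. Qed.

Lemma covered0 : covered finset.set0 = finset.set0.
Proof.
by apply/setP => v; rewrite finset.in_set0; apply/negP => /coveredP[e]; rewrite inE.
Qed.

Lemma matchingP D : reflect
  ((forall e, e \in D -> (e.1 < e.2)%N /\ adj e.1 e.2) /\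
   (forall e e' v, e \in D -> e' \in D -> incident e v -> incident e' v -> e = e'))
  (is_matching D).
Proof.
apply: (iffP andP) => -[edgesD disjD]; split.
- by move=> e eD; apply/andP; exact: (forall_inP edgesD).
- move=> e e' v eD e'D ev e'v; apply/eqP; apply/negPn/negP => ne.
  have /forall_inP/(_ _ e'D) := forall_inP disjD _ eD; rewrite ne /= => /and4P[].
  by case/orP: ev => /eqP ->; case/orP: e'v => /eqP ->; rewrite eqxx.
- by apply/forall_inP => e /edgesD[-> ->].
apply/forall_inP => e eD; apply/forall_inP => e' e'D; apply/implyP => ne.
have apart v : incident e v -> ~~ incident e' v.
  by move=> ev; apply: contra ne => e'v; apply/eqP; exact: disjD ev e'v.
have /norP[ne21 ne22] : ~~ incident e' e.2 by apply: apart; rewrite /incident eqxx orbT.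
have /norP[ne11 ne12] : ~~ incident e' e.1 by apply: apart; rewrite /incident eqxx.
by apply/and4P; split; rewrite eq_sym.
Qed.

Lemma matching0 : is_matching (finset.set0 : {set V * V}).
Proof. by apply/matchingP; split=> [e|e e' v]; rewrite inE. Qed.

Lemma matching_subset D D' : is_matching D -> D' \subset D -> is_matching D'.
Proof.
move=> /matchingP[edgesD disjD] /fintype.subsetP sD; apply/matchingP.
by split=> [e /sD|e e' v /sD eD /sD]; [exact: edgesD | exact: disjD].
Qed.

Lemma adj_neq o v : adj o v -> o != v.
Proof. by apply: contraTneq => ->; rewrite (@adj_irr G). Qed.

Lemma edgeC o v : edge o v = edge v o.
Proof. by rewrite /edge; case: ltngtP => // /val_inj ->. Qed.

Lemma ltn_edge e : (e.1 < e.2)%N -> edge e.1 e.2 = e.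
Proof. by case: e => a b /= ab; rewrite /edge ab. Qed.

Lemma incident_edge o v w : incident (edge o v) w = (w \in [set o; v]).
Proof.
by rewrite !inE /incident /edge; case: ifP => _ /=; rewrite ![_ == w]eq_sym ?[(w == v) || _]orbC.
Qed.

Lemma mem_covered_edge D o v : edge o v \in D -> (o \in covered D) && (v \in covered D).
Proof.
by move=> ovD; apply/andP; split; apply/coveredP; exists (edge o v);
  rewrite ?incident_edge ?inE ?eqxx ?orbT.
Qed.

Lemma covered_edgeU o v D : covered (edge o v |: D) = [set o; v] :|: covered D.
Proof.
apply/setP => w; rewrite [RHS]inE -incident_edge; apply/coveredP/orP.
  move=> [e]; rewrite in_setU1 => /orP[/eqP ->|eD ew]; first by left.
  by right; apply/coveredP; exists e.
case=> [?|/coveredP[e eD ew]]; first by exists (edge o v) => //; rewrite finset.setU11.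
by exists e => //; rewrite setU1r.
Qed.

Lemma matching_edgeU o v D : is_matching D -> adj o v -> o \notin covered D ->
  v \notin covered D -> is_matching (edge o v |: D).
Proof.
move=> /matchingP[edgesD disjD] ov oD vD.
have apart e w : e \in D -> incident (edge o v) w -> ~~ incident e w.
  move=> eD; rewrite incident_edge !inE => /orP[] /eqP ->.
    by apply: contra oD => eo; apply/coveredP; exists e.
  by apply: contra vD => ev; apply/coveredP; exists e.
apply/matchingP; split=> [e|e e' w]; rewrite !in_setU1.
  move=> /predU1P[->|]; last exact: edgesD.
  rewrite /edge; case: ifP => // /negbT; rewrite -leqNgt => vo /=.
  by rewrite (@adj_sym G) ov ltn_neqAle vo andbT; split=> //; rewrite eq_sym adj_neq.
move=> /predU1P[->|eD] /predU1P[->|e'D] // ew e'w; last exact: disjD ew e'w.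
- by case/negP: (apart e' w e'D ew).
- by case/negP: (apart e w eD e'w).
Qed.

Lemma matching_edgeP D o : is_matching D -> o \in covered D ->
  exists2 v, adj o v & edge o v \in D.
Proof.
move=> /matchingP[edgesD _] /coveredP[e eD]; have [ltD adjD] := edgesD e eD.
case/orP => /eqP <-; [exists e.2|exists e.1] => //.
- by rewrite ltn_edge.
- by rewrite (@adj_sym G).
- by rewrite edgeC ltn_edge.
Qed.

Lemma matching_edge_inj D o v w : is_matching D ->
  edge o v \in D -> edge o w \in D -> v = w.
Proof.
move=> /matchingP[_ disjD] vD wD.
have vw : edge o v = edge o w by apply: (disjD _ _ o vD wD); rewrite incident_edge !inE eqxx.
have : w \in [set o; v] by rewrite -incident_edge vw incident_edge !inE eqxx orbT.
rewrite !inE => /orP[/eqP wo|/eqP //].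
have : v \in [set o; w] by rewrite -incident_edge -vw incident_edge !inE eqxx orbT.
by rewrite wo !inE orbb => /eqP.
Qed.

Definition partner D o : V := odflt o [pick v | edge o v \in D].

Lemma partnerE D o v : is_matching D -> o \in covered D ->
  (partner D o == v) = (edge o v \in D).
Proof.
move=> mD oD; have [u _ uD] := matching_edgeP mD oD.
rewrite /partner; case: pickP => [w wD|/(_ u)]; last by rewrite uD.
by apply/eqP/idP => /= [<- //|]; exact: matching_edge_inj.
Qed.

Lemma covered_edgeD D o v : is_matching D -> edge o v \in D ->
  covered (D :\ edge o v) = covered D :\: [set o; v].
Proof.
move=> /matchingP[_ disjD] ovD; apply/setP => w; rewrite [RHS]inE -incident_edge.
apply/coveredP/andP.
  move=> [e]; rewrite in_setD1 => /andP[ne eD] ew; split; last by apply/coveredP; exists e.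
  by apply: contra ne => ow; rewrite (disjD _ _ _ eD ovD ew ow).
move=> [nw /coveredP[e eD ew]]; exists e => //; rewrite in_setD1 eD andbT.
by apply: contra nw => /eqP <-.
Qed.

Lemma card_covered D : is_matching D -> #|covered D| = (2 * #|D|)%N.
Proof.
move=> /matchingP[edgesD disjD]; pose endpoint (p : (V * V) * bool) := if p.2 then p.1.1 else p.1.2.
have endpointP e b : incident e (endpoint (e, b)).
  by case: b; rewrite /incident eqxx ?orbT.
have -> : covered D = endpoint @: finset.setX D [set: bool].
  apply/setP => w; apply/coveredP/imsetP => [[e eD]|[[e b]]]; last first.
    by rewrite finset.in_setX => /andP[eD _] ->; exists e.
  by case/orP => /eqP <-; [exists (e, true)|exists (e, false)];
    rewrite ?finset.in_setX /= ?eD ?finset.in_setT.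
rewrite card_in_imset; first by rewrite cardsX cardsT card_bool mulnC.
move=> [e b] [e' b']; rewrite !finset.in_setX /= => /andP[eD _] /andP[e'D _] ends.
have ee' : e = e' by apply: (disjD _ _ (endpoint (e, b)) eD e'D); rewrite // ends.
move: ends; rewrite -ee'; have [lt_e _] := edgesD e eD.
by case: b; case: b' => //; rewrite /endpoint /= => ends; rewrite ends ltnn in lt_e.
Qed.

Section partition_function.
Variables (K : comNzRingType) (x : K).

Definition induced_Z S : K :=
  (\sum_(D : {set V * V} | is_matching D && (covered D \subset S)) x ^+ #|S :\: covered D|)%R.

Lemma induced_Z_uncovered S o : o \in S ->
  (\sum_(D : {set V * V} | is_matching D && (covered D \subset S) && (o \notin covered D))
      x ^+ #|S :\: covered D|
   = x * induced_Z (S :\ o))%R.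
Proof.
move=> oS; rewrite /induced_Z big_distrr/=; apply: eq_big.
  by move=> D; rewrite subsetD1 andbA.
move=> D /andP[_ oD]; rewrite -exprS; congr (_ ^+ _)%R.
rewrite (cardsD1 o) inE oD oS add1n; congr (_.+1); apply: eq_card => w.
by rewrite !inE andbCA.
Qed.

Lemma induced_Z_edge S o v : o \in S -> v \in S -> adj o v ->
  (\sum_(D : {set V * V} | is_matching D && (covered D \subset S) && (edge o v \in D))
      x ^+ #|S :\: covered D|
   = induced_Z (S :\ o :\ v))%R.
Proof.
move=> oS vS ov; rewrite /induced_Z.
rewrite (reindex_onto (fun D => edge o v |: D) (fun D => D :\ edge o v)); last first.
  by move=> D /andP[_ ovD]; exact: finset.setD1K.
apply: eq_big => D; last first.
  move=> _; congr (_ ^+ _)%R; apply: eq_card => w; rewrite covered_edgeU !inE negb_or.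
  by case: (w == o); case: (w == v); case: (covers D w); case: (w \in S).
rewrite !subsetD1 finset.setU11 andbT; apply/idP/idP.
  move=> /andP[/andP[mU sU] /eqP DE]; rewrite (matching_subset mU) ?subsetU1//=.
  have cD := covered_edgeD mU (finset.setU11 _ _); rewrite DE in cD.
  rewrite cD !finset.in_setD !inE !eqxx/= orbT/= !andbT.
  by apply: fintype.subset_trans sU; rewrite finset.subsetDl.
move=> /andP[mD /andP[/andP[sD oD] vD]]; rewrite (matching_edgeU mD ov oD vD).
rewrite covered_edgeU !finset.subUset !finset.sub1set oS vS sD /= finset.setU1K//.
by apply: contra oD => /mem_covered_edge/andP[].
Qed.

Lemma induced_Z_rec S o : o \in S ->
  (induced_Z S = x * induced_Z (S :\ o) + \sum_(v in S :\ o | adj o v) induced_Z (S :\ o :\ v))%R.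
Proof.
move=> oS; rewrite [LHS](bigID (fun D => o \notin covered D))/= induced_Z_uncovered//.
congr (_ + _)%R.
rewrite (partition_big (partner^~ o) (fun v => (v \in S :\ o) && adj o v)); last first.
  move=> D /andP[/andP[mD sD] /negPn oD]; have [v ov vD] := matching_edgeP mD oD.
  have /eqP -> : partner D o == v by rewrite partnerE.
  rewrite /= ov andbT in_setD1 eq_sym adj_neq//.
  by apply: (fintype.subsetP sD); case/andP: (mem_covered_edge vD).
apply: eq_bigr => v /andP[]; rewrite in_setD1 => /andP[_ vS] ov.
rewrite -induced_Z_edge//; apply: eq_bigl => D; rewrite -[LHS]andbA.
apply: andb_id2l => /andP[mD _].
apply/andP/idP => [[/negPn oD /=]|ovD]; first by rewrite partnerE.
have /andP[oD _] := mem_covered_edge ovD.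
by rewrite oD /= partnerE.
Qed.

Lemma induced_Z0 : induced_Z finset.set0 = 1%R.
Proof.
rewrite /induced_Z (big_pred1 finset.set0) ?finset.set0D ?cards0//.
move=> D; rewrite finset.subset0; apply/idP/eqP => [/andP[mD /eqP cD]|->].
  have := card_covered mD; rewrite cD cards0 => /esym/eqP.
  by rewrite muln_eq0/= cards_eq0 => /eqP.
by rewrite matching0 covered0 eqxx.
Qed.

End partition_function.

End matchings.

Lemma induced_Z_rmorph {G : simple_graph} (K K' : comNzRingType) (f : {rmorphism K -> K'})
    (x : K) (S : {set 'I_(nv G)}) :
  induced_Z (f x) S = f (induced_Z x S).
Proof. by rewrite /induced_Z rmorph_sum; apply: eq_bigr => D _; rewrite rmorphXn. Qed.

Section monomer_dimer.
Context {R : realType} {G : simple_graph}.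
Local Notation V := 'I_(nv G).
Local Open Scope set_scope.
Implicit Types (S : {set V}) (o v : V) (x : R).

Lemma mdZ_induced x : mdZ G x = induced_Z x [set: V].
Proof.
apply: eq_big => D; first by rewrite finset.subsetT andbT.
by move=> mD; rewrite -card_covered// cardsD cardsT card_ord finset.setTI.
Qed.

Definition induced_R x S o : R := (x * induced_Z x (S :\ o) / induced_Z x S)%R.

Lemma mdR_induced x o : mdR G x o = induced_R x [set: V] o.
Proof.
rewrite /mdR mdZ_induced /induced_R -induced_Z_uncovered ?inE//; congr (_ / _)%R.
apply: eq_big => D; first by rewrite finset.subsetT andbT inE.
by move=> /andP[mD _]; rewrite -card_covered// cardsD cardsT card_ord finset.setTI.
Qed.

Lemma induced_Z_gt0 x S : (0 < x -> 0 < induced_Z x S)%R.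
Proof.
move=> x0; rewrite /induced_Z (bigD1 finset.set0)/= ?matching0 ?covered0 ?finset.sub0set//.
rewrite ltr_wpDr ?exprn_gt0//; apply: sumr_ge0 => D _.
by rewrite exprn_ge0// ltW.
Qed.

Lemma induced_R_rec x S o : (0 < x)%R -> o \in S ->
  (induced_R x S o =
   x ^+ 2 / (x ^+ 2 + \sum_(v in S :\ o | adj o v) induced_R x (S :\ o) v))%R.
Proof.
move=> x0 oS; rewrite /induced_R (induced_Z_rec _ oS) -mulr_suml -mulr_sumr.
set A := induced_Z x (S :\ o); set B := (\sum_(v in _ | _) _)%R.
have A0 : (0 < A)%R by exact: induced_Z_gt0.
have B0 : (0 <= B)%R by apply: sumr_ge0 => v _; exact/ltW/induced_Z_gt0.
field; apply/and3P; split; rewrite gt_eqF//.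
- by rewrite ltr_wpDr ?mulr_gt0// mulr_ge0// ltW.
- by rewrite ltr_wpDr// mulr_gt0.
Qed.

Lemma induced_R_bounds x S o : (0 < x)%R -> o \in S -> (0 <= induced_R x S o <= 1)%R.
Proof.
move=> x0 oS; apply/andP; split.
  by rewrite /induced_R divr_ge0 ?mulr_ge0 ?(ltW x0) ?(ltW (induced_Z_gt0 _ x0)).
rewrite /induced_R ler_pdivrMr ?induced_Z_gt0// mul1r (induced_Z_rec _ oS) lerDl.
by apply: sumr_ge0 => v _; exact/ltW/induced_Z_gt0.
Qed.

End monomer_dimer.

Section matching_polynomial.
Context {G : simple_graph}.
Local Notation V := 'I_(nv G).
Variable K : comNzRingType.
Implicit Types S : {set V}.

Lemma horner_induced_Z S (x : K) : (induced_Z ('X : {poly K}) S).[x] = induced_Z x S.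
Proof. by rewrite /induced_Z horner_sum; apply: eq_bigr => D _; rewrite hornerXn. Qed.

Lemma size_induced_Z S : (size (induced_Z ('X : {poly K}) S) <= #|S|.+1)%N.
Proof.
apply: (leq_trans (size_sum _ _ _)); apply/bigmax_leqP => D _.
by rewrite size_polyXn ltnS subset_leq_card// finset.subsetDl.
Qed.

Lemma deriv_induced_Z S :
  (induced_Z ('X : {poly K}) S)^`() = \sum_(v in S) induced_Z 'X (S :\ v)%SET.
Proof.
rewrite /induced_Z raddf_sum.
under [RHS]eq_bigr => v vS.
  under eq_bigl do rewrite finset.subsetD1 andbA.
  over.
pose inside D := is_matching D && (covered D \subset S).
rewrite (exchange_big_dep inside)/=; last by move=> v D _ /andP[].
apply: eq_bigr => D /andP[mD sD]; rewrite derivXn.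
rewrite (eq_bigl (fun v => v \in S :\: covered D)%SET); last first.
  by move=> v; rewrite mD sD /= finset.in_setD andbC.
rewrite (eq_bigr (fun=> 'X^(#|S :\: covered D|.-1)%SET)); last first.
  move=> v vS; congr ('X^_); rewrite [in RHS](cardsD1 v) vS /=.
  by apply: eq_card => w; rewrite !inE andbCA.
by rewrite sumr_const.
Qed.

End matching_polynomial.

Definition expected_monomers (G : simple_graph) {K : fieldType} (x : K) : K :=
  x * (\sum_v induced_Z x ([set: 'I_(nv G)] :\ v)%SET) / induced_Z x [set: 'I_(nv G)]%SET.

Lemma expected_monomers_rmorph {G : simple_graph} (K K' : fieldType) (f : {rmorphism K -> K'})
    (x : K) :
  expected_monomers G (f x) = f (expected_monomers G x).
Proof.
rewrite /expected_monomers !rmorphM fmorphV rmorph_sum induced_Z_rmorph.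
by congr (_ * _ / _); apply: eq_bigr => v _; exact: induced_Z_rmorph.
Qed.

Lemma expected_monomers_deriv {G : simple_graph} {K : fieldType} (x : K)
    (p : {poly K} := induced_Z 'X [set: 'I_(nv G)]%SET) :
  expected_monomers G x = x * (p^`().[x] / p.[x]).
Proof.
rewrite /expected_monomers horner_induced_Z deriv_induced_Z horner_sum -mulrA.
congr (_ * (_ / _)); apply: eq_big => v; first by rewrite inE.
by rewrite horner_induced_Z.
Qed.

Lemma mean_R_expected {R : realType} (G : simple_graph) (x : R) :
  mean_R G x = expected_monomers G x / (nv G)%:R.
Proof.
rewrite /mean_R; under eq_bigr do rewrite mdR_induced /induced_R.
by rewrite -mulr_suml -mulr_sumr.
Qed.

Lemma derive_ln_mdZ {R : realType} (G : simple_graph) (x : R) : 0 < x ->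
  x * derive1 (fun y => ln (mdZ G y) / (nv G)%:R) x = mean_R G x.
Proof.
move=> x0; pose p : {poly R} := induced_Z 'X [set: 'I_(nv G)]%SET.
have mdZE y : mdZ G y = p.[y] by rewrite mdZ_induced horner_induced_Z.
have px0 : 0 < p.[x] by rewrite horner_induced_Z induced_Z_gt0.
have ln_p : is_derive x 1 (@ln R \o horner p) (p.[x]^-1 * p^`().[x]).
  by apply: is_derive1_comp; exact: is_derive1_ln.
have -> : derive1 (fun y => ln (mdZ G y) / (nv G)%:R) x = (nv G)%:R^-1 * (p.[x]^-1 * p^`().[x]).
  rewrite derive1E (_ : (fun y => _) = (nv G)%:R^-1 \*: (@ln R \o horner p)); last first.
    by apply/funext => y /=; rewrite mdZE mulrC.
  exact: derive_val.
by rewrite mean_R_expected expected_monomers_deriv -/p; ring.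
Qed.

(** * The Heilmann--Lieb theorem and analyticity *)

Section heilmann_lieb.
Context {C : numClosedFieldType} {G : simple_graph}.
Local Notation V := 'I_(nv G).
Implicit Types (S : {set V}) (z t : C).

Lemma Re_inv_gt0 z : 0 < 'Re z -> 0 < 'Re z^-1.
Proof.
move=> z0; have zn0 : z != 0 by apply: contraTneq z0 => ->; rewrite raddf0 ltxx.
rewrite invC_norm ReMl ?Re_conj; last by rewrite rpredV rpredX// normr_real.
by rewrite mulr_gt0// invr_gt0 exprn_gt0// normr_gt0.
Qed.

(* Induction on [#|S|]: by the recursion the ratio is [z] plus inverses of ratios of
   smaller sets, and inversion preserves the open right half-plane. *)
Lemma heilmann_lieb z S : 0 < 'Re z -> induced_Z z S != 0 /\
  forall o, o \in S -> 0 < 'Re (induced_Z z S / induced_Z z (S :\ o)%SET).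
Proof.
move=> z0; have [n] := ubnP #|S|; elim: n S => // n IH S; rewrite ltnS => Sn.
have ratio o : o \in S -> 0 < 'Re (induced_Z z S / induced_Z z (S :\ o)%SET).
  move=> oS; have So : (#|S :\ o| < n)%N%SET by move: Sn; rewrite (cardsD1 o) oS.
  have [nz smaller] := IH _ So; rewrite (induced_Z_rec _ oS) mulrDl mulfK// raddfD ltr_pwDl//.
  rewrite mulr_suml raddf_sum; apply: sumr_ge0 => v /andP[vS _].
  rewrite -[induced_Z z (_ :\ v)%SET / _]invf_div; exact/ltW/Re_inv_gt0/smaller.
split=> //; have [->| [v vS]] := set_0Vmem S; first by rewrite induced_Z0 oner_neq0.
by apply: contraTneq (ratio v vS) => ->; rewrite mul0r raddf0 ltxx.
Qed.

Lemma log_deriv_prod_XsubC (K : fieldType) (r : seq K) (x : K) : x \notin r ->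
  (\prod_(t <- r) ('X - t%:P))^`().[x] =
  (\prod_(t <- r) ('X - t%:P)).[x] * \sum_(t <- r) (x - t)^-1.
Proof.
elim: r => [|t r IH]; first by rewrite !big_nil derivC hornerC mulr0.
rewrite inE negb_or => /andP[xt xr].
rewrite !big_cons derivM derivB derivX derivC subr0 mul1r hornerD !hornerM IH// hornerXsubC.
by move: (_.[x]) (\sum_(_ <- _) _) => A B; field; rewrite subr_eq0.
Qed.

Lemma expected_monomers_roots : exists r : seq C,
  [/\ (size r <= nv G)%N, {in r, forall t, 'Re t <= 0} &
      forall z, 0 < 'Re z -> expected_monomers G z = \sum_(t <- r) z / (z - t)].
Proof.
pose p : {poly C} := induced_Z 'X [set: V]%SET.
have pz z : 0 < 'Re z -> p.[z] != 0.
  by move=> z0; rewrite horner_induced_Z; case: (heilmann_lieb [set: V]%SET z0).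
have p0 : p != 0.
  have : p.[1] != 0 by apply: pz; rewrite (Creal_ReP _ (real1 _)) ltr01.
  by apply: contraNneq => ->; rewrite hornerC.
have [r] := closed_field_poly_normal p; set l := lead_coef p => pE.
have l0 : l != 0 by rewrite lead_coef_eq0.
have rootE z : (z \in r) = (p.[z] == 0).
  by rewrite -root_prod_XsubC /root [in RHS]pE hornerZ mulf_eq0 (negbTE l0).
exists r; split=> [|t tr|z z0].
- have := size_induced_Z C [set: V]%SET; rewrite -/p pE size_scale// size_prod_XsubC.
  by rewrite cardsT card_ord ltnS.
- rewrite real_leNgt ?Creal_Re ?real0//.
  by apply: contraL tr => /pz; rewrite rootE.
have zr : z \notin r by rewrite rootE pz.
rewrite -mulr_sumr expected_monomers_deriv -/p; congr (_ * _).
have pr0 : (\prod_(t <- r) ('X - t%:P)).[z] != 0 by rewrite -/(root _ _) root_prod_XsubC.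
rewrite {1 2}pE derivZ !hornerZ log_deriv_prod_XsubC//.
by rewrite -mulf_div divff// mul1r mulrAC divff// mul1r.
Qed.

End heilmann_lieb.

Section root_term.
Context {C : numClosedFieldType}.
Variables (t a : C).
Hypotheses (t0 : 'Re t <= 0) (a0 : 0 < a).
Implicit Types x h : C.

Lemma le_norm_sub_root x : 0 < x -> x <= `|x - t|.
Proof.
move=> x0; apply: le_trans ((leif_normC_Re_Creal _).1).
rewrite raddfB/= (Creal_ReP x (gtr0_real x0)).
apply: (@le_trans _ _ (x - 'Re t)); first by rewrite lerDl oppr_ge0.
by rewrite real_ler_norm// rpredB ?Creal_Re// gtr0_real.
Qed.

Lemma sub_root_neq0 x : 0 < x -> x - t != 0.
Proof. by move=> x0; rewrite -normr_gt0; exact: lt_le_trans (le_norm_sub_root x0). Qed.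

Lemma norm_root_le x : 0 < x -> `|t| <= 2 * `|x - t|.
Proof.
move=> x0; rewrite -[in leLHS](subKr x t) (le_trans (ler_normB _ _))// gtr0_norm//.
by rewrite -natr1 mulrDl mul1r lerD2r le_norm_sub_root.
Qed.

(* The Taylor coefficients at [a] of [x / (x - t) = 1 + t / (x - t)]. *)
Definition root_coef n : C := (n == 0)%:R + (-1) ^+ n * t / (a - t) ^+ n.+1.

Lemma root_term_remainder h M : a + h - t != 0 ->
  (a + h) / (a + h - t) - \sum_(n < M.+1) root_coef n * h ^+ n =
  t * (- h / (a - t)) ^+ M.+1 / (a + h - t).
Proof.
have := sub_root_neq0 a0; rewrite [a + h - t]addrAC; set w := a - t => w0 wh0.
have aE : a = w + t by rewrite /w subrK.
have coefE n : root_coef n * h ^+ n = (n == 0)%:R + t / w * (- h / w) ^+ n.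
  rewrite /root_coef -/w mulrDl; congr (_ + _); first by case: n => [|n]; rewrite ?mul0r ?mulr1.
  by rewrite -[- h]mulN1r !exprMn exprVn exprS invfM; ring.
under eq_bigr do rewrite coefE.
rewrite {1}aE; elim: M => [|M IH].
  rewrite big_ord_recr big_ord0 /= add0r expr0 mulr1 expr1.
  by field; rewrite w0 wh0.
rewrite big_ord_recr opprD addrA IH /= add0r [in RHS]exprSr.
by move: (_ ^+ M.+1) => q; field; rewrite w0 wh0.
Qed.

Lemma root_term_remainder_le h M : h \is Num.real -> `|h| < a ->
  `|(a + h) / (a + h - t) - \sum_(n < M.+1) root_coef n * h ^+ n| <= 2 * (`|h| / a) ^+ M.+1.
Proof.
move=> hr ha; have ah0 : 0 < a + h.
  by move: ha; rewrite real_ltr_norml// -ltrBlDl sub0r => /andP[].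
rewrite root_term_remainder ?sub_root_neq0// mulrAC normrM normf_div normrX normf_div normrN.
apply: ler_pM; rewrite ?divr_ge0 ?exprn_ge0 ?divr_ge0//.
  by rewrite ler_pdivrMr ?norm_root_le// normr_gt0 sub_root_neq0.
rewrite lerXn2r ?nnegrE ?divr_ge0 ?(ltW a0)// ler_wpM2l//.
by rewrite lef_pV2 ?posrE// ?le_norm_sub_root// normr_gt0 sub_root_neq0.
Qed.

End root_term.

Definition power_approx {R : numFieldType} (K a : R) (f : R -> R) (c : nat -> R) : Prop :=
  forall h M, h \is Num.real -> `|h| < a ->
    `|f h - \sum_(n < M.+1) c n * h ^+ n| <= K * (`|h| / a) ^+ M.+1.

Lemma expected_monomers_approx {C : numClosedFieldType} (G : simple_graph) (a : C) : 0 < a ->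
  exists c, power_approx ((nv G)%:R * 2) a (fun h => expected_monomers G (a + h)) c.
Proof.
move=> a0; have [r [size_r r_neg emE]] := @expected_monomers_roots C G.
exists (fun n => \sum_(t <- r) root_coef t a n) => h M hr ha.
have ah0 : 0 < a + h by move: ha; rewrite real_ltr_norml// -ltrBlDl sub0r => /andP[].
rewrite emE; last by rewrite (Creal_ReP _ (gtr0_real ah0)).
under [X in _ - X]eq_bigr do rewrite mulr_suml.
rewrite exchange_big -sumrB (le_trans (ler_norm_sum _ _ _))//.
apply: (@le_trans _ _ (\sum_(t <- r) 2 * (`|h| / a) ^+ M.+1)).
  rewrite big_seq [leRHS]big_seq; apply: ler_sum => t tr.
  by apply: root_term_remainder_le => //; exact: r_neg.
rewrite big_const_seq count_predT iter_addr_0 -[leLHS]mulr_natl -mulrA ler_wpM2r ?ler_nat//.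
by rewrite mulr_ge0// exprn_ge0// divr_ge0// ltW.
Qed.

Section real_part.
Context {R : realType}.
Local Notation "x %:C" := (real_complex R x).

Lemma normr_real_complex (x : R) : `|x%:C| = `|x|%:C.
Proof. by rewrite complex.normc_def /= expr0n addr0 sqrtr_sqr. Qed.

Lemma mean_R_approx (G : simple_graph) (a : R) : 0 < a ->
  exists c, power_approx 2 a (fun h => mean_R G (a + h)) c.
Proof.
move=> a0; have a0C : 0 < a%:C by rewrite complex.ltcR.
have [c emc] := expected_monomers_approx G a0C.
exists (fun n => complex.Re (c n) / (nv G)%:R) => h M _ ha.
have [nv0|nv0] := posnP (nv G).
  have -> : (nv G)%:R = 0 :> R by rewrite nv0.
  rewrite mean_R_expected nv0 invr0 mulr0 sub0r normrN.
  rewrite big1 ?normr0 ?mulr_ge0 ?exprn_ge0 ?divr_ge0 ?(ltW a0)// => n _.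
  by rewrite mulr0 mul0r.
under eq_bigr do rewrite mulrAC.
rewrite mean_R_expected -mulr_suml -mulrBl normf_div normr_nat.
rewrite ler_pdivrMr ?ltr0n// mulrC mulrA -complex.lecR -normr_real_complex.
have hr : h%:C \is Num.real by rewrite complex.complex_real.
have hC : `|h%:C| < a%:C by rewrite normr_real_complex complex.ltcR.
have := emc _ M hr hC; rewrite -rmorphD /= expected_monomers_rmorph normr_real_complex => approx.
rewrite !rmorphM !rmorph_nat rmorphXn fmorph_div.
apply: le_trans approx.
apply: le_trans (leif_normC_Re_Creal _).1.
have em_real : (@expected_monomers G R (a + h))%:C \is Num.real by rewrite complex.complex_real.
rewrite rmorphB raddfB /= (Creal_ReP _ em_real).
rewrite rmorph_sum [in leRHS]raddf_sum le_eqVlt; apply/orP; left; apply/eqP; congr (`|_ - _|).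
by apply: eq_bigr => n _; rewrite rmorphM rmorphXn /= complex.complexRe ReMr// rpredX.
Qed.

End real_part.

Section power_approx_limit.
Local Open Scope classical_set_scope.
Context {R : realType}.
Variables (K a : R) (g : nat -> R -> R) (f : R -> R) (c : nat -> nat -> R).
Hypotheses (K0 : 0 < K) (a0 : 0 < a)
  (g_approx : forall k, power_approx K a (g k) (c k))
  (g_cvg : forall h, `|h| < a -> (fun k => g k h) @ \oo --> f h).

Let coef_quotient h n k := (g k h - \sum_(i < n) c k i * h ^+ i) / h ^+ n.

Lemma coef_quotient_close h n k : 0 < h < a ->
  `|coef_quotient h n k - c k n| <= K * h / a ^+ n.+1.
Proof.
move=> /andP[h0 ha]; have hn0 : 0 < h ^+ n by rewrite exprn_gt0.
have hE : `|h| = h by rewrite gtr0_norm.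
rewrite -(ler_pM2r hn0) -[X in _ * X](gtr0_norm hn0) -normrM mulrBl.
rewrite /coef_quotient divfK ?gt_eqF//.
have := @g_approx k h n (num_real h); rewrite big_ord_recr/= opprD addrA hE => /(_ ha).
by move/le_trans; apply; rewrite expr_div_n exprS le_eqVlt; apply/orP; left; apply/eqP; ring.
Qed.

Lemma exists_small_step n e : 0 < e -> exists2 h, 0 < h < a & K * h / a ^+ n.+1 <= e.
Proof.
move=> e0; have an0 : 0 < a ^+ n.+1 by rewrite exprn_gt0.
exists (Num.min (a / 2) (e * a ^+ n.+1 / K)).
  rewrite lt_min divr_gt0//= divr_gt0 ?mulr_gt0//= gt_min; apply/orP; left.
  by rewrite ltr_pdivrMr// ltr_pMr// ltr1n.
by rewrite ler_pdivrMr// mulrC -ler_pdivlMr// ge_min lexx orbT.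
Qed.

Lemma power_coef_cvg n : cvg ((fun k => c k n) @ \oo).
Proof.
have [m] := ubnP n; elim: m n => // m IH n; rewrite ltnS => nm.
apply/cauchy_cvgP/cauchyP => /= e e0; have e4 : 0 < e / 4 by rewrite divr_gt0.
have [h hI he] := exists_small_step n e4.
have quotient_cvg : cvg (coef_quotient h n @ \oo).
  apply/cvg_ex; exists ((f h - \sum_(i < n) limn (fun k => c k i) * h ^+ i) / h ^+ n).
  apply: cvgM; last exact: cvg_cst.
  apply: cvgB; first by apply: g_cvg; case/andP: hI => h0 ha; rewrite gtr0_norm.
  apply: cvg_big => [|i _]; first exact: add_continuous.
  by apply: cvgM; [exact: IH (leq_trans (ltn_ord i) nm) | exact: cvg_cst].
exists (limn (coef_quotient h n)); have /cvgrPdist_lt/(_ _ e4) := quotient_cvg.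
apply: filterS => k /=; rewrite /ball /= => qk.
have close := le_trans (coef_quotient_close n k hI) he.
set q := coef_quotient h n k in qk close.
rewrite (_ : limn _ - c k n = (limn (coef_quotient h n) - q) + (q - c k n)); last by ring.
by apply: le_lt_trans (ler_normD _ _) _; lra.
Qed.

Lemma power_approx_limit : power_approx K a f (fun n => limn (fun k => c k n)).
Proof.
move=> h M hr ha; set d := fun n => limn (fun k => c k n).
have dist_cvg : (fun k => `|g k h - \sum_(n < M.+1) c k n * h ^+ n|) @ \oo -->
    `|f h - \sum_(n < M.+1) d n * h ^+ n|.
  apply: cvg_norm; apply: cvgB; first exact: g_cvg.
  apply: cvg_big => [|n _]; first exact: add_continuous.
  by apply: cvgM; [exact: power_coef_cvg | exact: cvg_cst].
by apply: (cvgr_to_le dist_cvg); apply: nearW => k; exact: g_approx.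
Qed.

End power_approx_limit.

Section analyticity.
Local Open Scope classical_set_scope.
Context {R : realType}.

Lemma power_approx_cvg (K a : R) (f : R -> R) (c : nat -> R) : 0 < a -> power_approx K a f c ->
  forall h, `|h| < a -> (fun N => \sum_(n < N) c n * h ^+ n) @ \oo --> f h.
Proof.
move=> a0 fc h ha; rewrite -(cvg_shiftn 1).
have ratio_lt1 : `| `|h| / a | < 1.
  by rewrite ger0_norm ?divr_ge0 ?(ltW a0)// ltr_pdivrMr// mul1r.
have bound_cvg : (fun M => K * (`|h| / a) ^+ M.+1) @ \oo --> (0 : R).
  rewrite -(mulr0 K); apply: cvgM; first exact: cvg_cst.
  by have := cvg_expr ratio_lt1; rewrite -(cvg_shiftS (fun n => (`|h| / a) ^+ n)).
apply/cvgrPdist_le => e e0; have /cvgrPdist_le/(_ _ e0) := bound_cvg.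
apply: filterS => M /=; rewrite sub0r normrN addn1 => le_e.
by apply: le_trans (fc h M (num_real h) ha) (le_trans (ler_norm _) le_e).
Qed.

Lemma mean_R_limit_analytic (G : nat -> simple_graph) (f : R -> R) :
  (forall x, 0 < x -> (fun n => mean_R (G n) x) @ \oo --> f x) ->
  real_analytic_on [set x : R | 0 < x] f.
Proof.
move=> Gf a /= a0; exists a => //.
have [c cP] := choice (fun n => mean_R_approx (G n) a0).
have shift_cvg h : `|h| < a -> (fun n => mean_R (G n) (a + h)) @ \oo --> f (a + h).
  by rewrite ltr_norml => /andP[ha _]; apply: Gf; lra.
exists (fun n => limn (fun k => c k n)) => y ya.
have := power_approx_limit (ltr0Sn R 1) a0 cP shift_cvg.
by move=> /(power_approx_cvg a0)/(_ _ ya); rewrite [a + _]addrC subrK.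
Qed.

End analyticity.

(** * The truncated cavity map *)

Section truncations.
Context {R : realFieldType}.
Implicit Types c y z s t : R.

Definition pospart s : R := Num.max 0 s.

Definition clip01 y : R := Num.max 0 (Num.min 1 y).

(* On [s < 0] the truncation keeps the denominator away from [0]. *)
Definition cavity c s : R := c / (c + pospart s).

Lemma pospart_ge0 s : 0 <= pospart s. Proof. by rewrite le_max lexx. Qed.

Lemma pospart_id s : 0 <= s -> pospart s = s.
Proof. by move=> s0; rewrite /pospart max_r. Qed.

Lemma pospartK s : pospart (pospart s) = pospart s.
Proof. exact/pospart_id/pospart_ge0. Qed.

Lemma pospart_homo : {homo pospart : s t / s <= t}.
Proof.
by move=> s t st; rewrite /pospart; case: (leP 0 s) => ?; case: (leP 0 t) => ?; lra.
Qed.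

Lemma clip01_ge0 y : 0 <= clip01 y. Proof. by rewrite le_max lexx. Qed.

Lemma clip01_le1 y : clip01 y <= 1.
Proof. by rewrite ge_max ler01 ge_min lexx. Qed.

Lemma clip01E y : clip01 y = if y <= 0 then 0 else if 1 <= y then 1 else y.
Proof.
rewrite /clip01; case: (leP 1 y) => ?; case: (leP y 0) => ? //; first by lra.
by rewrite max_r.
Qed.

Lemma clip01_id y : 0 <= y <= 1 -> clip01 y = y.
Proof. by case/andP=> y0 y1; rewrite /clip01 min_r// max_r. Qed.

Lemma clip01_homo : {homo clip01 : y z / y <= z}.
Proof.
move=> y z yz; rewrite !clip01E.
by case: (leP y 0) => ?; case: (leP 1 y) => ?; case: (leP z 0) => ?; case: (leP 1 z) => ?; lra.
Qed.

Lemma cavityE c s : 0 <= s -> cavity c s = c / (c + s).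
Proof. by move=> s0; rewrite /cavity pospart_id. Qed.

Lemma cavity_den_gt0 c s : 0 < c -> 0 < c + pospart s.
Proof. by move=> c0; rewrite ltr_wpDr// pospart_ge0. Qed.

Lemma cavity_ge0 c s : 0 < c -> 0 <= cavity c s.
Proof. by move=> c0; rewrite divr_ge0// ltW// cavity_den_gt0. Qed.

Lemma cavity_le1 c s : 0 < c -> cavity c s <= 1.
Proof.
by move=> c0; rewrite ler_pdivrMr ?cavity_den_gt0// mul1r lerDl pospart_ge0.
Qed.

Lemma cavity_bounds c s : 0 < c -> 0 <= cavity c s <= 1.
Proof. by move=> c0; rewrite cavity_ge0// cavity_le1. Qed.

Lemma cavityB c s t : 0 < c ->
  cavity c s - cavity c t = c * (pospart t - pospart s) / ((c + pospart s) * (c + pospart t)).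
Proof.
move=> c0; rewrite /cavity; field.
by rewrite !gt_eqF ?cavity_den_gt0.
Qed.

Lemma cavity_anti c : 0 < c -> {homo cavity c : s t /~ s <= t}.
Proof.
move=> c0 s t st; rewrite -subr_ge0 cavityB// divr_ge0//.
  by rewrite mulr_ge0 ?(ltW c0)// subr_ge0 pospart_homo.
by rewrite mulr_ge0// ltW// cavity_den_gt0.
Qed.

Lemma cavity_slope c K s t : 0 < c -> 0 <= s -> s <= t -> t <= K ->
  c / (c + K) ^+ 2 * (t - s) <= cavity c s - cavity c t.
Proof.
move=> c0 s0 st tK; rewrite cavityB// !pospart_id ?(le_trans s0)// mulrAC.
have [cs0 ct0 cK0] : [/\ 0 < c + s, 0 < c + t & 0 < c + K] by split; lra.
rewrite ler_wpM2l ?mulr_ge0 ?(ltW c0) ?subr_ge0// lef_pV2 ?posrE ?mulr_gt0 ?exprn_gt0//.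
by rewrite expr2; apply: ler_pM; rewrite ?(ltW cs0) ?(ltW ct0)//; lra.
Qed.

Lemma homo_nonexpansive (f : R -> R) : {homo f : y z / y <= z} ->
  (forall y z, y <= z -> f z - f y <= z - y) -> forall y z, `|f y - f z| <= `|y - z|.
Proof.
move=> f_homo f_exp y z; wlog yz : y z / y <= z.
  by move=> wlog_yz; have [/wlog_yz//|/ltW/wlog_yz] := leP y z; rewrite distrC [leRHS]distrC.
by rewrite distrC [leRHS]distrC !ger0_norm ?subr_ge0 ?f_homo// f_exp.
Qed.

Lemma pospart_nonexpansive s t : `|pospart s - pospart t| <= `|s - t|.
Proof.
apply: homo_nonexpansive => [|{}s {}t st]; first exact: pospart_homo.
by rewrite /pospart; case: (leP 0 s) => ?; case: (leP 0 t) => ?; lra.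
Qed.

Lemma clip01_nonexpansive y z : `|clip01 y - clip01 z| <= `|y - z|.
Proof.
apply: homo_nonexpansive => [|{}y {}z yz]; first exact: clip01_homo.
rewrite !clip01E.
by case: (leP y 0) => ?; case: (leP 1 y) => ?; case: (leP z 0) => ?; case: (leP 1 z) => ?; lra.
Qed.

Lemma cavityB_le c s t : 0 < c -> `|cavity c s - cavity c t| <= c^-1 * `|s - t|.
Proof.
move=> c0; rewrite cavityB// !normrM normfV (gtr0_norm c0).
have den0 : 0 < (c + pospart s) * (c + pospart t) by rewrite mulr_gt0 ?cavity_den_gt0.
rewrite (gtr0_norm den0) ler_pdivrMr//.
apply: (@le_trans _ _ (c * `|s - t|)).
  by rewrite ler_wpM2l ?(ltW c0)// distrC pospart_nonexpansive.
rewrite -mulrA [leRHS]mulrCA [leRHS]mulrC ler_wpM2r// ler_pdivlMl//.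
by apply: ler_pM; rewrite ?(ltW c0)// lerDl pospart_ge0.
Qed.

End truncations.

(** * Plane trees and self-avoiding walks *)

Section plane_trees.
Implicit Types (t T : {fset word}) (u w : word) (ts : seq {fset word}).

Definition is_child u w : bool := (size w == (size u).+1) && (take (size u) w == u).

Lemma is_childP u w : reflect (exists i, w = rcons u i) (is_child u w).
Proof.
apply: (iffP andP) => [[/eqP size_w /eqP take_w]|[i ->]].
  case/lastP: w size_w take_w => // w i; rewrite size_rcons => -[size_w].
  by rewrite -cats1 take_cat size_w ltnn subnn take0 cats0 => <-; exists i; rewrite cats1.
by rewrite size_rcons eqxx -cats1 take_cat ltnn subnn take0 cats0.
Qed.

Lemma is_child_inj u u' w : is_child u w -> is_child u' w -> u = u'.
Proof. by move=> /is_childP[i ->] /is_childP[j /rcons_inj[]]. Qed.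

Lemma tadjE u w : tadj u w = is_child u w || is_child w u.
Proof. by []. Qed.

Lemma downset_size (s : seq nat) : uniq s ->
  (forall i j, i \in s -> (j < i)%N -> j \in s) -> forall i, (i \in s) = (i < size s)%N.
Proof.
move=> us down i; apply/idP/idP => [si|].
  have sub : {subset iota 0 i.+1 <= s}.
    by move=> j; rewrite mem_iota add0n ltnS /= leq_eqVlt => /predU1P[->//|]; exact: down.
  by have := uniq_leq_size (iota_uniq 0 i.+1) sub; rewrite size_iota.
apply: contraLR => ns; rewrite -leqNgt -(size_iota 0 i).
apply: uniq_leq_size => // j sj; rewrite mem_iota add0n /= ltnNge leq_eqVlt.
apply/negP => /predU1P[ij|ij]; first by rewrite ij sj in ns.
by rewrite (down _ _ sj ij) in ns.
Qed.

Lemma mem_rcons_ptree T u i : is_ptree T -> (rcons u i \in T) = (i < nchild T u)%N.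
Proof.
move=> [_ closedT]; pose children := seq.filter (is_child u) (enum_fset T).
have childrenP w : w \in children -> exists2 j, w = rcons u j & rcons u j \in T.
  by rewrite mem_filter => /andP[/is_childP[j ->] ?]; exists j.
have last_inj : {in children &, injective (last 0%N)}.
  by move=> _ _ /childrenP[j -> _] /childrenP[k -> _]; rewrite !last_rcons => ->.
have mem_label j : (j \in map (last 0%N) children) = (rcons u j \in T).
  apply/mapP/idP => [[_ /childrenP[k -> kT]]|jT]; first by rewrite last_rcons => ->.
  exists (rcons u j); last by rewrite last_rcons.
  by rewrite mem_filter jT andbT; apply/is_childP; exists j.
rewrite -mem_label /nchild -size_filter -(size_map (last 0%N) children); apply: downset_size.
  by rewrite map_inj_in_uniq// filter_uniq// fset_uniq.
by move=> j k; rewrite !mem_label => /closedT[_]; apply.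
Qed.

Lemma nchild_unique T u n : is_ptree T ->
  (forall i, (rcons u i \in T) = (i < n)%N) -> nchild T u = n.
Proof.
move=> pT mem_u; apply/eqP; rewrite eqn_leq; apply/andP; split; rewrite leqNgt; apply/negP => lt.
  by have := mem_rcons_ptree u n pT; rewrite mem_u lt ltnn.
by have := mem_rcons_ptree u (nchild T u) pT; rewrite mem_u lt ltnn.
Qed.

Definition node_seq ts : seq word :=
  [::] :: flatten [seq [seq i :: w | w <- enum_fset (nth fset0 ts i)] | i <- iota 0 (size ts)].

Definition node ts : {fset word} := [fset w in node_seq ts]%fset.

Lemma mem_node ts w : (w \in node ts) =
  if w is i :: w' then (i < size ts)%N && (w' \in nth fset0 ts i) else true.
Proof.
rewrite in_fset /=; case: w => [|i w]; first by rewrite inE.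
rewrite inE /=; apply/flatten_mapP/andP => [[j]|[ij wi]].
  by rewrite mem_iota add0n => jt /mapP[v vj [-> ->]].
by exists i; rewrite ?mem_iota//; apply/mapP; exists w.
Qed.

Lemma uniq_node_seq ts : uniq (node_seq ts).
Proof.
rewrite /node_seq cons_uniq; apply/andP; split.
  by apply/flatten_mapP => -[j _ /mapP[v _]].
elim: (iota 0 (size ts)) (iota_uniq 0 (size ts)) => //= i s IH /andP[ns us].
rewrite cat_uniq map_inj_uniq ?fset_uniq ?IH ?andbT//=; last by move=> a b [].
apply/hasPn => _ /flatten_mapP[j js /mapP[v _ ->]].
by apply/mapP => -[v' _ [ji _]]; rewrite -ji js in ns.
Qed.

Lemma perm_node ts : perm_eq (enum_fset (node ts)) (node_seq ts).
Proof.
apply: uniq_perm; [exact: fset_uniq | exact: uniq_node_seq|].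
by move=> w; rewrite -[LHS]/(w \in node ts) in_fset.
Qed.

Definition all_ptree ts : Prop := forall t, t \in ts -> is_ptree t.

Lemma is_ptree_node ts : all_ptree ts -> is_ptree (node ts).
Proof.
move=> pts; split; first by rewrite mem_node.
move=> [|i u] j; rewrite /= mem_node.
  move=> /andP[jt _]; split; first by rewrite mem_node.
  move=> k kj; rewrite mem_node (ltn_trans kj jt)/=.
  by have [] := pts _ (mem_nth fset0 (ltn_trans kj jt)).
move=> /andP[it uT]; have [_ closed_t] := pts _ (mem_nth fset0 it).
have [ut lt_j] := closed_t _ _ uT; rewrite mem_node it; split => // k kj.
by rewrite mem_node it lt_j.
Qed.

Lemma height_node ts r : (forall t, t \in ts -> height_le t r) -> height_le (node ts) r.+1.
Proof.
move=> hts [|i u] //; rewrite mem_node => /andP[it ut] /=.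
by rewrite ltnS; apply: hts ut; exact: mem_nth.
Qed.

Lemma nchild_node_root ts : all_ptree ts -> nchild (node ts) [::] = size ts.
Proof.
move=> pts; apply: nchild_unique; first exact: is_ptree_node.
move=> i; rewrite mem_node /=; case: ltnP => // it /=.
by have [] := pts _ (mem_nth fset0 it).
Qed.

Lemma nchild_node ts i u : all_ptree ts -> (i < size ts)%N ->
  nchild (node ts) (i :: u) = nchild (nth fset0 ts i) u.
Proof.
move=> pts it; apply: nchild_unique; first exact: is_ptree_node.
move=> j; rewrite rcons_cons mem_node it /= mem_rcons_ptree//.
by apply: pts; exact: mem_nth.
Qed.

Lemma node_inj ts ts' : all_ptree ts -> all_ptree ts' -> node ts = node ts' -> ts = ts'.
Proof.
move=> pts pts' node_eq.
have sz : size ts = size ts' by rewrite -nchild_node_root// node_eq nchild_node_root.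
apply: (@eq_from_nth _ fset0) => // i it; apply/fsetP => w.
have : (i :: w \in node ts) = (i :: w \in node ts') by rewrite node_eq.
by rewrite !mem_node -sz it.
Qed.

Lemma gw_weight_node (R : realType) (P rho : nat -> R) r ts : all_ptree ts ->
  gw_weight P rho r.+1 (node ts) = P (size ts) * \prod_(t <- ts) gw_weight rho rho r t.
Proof.
move=> pts; rewrite /gw_weight (perm_big _ (perm_node ts)) /= big_cons /=.
rewrite nchild_node_root//; congr (_ * _).
rewrite big_flatten big_map /= [RHS](big_nth fset0) /index_iota subn0.
rewrite big_seq [RHS]big_seq; apply: eq_bigr => i; rewrite mem_iota add0n => /= it.
rewrite big_map; apply: eq_big => u //= _; rewrite nchild_node//.
by case: eqP.
Qed.

Lemma gw_weight_height0 (R : realType) (P rho : nat -> R) t : gw_weight P rho 0 t = 1.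
Proof. by rewrite /gw_weight big_pred0. Qed.

Lemma gw_weight_ge0 (R : realType) (P rho : nat -> R) r t :
  (forall k, 0 <= P k) -> (forall k, 0 <= rho k) -> 0 <= gw_weight P rho r t.
Proof. by move=> P0 rho0; apply: prodr_ge0 => u _; case: ifP. Qed.

End plane_trees.

Section tree_cavity.
Context {R : realFieldType} (c : R).
Implicit Types (t : {fset word}) (u : word) (ts : seq {fset word}).

Fixpoint tree_cavity r t u : R :=
  if r is r'.+1 then cavity c (\sum_(i < nchild t u) tree_cavity r' t (rcons u i)) else 1.

Lemma tree_cavity_bounds r t u : 0 < c -> 0 <= tree_cavity r t u <= 1.
Proof. by move=> c0; case: r => [|r]; [rewrite /= ler01 lexx | exact: cavity_bounds]. Qed.

Lemma tree_cavity_subtree r ts i u : all_ptree ts -> (i < size ts)%N ->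
  tree_cavity r (node ts) (i :: u) = tree_cavity r (nth fset0 ts i) u.
Proof.
move=> pts it; elim: r u => //= r IH u; rewrite nchild_node//.
by congr cavity; apply: eq_bigr => j _; rewrite IH.
Qed.

Lemma tree_cavity_node r ts : all_ptree ts ->
  tree_cavity r.+1 (node ts) [::] = cavity c (\sum_(t <- ts) tree_cavity r t [::]).
Proof.
move=> pts /=; rewrite nchild_node_root//; congr cavity.
rewrite [RHS](big_nth fset0) big_mkord; apply: eq_bigr => i _.
by rewrite tree_cavity_subtree.
Qed.

End tree_cavity.

Section tree_enumeration.
Implicit Types (t : {fset word}) (ts : seq {fset word}).

Fixpoint kseqs (A : Type) k (s : seq A) : seq (seq A) :=
  if k is k'.+1 then [seq a :: l | a <- s, l <- kseqs k' s] else [:: [::]].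

Lemma mem_kseqs (A : eqType) k (s : seq A) l :
  (l \in kseqs k s) = (size l == k) && all (mem s) l.
Proof.
elim: k l => [|k IH] l /=; first by rewrite inE; case: l.
apply/allpairsP/idP => [[[a m] /= [aS mS ->]]|].
  by move: mS; rewrite IH => /andP[/eqP sm am]; rewrite /= sm eqxx aS.
by case: l => // a l /= /andP[sl /andP[aS lS]]; exists (a, l); split => //; rewrite IH lS andbT.
Qed.

Lemma uniq_kseqs (A : eqType) k (s : seq A) : uniq s -> uniq (kseqs k s).
Proof.
move=> us; elim: k => //= k IH; apply: allpairs_uniq => //.
by move=> [a l] [b m] _ _ /= [-> ->].
Qed.

Lemma big_kseqs (R : nmodType) (A : Type) k (s : seq A) (F : seq A -> R) :
  \sum_(l <- kseqs k.+1 s) F l = \sum_(a <- s) \sum_(l <- kseqs k s) F (a :: l).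
Proof. by rewrite /= big_flatten big_map; apply: eq_bigr => a _; rewrite big_map. Qed.

Lemma sum_kseqs_prod (R : comPzSemiRingType) (A : Type) k (s : seq A) (w : A -> R) :
  \sum_(l <- kseqs k s) \prod_(a <- l) w a = (\sum_(a <- s) w a) ^+ k.
Proof.
elim: k => [|k IH]; first by rewrite /= big_seq1 big_nil expr0.
rewrite big_kseqs exprS mulr_suml; apply: eq_bigr => a _.
by rewrite -IH mulr_sumr; apply: eq_bigr => l _; rewrite big_cons.
Qed.

(* The plane trees of height at most [r] whose vertices have fewer than [N] children. *)
Fixpoint trees N r : seq {fset word} :=
  if r is r'.+1
  then flatten [seq [seq node ts | ts <- kseqs k (trees N r')] | k <- iota 0 N]
  else [:: [fset [::]]%fset].

Lemma trees_ptree N r t : t \in trees N r -> is_ptree t /\ height_le t r.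
Proof.
elim: r t => [|r IH] t /=.
  rewrite inE => /eqP ->; split.
    split; first by rewrite inE.
    by move=> u i; rewrite inE => /eqP/(congr1 size); rewrite size_rcons.
  by move=> w; rewrite inE => /eqP ->.
move=> /flatten_mapP[k _ /mapP[ts]]; rewrite mem_kseqs => /andP[_ /allP ts_trees] ->.
split; first by apply: is_ptree_node => s /ts_trees /IH[].
by apply: height_node => s /ts_trees /IH[].
Qed.

Lemma kseqs_ptree N r k ts : ts \in kseqs k (trees N r) -> all_ptree ts /\ size ts = k.
Proof.
rewrite mem_kseqs => /andP[/eqP sz /allP ts_trees]; split => // t /ts_trees.
by case/trees_ptree.
Qed.

Lemma uniq_trees N r : uniq (trees N r).
Proof.
elim: r => //= r IH.
elim: (iota 0 N) (iota_uniq 0 N) => //= k s IHs /andP[ns us].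
rewrite cat_uniq IHs// andbT; apply/andP; split.
  rewrite map_inj_in_uniq ?uniq_kseqs// => ts ts' /kseqs_ptree[p _] /kseqs_ptree[p' _].
  exact: node_inj.
apply/hasPn => _ /flatten_mapP[j js /mapP[ts /kseqs_ptree[pts sz] ->]].
apply/mapP => -[ts' /kseqs_ptree[pts' sz'] /(node_inj pts pts') tsE].
by move: ns; rewrite -sz' -tsE sz js.
Qed.

Lemma big_trees (R : nmodType) N r (F : {fset word} -> R) :
  \sum_(t <- trees N r.+1) F t = \sum_(k < N) \sum_(ts <- kseqs k (trees N r)) F (node ts).
Proof.
rewrite /= big_flatten big_map -[N in iota 0 N]subn0 -/(index_iota 0 N) big_mkord.
by apply: eq_bigr => k _; rewrite big_map.
Qed.

End tree_enumeration.

Section rooted_isomorphisms.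

Lemma rooted_iso_refl (A : Type) (VA : A -> Prop) adjA ra : rooted_iso VA adjA ra VA adjA ra.
Proof. by exists id; split => // a Va; exists a. Qed.

Lemma rooted_iso_sym (A : choiceType) (B : Type) (VA : A -> Prop) adjA ra
    (VB : B -> Prop) adjB rb :
  VA ra -> rooted_iso VA adjA ra VB adjB rb -> rooted_iso VB adjB rb VA adjA ra.
Proof.
move=> Vra [f [f_in f_inj f_surj f_root f_adj]].
pose g b := xget ra [set a | VA a /\ f a = b]%classic.
have gP b : VB b -> VA (g b) /\ f (g b) = b.
  by move=> /f_surj[a Va fa]; rewrite /g; case: xgetP => [_ _ //|/(_ a)/=[]].
have gf a : VA a -> g (f a) = a.
  by move=> Va; have [Vg fg] := gP _ (f_in _ Va); apply: f_inj.
exists g; split.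
- by move=> b /gP[].
- by move=> b b' /gP[_ fgb] /gP[_ fgb'] gbb'; rewrite -fgb -fgb' gbb'.
- by move=> a Va; exists (f a); [exact: f_in | exact: gf].
- by rewrite -f_root gf.
- by move=> b b' /gP[Vgb fgb] /gP[Vgb' fgb']; rewrite f_adj// fgb fgb'.
Qed.

Lemma rooted_iso_trans (A B C : Type) (VA : A -> Prop) adjA ra (VB : B -> Prop) adjB rb
    (VC : C -> Prop) adjC rc :
  rooted_iso VA adjA ra VB adjB rb -> rooted_iso VB adjB rb VC adjC rc ->
  rooted_iso VA adjA ra VC adjC rc.
Proof.
move=> [f [f_in f_inj f_surj f_root f_adj]] [g [g_in g_inj g_surj g_root g_adj]].
exists (g \o f); split => /=.
- by move=> a /f_in/g_in.
- by move=> a a' Va Va' gfE; apply: f_inj => //; apply: g_inj gfE; exact: f_in.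
- by move=> c /g_surj[b /f_surj[a Va <-] <-]; exists a.
- by rewrite f_root.
- by move=> a a' Va Va'; rewrite f_adj// g_adj//; exact: f_in.
Qed.

End rooted_isomorphisms.

Section self_avoiding_walks.
Context {R : realFieldType} (c : R) {A : eqType} (nb : A -> seq A).

(* [p] lists the vertices visited before [a]. *)
Fixpoint saw_cavity r (p : seq A) (a : A) : R :=
  if r is r'.+1
  then cavity c (\sum_(b <- nb a | b \notin a :: p) saw_cavity r' (a :: p) b) else 1.

Lemma saw_cavity_bounds r p a : 0 < c -> 0 <= saw_cavity r p a <= 1.
Proof. by move=> c0; case: r => [|r]; [rewrite /= ler01 lexx | exact: cavity_bounds]. Qed.

Section tree_like.
Variables (VA : A -> Prop) (adjA : A -> A -> bool) (root : A) (r : nat) (T : {fset word}).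

(* [level k] contains the vertices reached after [k] steps; only below level [r] must
   [nb] list all the neighbours. *)
Variable level : nat -> A -> Prop.
Hypotheses (uniq_nb : forall a, uniq (nb a)) (level_root : level 0 root)
  (level_sub : forall k a, (k <= r)%N -> level k a -> VA a)
  (nbP : forall k a b, (k < r)%N -> level k a -> (b \in nb a) <-> (VA b /\ adjA a b))
  (level_step : forall k a b, (k < r)%N -> level k a -> b \in nb a -> level k.+1 b)
  (pT : is_ptree T).

Section isomorphism.
Variable f : A -> word.
Hypotheses (f_in : forall a, VA a -> f a \in T)
  (f_inj : forall a a', VA a -> VA a' -> f a = f a' -> a = a')
  (f_surj : forall w, w \in T -> exists2 a, VA a & f a = w)
  (f_adj : forall a a', VA a -> VA a' -> adjA a a' = tadj (f a) (f a')).

(* After visiting [p], the walk sits at [a], [k] steps from the root, and has come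
   through the parent of [a]. *)
Definition descent (k : nat) (p : seq A) (a : A) : Prop :=
  [/\ level k a, size (f a) = k, forall q, q \in p -> VA q /\ (size (f q) < k)%N &
      (0 < k)%N -> exists2 q, q \in p & is_child (f q) (f a)].

Section step.
Variables (k : nat) (p : seq A) (a : A).
Hypotheses (kr : (k < r)%N) (dpa : descent k p a).

Lemma descent_child b : b \in nb a -> b \notin a :: p -> is_child (f a) (f b).
Proof.
have [la size_a visited parent] := dpa; have Va := level_sub (ltnW kr) la.
move=> /(nbP b kr la)[Vb ab]; rewrite inE negb_or => /andP[_ bp].
move: ab; rewrite f_adj// tadjE => /orP[//|ba].
have k0 : (0 < k)%N by case/andP: ba; rewrite size_a => /eqP ->.
have [q qp qa] := parent k0; case/negP: bp.
suff -> : b = q by [].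
by apply: f_inj => //; [case: (visited q qp) | exact: is_child_inj ba qa].
Qed.

Lemma descent_step b : b \in nb a -> b \notin a :: p -> descent k.+1 (a :: p) b.
Proof.
move=> ba bp; have ab := descent_child ba bp; have [la size_a visited _] := dpa.
split=> [|||_]; first exact: level_step la ba.
- by case/andP: ab => /eqP ->; rewrite size_a.
- move=> q; rewrite inE => /predU1P[->|/visited[Vq lt_qk]]; last by split=> //; exact: ltnW.
  by rewrite size_a ltnSn; split=> //; exact: level_sub (ltnW kr) la.
- by exists a; rewrite ?mem_head.
Qed.

Lemma perm_descent_children :
  perm_eq (map f [seq b <- nb a | b \notin a :: p]) (map (rcons (f a)) (iota 0 (nchild T (f a)))).
Proof.
have [la size_a visited _] := dpa.
have nbV b : b \in nb a -> VA b by move=> /(nbP b kr la)[].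
apply: uniq_perm; first rewrite map_inj_in_uniq ?filter_uniq//.
- move=> b b'; rewrite !mem_filter => /andP[_ /nbV Vb] /andP[_ /nbV Vb']; exact: f_inj.
- by rewrite map_inj_uniq ?iota_uniq// => i j /rcons_inj[].
move=> w; apply/mapP/mapP => -[].
  move=> b; rewrite mem_filter => /andP[bp ba] ->.
  have /is_childP[i fb] := descent_child ba bp; exists i => //.
  by rewrite mem_iota /= add0n -mem_rcons_ptree// -fb; exact/f_in/nbV.
move=> i; rewrite mem_iota /= add0n -mem_rcons_ptree// => iT ->.
have [b Vb fb] := f_surj iT; exists b => //; rewrite mem_filter.
have ba : b \in nb a.
  apply/(nbP b kr la); split=> //; rewrite f_adj//; last exact: level_sub (ltnW kr) la.
  by rewrite fb tadjE; apply/orP; left; apply/is_childP; exists i.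
rewrite ba andbT inE negb_or; apply/andP; split.
  by apply/eqP => b_a; move: fb; rewrite b_a => /(congr1 size); rewrite size_rcons => /n_Sn.
by apply/negP => /visited[_]; rewrite fb size_rcons size_a ltnNge leqnSn.
Qed.

End step.

Lemma saw_cavity_descent (k m : nat) (p : seq A) (a : A) : (k + m = r)%N -> descent k p a ->
  saw_cavity m p a = tree_cavity c m T (f a).
Proof.
elim: m k p a => // m IH k p a km dpa.
have kr : (k < r)%N by rewrite -km -addSnnS leq_addr.
rewrite /=; congr cavity.
rewrite -(big_mkord xpredT (fun i => tree_cavity c m T (rcons (f a) i))) /index_iota subn0.
rewrite -(big_map (rcons (f a)) xpredT (tree_cavity c m T)) -big_filter.
rewrite -(perm_big _ (perm_descent_children kr dpa)) big_map.
rewrite big_seq [RHS]big_seq; apply: eq_bigr => b; rewrite mem_filter => /andP[bp ba].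
by apply: (IH k.+1); [rewrite addSnnS | exact: descent_step].
Qed.

End isomorphism.

Lemma saw_cavity_tree_like : rooted_iso VA adjA root (fun w => w \in T) tadj [::] ->
  saw_cavity r [::] root = tree_cavity c r T [::].
Proof.
move=> [f [f_in f_inj f_surj f_root f_adj]]; rewrite -f_root.
by apply: (saw_cavity_descent f_in f_inj f_surj f_adj (k := 0)) => //; split; rewrite ?f_root.
Qed.

End tree_like.

End self_avoiding_walks.

Lemma tree_cavity_iso (R : realFieldType) (c : R) (r : nat) (t T : {fset word}) :
  is_ptree t -> is_ptree T ->
  rooted_iso (fun w => w \in t) tadj [::] (fun w => w \in T) tadj [::] ->
  tree_cavity c r t [::] = tree_cavity c r T [::].
Proof.
move=> pt pT tT; pose nb u := [seq w <- enum_fset t | tadj u w].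
have sawE T' : is_ptree T' ->
    rooted_iso (fun w => w \in t) tadj [::] (fun w => w \in T') tadj [::] ->
    saw_cavity c nb r [::] [::] = tree_cavity c r T' [::].
  move=> pT' iso; apply: (@saw_cavity_tree_like _ c _ nb _ _ _ r T' (fun _ w => w \in t)
    _ _ _ _ _ _ iso) => //.
  - by move=> u; rewrite filter_uniq// fset_uniq.
  - by case: pt.
  - by move=> k u w _ _; rewrite mem_filter; split => [/andP[]|[-> ->]].
  - by move=> k u w _ _; rewrite mem_filter => /andP[].
by rewrite -(sawE T)// -(sawE t)//; exact: rooted_iso_refl.
Qed.

Section graph_walks.
Context {R : realType} {G : simple_graph}.
Local Notation V := 'I_(nv G).
Implicit Types (a b v : V) (p : seq V).

Definition neighbours v : seq V := [seq w <- enum V | adj v w].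

Lemma mem_neighbours v w : (w \in neighbours v) = adj v w.
Proof. by rewrite mem_filter mem_enum andbT. Qed.

Lemma gball_center v r : v \in gball v r.
Proof. by elim: r => [|r IH]; rewrite /gball ?iterS ?finset.in_setU ?IH//= inE. Qed.

Lemma gball_adj v k a b : a \in gball v k -> adj a b -> b \in gball v k.+1.
Proof.
move=> ak ab; rewrite /gball iterS finset.in_setU; apply/orP; right.
by rewrite inE; apply/existsP; exists a; rewrite ak.
Qed.

Lemma gball_le v k r a : (k <= r)%N -> a \in gball v k -> a \in gball v r.
Proof.
move=> /subnK <-; elim: (r - k)%N => // m IH /IH am.
by rewrite addSn /gball iterS finset.in_setU am.
Qed.

Lemma saw_cavity_ball (c : R) v r T : is_ptree T ->
  rooted_iso (fun a => a \in gball v r) (@adj G) v (fun w => w \in T) tadj [::] ->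
  saw_cavity c neighbours r [::] v = tree_cavity c r T [::].
Proof.
move=> pT iso; apply: (@saw_cavity_tree_like _ c _ neighbours _ _ v r T (fun k a => a \in gball v k)
  _ _ _ _ _ _ iso) => //.
- by move=> a; rewrite filter_uniq// enum_uniq.
- exact: gball_center.
- by move=> k a kr; exact: gball_le.
- move=> k a b kr ak; rewrite mem_neighbours; split => [ab|[]//]; split => //.
  exact: gball_le kr (gball_adj ak ab).
- by move=> k a b kr ak; rewrite mem_neighbours; exact: gball_adj.
Qed.

Lemma mem_unvisited p b : (b \in ~: [set a in p])%SET = (b \notin p).
Proof. by rewrite finset.in_setC inE. Qed.

Lemma induced_R_cavity (x : R) p v : 0 < x -> v \notin p ->
  induced_R x (~: [set a in p])%SET v =
  cavity (x ^+ 2)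
    (\sum_(b <- neighbours v | b \notin v :: p) induced_R x (~: [set a in v :: p])%SET b).
Proof.
move=> x0 vp; rewrite induced_R_rec ?mem_unvisited//.
have -> : ((~: [set a in p]) :\ v = ~: [set a in v :: p])%SET.
  by apply/setP => a; rewrite !inE negb_or.
rewrite /neighbours big_filter_cond big_enum_cond cavityE.
  by congr (_ / (_ + _)); apply: eq_bigl => b; rewrite !inE andbC.
apply: sumr_ge0 => b /and3P[_ _ bp].
have bS : b \in (~: [set a in v :: p])%SET by rewrite mem_unvisited.
by case/andP: (induced_R_bounds x0 bS).
Qed.

Lemma saw_cavity_sandwich (x : R) r p v : 0 < x -> v \notin p ->
  if odd r then saw_cavity (x ^+ 2) neighbours r p v <= induced_R x (~: [set a in p])%SET v
  else induced_R x (~: [set a in p])%SET v <= saw_cavity (x ^+ 2) neighbours r p v.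
Proof.
move=> x0; elim: r p v => [|r IH] p v vp.
  have vS : v \in (~: [set a in p])%SET by rewrite mem_unvisited.
  by case/andP: (induced_R_bounds x0 vS).
rewrite [in X in if _ then _ else X]induced_R_cavity//.
rewrite [in X in if _ then X else _]induced_R_cavity//=.
have c0 : 0 < x ^+ 2 by rewrite exprn_gt0.
case: (boolP (odd r)) => odd_r /=; apply: cavity_anti => //; apply: ler_sum => b bp.
  by have := IH _ _ bp; rewrite odd_r.
by have := IH _ _ bp; rewrite (negbTE odd_r).
Qed.

Lemma mdR_sandwich (x : R) r v : 0 < x ->
  saw_cavity (x ^+ 2) neighbours r.*2.+1 [::] v <= mdR G x v
    <= saw_cavity (x ^+ 2) neighbours r.*2 [::] v.
Proof.
move=> x0; have -> : mdR G x v = induced_R x (~: [set a in [::]])%SET v.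
  by rewrite mdR_induced; congr induced_R; apply/setP => a; rewrite !inE.
have := @saw_cavity_sandwich x r.*2 [::] v x0 isT.
have := @saw_cavity_sandwich x r.*2.+1 [::] v x0 isT.
by rewrite oddS odd_double /= => -> ->.
Qed.

End graph_walks.

Local Open Scope classical_set_scope.
Local Open Scope ring_scope.

(** * Laws on the line and the stochastic order *)

Section bounded_measurable.
Context {d : measure_display} {T : measurableType d} {R : realType}.
Implicit Types (f g : T -> R) (A : set T).

Definition bdd_measurable f : Prop :=
  measurable_fun setT f /\ exists M, forall y, `|f y| <= M.

Lemma bdd_measurable_cst c : bdd_measurable (fun=> c).
Proof. by split; [exact: measurable_cst | exists `|c|]. Qed.

Lemma bdd_measurableD f g : bdd_measurable f -> bdd_measurable g ->
  bdd_measurable (fun y => f y + g y).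
Proof.
move=> [mf [M fM]] [mg [N gN]]; split; first exact: measurable_funD.
by exists (M + N) => y; rewrite (le_trans (ler_normD _ _))// lerD.
Qed.

Lemma bdd_measurableM f g : bdd_measurable f -> bdd_measurable g ->
  bdd_measurable (fun y => f y * g y).
Proof.
move=> [mf [M fM]] [mg [N gN]]; split; first exact: measurable_funM.
by exists (M * N) => y; rewrite normrM ler_pM.
Qed.

Lemma bdd_measurableZ c f : bdd_measurable f -> bdd_measurable (fun y => c * f y).
Proof. exact/bdd_measurableM/bdd_measurable_cst. Qed.

Lemma bdd_measurableN f : bdd_measurable f -> bdd_measurable (fun y => - f y).
Proof. by under eq_fun do rewrite -mulN1r; exact: bdd_measurableZ. Qed.

Lemma bdd_measurableB f g : bdd_measurable f -> bdd_measurable g ->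
  bdd_measurable (fun y => f y - g y).
Proof. by move=> bf /bdd_measurableN; exact: bdd_measurableD. Qed.

Lemma bdd_measurable_indic A : measurable A -> bdd_measurable (\1_A : T -> R).
Proof.
move=> mA; split; first exact: measurable_indic.
by exists 1 => y; rewrite indicE ger0_norm// lern1 leq_b1.
Qed.

End bounded_measurable.

Lemma bdd_measurable_comp {d d' : measure_display} {T : measurableType d}
    {T' : measurableType d'} {R : realType} (f : T -> R) (h : T' -> T) :
  bdd_measurable f -> measurable_fun setT h -> bdd_measurable (f \o h).
Proof. by move=> [mf [M fM]] mh; split; [exact: measurableT_comp | exists M => y /=]. Qed.

Section expectation.
Context {d : measure_display} {T : measurableType d} {R : realType}.
Implicit Types (m : probability T R) (f g : T -> R) (A : set T).

Definition Ex m f : R := \int[m]_y f y.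

Lemma bdd_measurable_integrable m f : bdd_measurable f -> m.-integrable setT (EFin \o f).
Proof.
move=> [mf [M fM]]; apply: (@le_integrable _ _ _ m setT _ (EFin \o f) (cst M%:E)) => //.
- exact/measurable_EFinP.
- by move=> y _ /=; rewrite lee_fin (le_trans (fM y))// ler_norm.
- exact: finite_measure_integrable_cst.
Qed.

Lemma Ex_EFin m f : bdd_measurable f -> (\int[m]_y (f y)%:E)%E = (Ex m f)%:E.
Proof.
move=> bf; rewrite /Ex /Rintegral fineK//.
exact/integrable_fin_num/bdd_measurable_integrable.
Qed.

Lemma ExD m f g : bdd_measurable f -> bdd_measurable g ->
  Ex m (fun y => f y + g y) = Ex m f + Ex m g.
Proof. by move=> bf bg; apply: RintegralD => //; exact: bdd_measurable_integrable. Qed.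

Lemma ExB m f g : bdd_measurable f -> bdd_measurable g ->
  Ex m (fun y => f y - g y) = Ex m f - Ex m g.
Proof. by move=> bf bg; apply: RintegralB => //; exact: bdd_measurable_integrable. Qed.

Lemma ExZ m c f : bdd_measurable f -> Ex m (fun y => c * f y) = c * Ex m f.
Proof. by move=> bf; apply: RintegralZl => //; exact: bdd_measurable_integrable. Qed.

Lemma Ex_cst m c : Ex m (fun=> c) = c.
Proof.
rewrite /Ex Rintegral_cst//; have -> : fine (m setT) = 1 by rewrite probability_setT.
by rewrite mulr1.
Qed.

Lemma le_Ex m f g : bdd_measurable f -> bdd_measurable g -> (forall y, f y <= g y) ->
  Ex m f <= Ex m g.
Proof.
by move=> bf bg fg; apply: le_Rintegral => //; exact: bdd_measurable_integrable.
Qed.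

Lemma Ex_ge0 m f : (forall y, 0 <= f y) -> 0 <= Ex m f.
Proof. by move=> f0; apply: Rintegral_ge0. Qed.

Lemma normr_Ex_le m f M : bdd_measurable f -> (forall y, `|f y| <= M) -> `|Ex m f| <= M.
Proof.
move=> bf fM; rewrite ler_norml -[X in X <= _](Ex_cst m) -[X in _ && (_ <= X)](Ex_cst m).
by apply/andP; split; apply: le_Ex => //; try exact: bdd_measurable_cst;
  move=> y; have := fM y; rewrite ler_norml => /andP[].
Qed.

Lemma le_Ex_full m A f g : measurable A -> m A = 1%E ->
  bdd_measurable f -> bdd_measurable g -> (forall y, A y -> f y <= g y) -> Ex m f <= Ex m g.
Proof.
move=> mA mA1 bf bg fg.
have restrict k : bdd_measurable k -> Ex m k = \int[m]_(y in A) k y.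
  move=> bk; rewrite /Ex /Rintegral; congr fine.
  rewrite (@negligible_integral _ _ _ m setT (~` A) (EFin \o k))//=.
  - by rewrite setTD setCK.
  - exact: measurableC.
  - exact: bdd_measurable_integrable.
  - by rewrite [LHS]probability_setC// mA1 subee.
rewrite !restrict//; apply: le_Rintegral => //.
- exact: integrableS (bdd_measurable_integrable m bf).
- exact: integrableS (bdd_measurable_integrable m bg).
Qed.

Lemma Ex_indic m A : measurable A -> (Ex m (\1_A : T -> R))%:E = m A.
Proof.
by move=> mA; rewrite -Ex_EFin; [rewrite integral_indic// setIT | exact: bdd_measurable_indic].
Qed.

Lemma Ex_dirac (a : T) f : bdd_measurable f -> Ex (\d_a : probability T R) f = f a.
Proof.
move=> bf; rewrite /Ex /Rintegral integral_dirac//; first by rewrite diracT mul1e.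
by apply/measurable_EFinP; case: bf.
Qed.

End expectation.

Section iterated_expectation.
Context {d1 d2 : measure_display} {T1 : measurableType d1} {T2 : measurableType d2} {R : realType}.
Implicit Types (mu : probability T1 R) (nu : probability T2 R) (h : T1 * T2 -> R).

Lemma measurable_integral_param nu (h : T1 * T2 -> \bar R) :
  measurable_fun setT h -> measurable_fun setT (fun t => \int[nu]_y h (t, y))%E.
Proof.
move=> mh; rewrite (_ : (fun _ => _) =
    ((fun t => \int[nu]_y h^\+ (t, y)) \- (fun t => \int[nu]_y h^\- (t, y)))%E); last first.
  apply/funext => t; rewrite [LHS]integralE.
  by congr (_ - _)%E; apply: eq_integral => y _; rewrite ?funeposE ?funenegE.
apply: emeasurable_funB.
- apply: (@measurable_fun_fubini_tonelli_F _ _ _ _ _ nu h^\+%E) => //.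
  exact: measurable_funepos.
- apply: (@measurable_fun_fubini_tonelli_F _ _ _ _ _ nu h^\-%E) => //.
  exact: measurable_funeneg.
Qed.

Lemma bdd_measurable_pair1 h x : bdd_measurable h -> bdd_measurable (fun y => h (x, y)).
Proof. by move=> /bdd_measurable_comp; apply; exact: measurable_fun_pair. Qed.

Lemma bdd_measurable_pair2 h y : bdd_measurable h -> bdd_measurable (fun x => h (x, y)).
Proof. by move=> /bdd_measurable_comp; apply; exact: measurable_fun_pair. Qed.

Lemma bdd_measurable_Ex nu h : bdd_measurable h ->
  bdd_measurable (fun x => Ex nu (fun y => h (x, y))).
Proof.
move=> bh; have [mh [M hM]] := bh; split; last first.
  by exists M => x; apply: normr_Ex_le => //; exact: bdd_measurable_pair1.
apply/measurable_EFinP; have /measurable_EFinP/(measurable_integral_param nu) := mh.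
by apply: eq_measurable_fun => x _ /=; rewrite Ex_EFin//; exact: bdd_measurable_pair1.
Qed.

End iterated_expectation.

Section exchange_expectations.
Context {d1 d2 : measure_display} {T1 : measurableType d1} {T2 : measurableType d2} {R : realType}.
Implicit Types (mu : probability T1 R) (nu : probability T2 R) (h : T1 * T2 -> R).

Lemma Ex_prod mu nu h : bdd_measurable h ->
  Ex (mu \x nu)%E h = Ex mu (fun x => Ex nu (fun y => h (x, y))).
Proof.
move=> bh; apply: EFin_inj; rewrite -!Ex_EFin//; last exact: bdd_measurable_Ex.
have := integral12_prod_meas1 (bdd_measurable_integrable (mu \x nu)%E bh).
rewrite /fubini_F /= => <-; apply: eq_integral => x _.
by rewrite Ex_EFin//; exact: bdd_measurable_pair1.
Qed.

Lemma Ex_exchange mu nu h : bdd_measurable h ->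
  Ex mu (fun x => Ex nu (fun y => h (x, y))) = Ex nu (fun y => Ex mu (fun x => h (x, y))).
Proof.
move=> bh; have bhC : bdd_measurable (fun p : T2 * T1 => h (p.2, p.1)).
  exact: (bdd_measurable_comp bh (@measurable_swap _ _ _ _)).
apply: EFin_inj; rewrite -Ex_EFin; last exact: (bdd_measurable_Ex nu bh).
rewrite -Ex_EFin; last exact: (bdd_measurable_Ex mu bhC).
under eq_integral do rewrite -(Ex_EFin _ (bdd_measurable_pair1 _ bh)).
under [RHS]eq_integral do rewrite -(Ex_EFin _ (bdd_measurable_pair2 _ bh)).
by apply: (@Fubini _ _ _ _ _ mu nu (EFin \o h)); exact: bdd_measurable_integrable.
Qed.

End exchange_expectations.

Section bounded_lipschitz.
Context {R : realType}.
Implicit Types (f g : R -> R) (K L : R).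

Lemma klipschitzP L f : L.-lipschitz f <-> forall y z, `|f y - f z| <= L * `|y - z|.
Proof. by split=> [Lf y z|Lf [y z] _]; [exact: (Lf (y, z) (conj I I)) | exact: Lf]. Qed.

Lemma klipschitz_ge0 L f : L.-lipschitz f -> 0 <= L.
Proof.
by move=> /klipschitzP/(_ 1 0); rewrite subr0 normr1 mulr1; exact: le_trans (normr_ge0 _).
Qed.

Lemma klipschitz_continuous L f : L.-lipschitz f -> continuous f.
Proof.
move=> Lf y; have L1 : 0 < L + 1 by rewrite ltr_wpDl// (klipschitz_ge0 Lf).
apply/cvgrPdist_lt => e e0; near=> z.
apply: le_lt_trans ((klipschitzP L f).1 Lf _ _) _.
apply: (@le_lt_trans _ _ ((L + 1) * `|y - z|)); first by rewrite ler_wpM2r// lerDl.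
rewrite -ltr_pdivlMl//.
by near: z; apply: (@near_ball R R) => //; rewrite mulr_gt0 ?invr_gt0.
Unshelve. all: by end_near. Qed.

Definition bdd_lipschitz f : Prop :=
  (exists L, L.-lipschitz f) /\ exists M, forall y, `|f y| <= M.

Lemma bdd_lipschitz_measurable f : bdd_lipschitz f -> bdd_measurable f.
Proof.
move=> [[L Lf] bf]; split => //.
by apply: continuous_measurable_fun; exact: klipschitz_continuous Lf.
Qed.

Lemma bdd_lipschitzD f g : bdd_lipschitz f -> bdd_lipschitz g ->
  bdd_lipschitz (fun y => f y + g y).
Proof.
move=> [[L /klipschitzP Lf] [M fM]] [[K /klipschitzP Kg] [N gN]]; split.
  exists (L + K); apply/klipschitzP => y z; rewrite opprD addrACA mulrDl.
  by rewrite (le_trans (ler_normD _ _))// lerD.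
by exists (M + N) => y; rewrite (le_trans (ler_normD _ _))// lerD.
Qed.

Lemma bdd_lipschitzZ a f : bdd_lipschitz f -> bdd_lipschitz (fun y => a * f y).
Proof.
move=> [[L /klipschitzP Lf] [M fM]]; split.
  by exists (`|a| * L); apply/klipschitzP => y z; rewrite -mulrBr normrM -mulrA ler_wpM2l.
by exists (`|a| * M) => y; rewrite normrM ler_wpM2l.
Qed.

Lemma bdd_lipschitzN f : bdd_lipschitz f -> bdd_lipschitz (fun y => - f y).
Proof. by under eq_fun do rewrite -mulN1r; exact: bdd_lipschitzZ. Qed.

Lemma bdd_lipschitzB f g : bdd_lipschitz f -> bdd_lipschitz g ->
  bdd_lipschitz (fun y => f y - g y).
Proof. by move=> bf /bdd_lipschitzN; apply: bdd_lipschitzD. Qed.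

Lemma bdd_lipschitz_comp f g K : bdd_lipschitz f -> K.-lipschitz g -> bdd_lipschitz (f \o g).
Proof.
move=> [[L Lf] [M fM]] /klipschitzP Kg; split; last by exists M => y /=.
exists (L * K); apply/klipschitzP => y z; apply: le_trans ((klipschitzP L f).1 Lf _ _) _.
by rewrite -mulrA ler_wpM2l// (klipschitz_ge0 Lf).
Qed.

Lemma clip01_lipschitz : 1.-lipschitz (@clip01 R).
Proof. by apply/klipschitzP => y z; rewrite mul1r clip01_nonexpansive. Qed.

Lemma bdd_lipschitz_clip01 : bdd_lipschitz (@clip01 R).
Proof.
split; first by exists 1; exact: clip01_lipschitz.
by exists 1 => y; rewrite ger0_norm ?clip01_le1 ?clip01_ge0.
Qed.

Lemma cavity_lipschitz (c : R) : 0 < c -> c^-1.-lipschitz (cavity c).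
Proof. by move=> c0; apply/klipschitzP => s t; exact: cavityB_le. Qed.

Lemma bdd_lipschitz_cavity (c : R) : 0 < c -> bdd_lipschitz (cavity c).
Proof.
move=> c0; split; first by exists c^-1; exact: cavity_lipschitz.
by exists 1 => s; rewrite ger0_norm ?cavity_le1 ?cavity_ge0.
Qed.

End bounded_lipschitz.

Section stochastic_order.
Context {R : realType}.
Implicit Types (mu nu m : probability R R) (f : R -> R).

Definition st_le mu nu : Prop :=
  forall f, bdd_lipschitz f -> {homo f : y z / y <= z} -> Ex mu f <= Ex nu f.

Lemma st_le_anti mu nu f : st_le mu nu -> bdd_lipschitz f -> {homo f : y z /~ y <= z} ->
  Ex nu f <= Ex mu f.
Proof.
move=> mn bf f_anti; have := mn _ (bdd_lipschitzZ (-1) bf).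
rewrite !ExZ; try exact: bdd_lipschitz_measurable.
by rewrite !mulN1r lerN2; apply=> y z yz; rewrite !mulN1r lerN2 f_anti.
Qed.

Lemma st_le_trans mu nu m : st_le mu nu -> st_le nu m -> st_le mu m.
Proof. by move=> mn nm f bf f_homo; apply: le_trans (mn f bf f_homo) (nm f bf f_homo). Qed.

Definition eq_law mu nu : Prop := forall A, measurable A -> mu A = nu A.

Lemma eq_law_st_le mu nu : eq_law mu nu -> st_le mu nu.
Proof.
move=> mn f bf _; rewrite /Ex /Rintegral.
by rewrite (eq_measure_integral nu)// => A mA _; exact: mn.
Qed.

Definition supp01 mu : Prop := mu [set y | 0 <= y <= 1] = 1%E.

Lemma measurable_01 : measurable [set y : R | 0 <= y <= 1].
Proof. by rewrite (_ : [set y | _] = `[0, 1]%classic). Qed.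

Lemma Ex_clip01 mu f : supp01 mu -> bdd_lipschitz f -> Ex mu (f \o clip01) = Ex mu f.
Proof.
move=> mu01 bf; have bfc := bdd_lipschitz_comp bf clip01_lipschitz.
by apply/eqP; rewrite eq_le; apply/andP; split;
  apply: (le_Ex_full measurable_01 mu01) => [| |y y01 /=];
  do ?[exact: bdd_lipschitz_measurable]; rewrite clip01_id.
Qed.

Lemma st_le_dirac1 mu : supp01 mu -> st_le mu (\d_(1 : R)).
Proof.
move=> mu01 f bf f_homo; have bm := bdd_lipschitz_measurable bf.
rewrite Ex_dirac// -[leRHS](Ex_cst mu).
apply: (le_Ex_full measurable_01 mu01) => //; first exact: bdd_measurable_cst.
by move=> y /andP[_ y1]; exact: f_homo.
Qed.

Definition mean01 mu : R := Ex mu clip01.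

Lemma st_le_mean01 mu nu : st_le mu nu -> mean01 mu <= mean01 nu.
Proof. by move=> mn; apply: mn; [exact: bdd_lipschitz_clip01 | exact: clip01_homo]. Qed.

(* Since [L * clip01 +- f] is nondecreasing, the defect of means controls all
   Lipschitz test functions. *)
Lemma st_le_Ex_dist mu nu f L : st_le mu nu ->
  (forall y z, `|f y - f z| <= L * `|clip01 y - clip01 z|) -> bdd_lipschitz f ->
  `|Ex nu f - Ex mu f| <= L * (mean01 nu - mean01 mu).
Proof.
move=> mn f_clip bf; have bZ := bdd_lipschitzZ L (@bdd_lipschitz_clip01 R).
have f_slope y z : y <= z -> `|f z - f y| <= L * (clip01 z - clip01 y).
  by move=> yz; rewrite (le_trans (f_clip _ _))// ger0_norm// subr_ge0 clip01_homo.
have leB : Ex mu (fun y => L * clip01 y - f y) <= Ex nu (fun y => L * clip01 y - f y).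
  apply: mn => [|y z /f_slope]; first exact: bdd_lipschitzB.
  by rewrite ler_norml mulrBr => /andP[? ?]; lra.
have leD : Ex mu (fun y => L * clip01 y + f y) <= Ex nu (fun y => L * clip01 y + f y).
  apply: mn => [|y z /f_slope]; first exact: bdd_lipschitzD.
  by rewrite ler_norml mulrBr => /andP[? ?]; lra.
have bfm := bdd_lipschitz_measurable bf; have bZm := bdd_lipschitz_measurable bZ.
have bcm := bdd_lipschitz_measurable (@bdd_lipschitz_clip01 R).
move: leB leD; rewrite !ExB// !ExD// !ExZ// => leB leD.
by rewrite ler_norml mulrBr /mean01; apply/andP; split; lra.
Qed.

End stochastic_order.

Section distribution_function.
Context {R : realType}.
Implicit Types (mu nu : probability R R) (f : R -> R) (t c : R).

Definition distr_fun mu t : R := fine (mu `]-oo, t]%classic).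

Lemma distr_funE mu t : mu `]-oo, t]%classic = (distr_fun mu t)%:E.
Proof. by rewrite /distr_fun fineK// fin_num_measure. Qed.

Lemma distr_fun_ge0 mu t : 0 <= distr_fun mu t.
Proof. by rewrite -lee_fin -distr_funE. Qed.

Lemma distr_fun_le1 mu t : distr_fun mu t <= 1.
Proof. by rewrite -lee_fin -distr_funE probability_le1. Qed.

Lemma distr_fun_homo mu : {homo distr_fun mu : s t / s <= t}.
Proof.
move=> s t st; rewrite -lee_fin -!distr_funE le_measure ?inE//.
by apply: subset_itvl; rewrite bnd_simp.
Qed.

Lemma distr_fun_right_continuous mu : right_continuous (distr_fun mu).
Proof.
pose X : {mfun R >-> R} :=
  HB.pack (fun y : R => y) (isMeasurableFun.Build _ _ _ _ _ (@measurable_id _ R setT)).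
have cdfE : cdf (X : {RV mu >-> R}) = EFin \o distr_fun mu.
  by apply/funext => t /=; rewrite -distr_funE.
by move=> t; have := @cdf_right_continuous _ _ _ mu X t; rewrite cdfE => /fine_cvg.
Qed.

Lemma distr_fun_lt0 mu t : supp01 mu -> t < 0 -> distr_fun mu t = 0.
Proof.
move=> mu01 t0; apply: EFin_inj; rewrite -distr_funE; apply/eqP; rewrite -measure_le0.
have <- : mu (~` [set y | 0 <= y <= 1]) = 0%E.
  by rewrite [LHS]probability_setC ?mu01 ?subee//; exact: measurable_01.
rewrite le_measure ?inE//; first by apply: measurableC; exact: measurable_01.
move=> y /=; rewrite in_itv/= => yt; apply/negP; rewrite negb_and -ltNge.
by rewrite (le_lt_trans yt).
Qed.

Lemma distr_fun_ge1 mu t : supp01 mu -> 1 <= t -> distr_fun mu t = 1.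
Proof.
move=> mu01 t1; apply/eqP; rewrite eq_le distr_fun_le1 -lee_fin -distr_funE -mu01 /=.
rewrite le_measure ?inE//; first exact: measurable_01.
by move=> y /= /andP[_ y1]; rewrite in_itv/= (le_trans y1).
Qed.

Lemma measure_itvoc mu a b : a <= b ->
  mu `]a, b]%classic = (distr_fun mu b - distr_fun mu a)%:E.
Proof.
move=> ab; rewrite EFinB -!distr_funE.
have -> : `]a, b]%classic = `]-oo, b] `\` `]-oo, a] :> set R.
  by rewrite -[RHS]setCK setCD setCitvl setUC -[LHS]setCK setCitv.
rewrite measureD ?setIidr//; last by rewrite -ge0_fin_numE// fin_num_measure.
by apply: subset_itvl; rewrite bnd_simp.
Qed.

Lemma eq_distr_fun mu nu : distr_fun mu =1 distr_fun nu -> eq_law mu nu.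
Proof.
move=> mn; apply: (@measure_unique _ _ _ (@ocitv R) (fun k => `]- k%:R, k%:R]%classic)) => //.
- exact: ocitvI.
- by move=> k; exact: is_ocitv.
- exact: (bigcup_itvT false false).
- move=> _ [[a b] _ <-] /=; have [ab|ba] := leP a b; first by rewrite !measure_itvoc// !mn.
  by rewrite set_itv_ge ?measure0// bnd_simp -leNgt ltW.
- by move=> k; rewrite -ge0_fin_numE// fin_num_measure.
Qed.

Definition ramp t (n : nat) (y : R) : R := clip01 (1 - n.+1%:R * (y - t)).

Lemma bdd_lipschitz_ramp t n : bdd_lipschitz (ramp t n).
Proof.
apply: (bdd_lipschitz_comp (K := n.+1%:R) bdd_lipschitz_clip01); apply/klipschitzP => y z.
have -> : 1 - n.+1%:R * (y - t) - (1 - n.+1%:R * (z - t)) = - (n.+1%:R * (y - z)) by ring.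
by rewrite normrN normrM ger0_norm.
Qed.

Lemma ramp_anti t n : {homo ramp t n : y z /~ y <= z}.
Proof.
by move=> y z yz; apply: clip01_homo; rewrite lerD2l lerN2 ler_wpM2l// lerD2r.
Qed.

Lemma distr_fun_le_ramp mu t n : distr_fun mu t <= Ex mu (ramp t n).
Proof.
rewrite -lee_fin -distr_funE -Ex_indic// lee_fin.
apply: le_Ex => [| |y]; first exact: bdd_measurable_indic.
  exact/bdd_lipschitz_measurable/bdd_lipschitz_ramp.
rewrite indicE; have [|_] := boolP (y \in _); last by rewrite clip01_ge0.
rewrite inE/= in_itv/= => yt; have slope : n.+1%:R * (y - t) <= 0.
  by rewrite mulr_ge0_le0// subr_le0.
by rewrite /ramp clip01E; case: ifP => [|_]; [lra | case: ifP => // /negP; lra].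
Qed.

Lemma ramp_le_distr_fun mu t n : Ex mu (ramp t n) <= distr_fun mu (t + n.+1%:R^-1).
Proof.
rewrite -lee_fin -distr_funE -Ex_indic// lee_fin.
apply: le_Ex => [| |y]; last 1 first.
- rewrite indicE; have [_|] := boolP (y \in _); first by rewrite clip01_le1.
  rewrite notin_setE/= in_itv/= => /negP; rewrite -ltNge => yt; rewrite /ramp clip01E.
  have slope : 1 <= n.+1%:R * (y - t) by rewrite -ler_pdivrMl// mulr1 lerBrDl ltW.
  by rewrite ifT// subr_le0.
- exact/bdd_lipschitz_measurable/bdd_lipschitz_ramp.
- exact: bdd_measurable_indic.
Qed.

Lemma st_le_distr_fun mu nu t : st_le mu nu -> distr_fun nu t <= distr_fun mu t.
Proof.
move=> mn; have ramp_cvg : (fun n => distr_fun mu (t + n.+1%:R^-1)) @ \oo --> distr_fun mu t.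
  have /cvg_at_rightP := @distr_fun_right_continuous mu t; apply; split=> [n|].
    by rewrite ltrDl invr_gt0.
  rewrite -[X in _ --> X]addr0; apply: cvgD; [exact: cvg_cst | exact: cvg_harmonic].
apply: (cvgr_to_ge ramp_cvg); apply: nearW => n.
apply: le_trans (distr_fun_le_ramp nu t n) _; apply: le_trans (ramp_le_distr_fun mu t n).
exact: (st_le_anti mn (bdd_lipschitz_ramp t n) (@ramp_anti t n)).
Qed.

Lemma st_le_eq_law mu nu : st_le mu nu -> st_le nu mu -> eq_law mu nu.
Proof.
by move=> mn nm; apply: eq_distr_fun => t; apply/eqP; rewrite eq_le !st_le_distr_fun.
Qed.

Lemma homo_continuous_sublevel f c : {homo f : y z / y <= z} -> continuous f ->
  [\/ [set y | f y <= c] = set0, [set y | f y <= c] = setT |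
      exists s, [set y | f y <= c] = `]-oo, s]%classic].
Proof.
move=> f_homo f_cont; set A := [set y | f y <= c].
have [[y Ay]|nA] := pselect (A !=set0); last by apply: Or31; exact/eqP/negPn/negP/set0P.
have [[z fz]|nA] := pselect (exists z, c < f z); last first.
  apply: Or32; apply/seteqP; split=> // z _; rewrite /A /= leNgt; apply/negP => fz.
  by apply: nA; exists z.
have ubA : has_ubound A.
  by exists z => u /= fu; rewrite leNgt; apply/negP => /ltW/f_homo; rewrite leNgt (le_lt_trans fu).
have closedA : closed A.
  apply: (closed_comp (f := f) (D := [set u | u <= c])) => [u _|].
    exact: f_cont.
  exact: closed_le.
have supA : f (sup A) <= c by apply: closedA; apply: closure_sup => //; exists y.
apply: Or33; exists (sup A); apply/seteqP; split=> u /=; rewrite in_itv/=.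
  by move=> fu; apply: ub_le_sup.
by move=> /f_homo/le_trans; apply.
Qed.

Lemma le_measure_sublevel mu nu f c : (forall t, distr_fun nu t <= distr_fun mu t) ->
  {homo f : y z / y <= z} -> continuous f ->
  (nu [set y | (f y <= c)%R] <= mu [set y | (f y <= c)%R])%E.
Proof.
move=> df f_homo /(homo_continuous_sublevel c f_homo)[->|->|[s ->]].
- by rewrite !measure0.
- by rewrite !probability_setT.
- by rewrite !distr_funE lee_fin.
Qed.

(* Layer cake: the tails of [f + M >= 0] compare because the sublevel sets of [f] are
   half-lines. *)
Lemma distr_fun_st_le mu nu : (forall t, distr_fun nu t <= distr_fun mu t) -> st_le mu nu.
Proof.
move=> df f bf f_homo; have [[L Lf] [M fM]] := bf.
have bfm := bdd_lipschitz_measurable bf; have bM := @bdd_measurable_cst _ R R M.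
have bg : bdd_measurable (fun y => f y + M) by exact: bdd_measurableD.
have g_ge0 y : 0 <= f y + M by have := fM y; rewrite ler_norml => /andP[+ _]; lra.
suff : Ex mu (fun y => f y + M) <= Ex nu (fun y => f y + M).
  by rewrite !ExD// !Ex_cst lerD2r.
pose X : {mfun R >-> R} := HB.pack (fun y => f y + M) (isMeasurableFun.Build _ _ _ _ _ bg.1).
rewrite -lee_fin -!Ex_EFin//.
have tail (m : probability R R) : (\int[m]_y (f y + M)%:E =
    \int[lebesgue_measure]_(r in `[0%R, +oo[) ccdf (X : {RV m >-> R}) r)%E.
  by rewrite -(@ge0_expectation_ccdf _ _ _ m X g_ge0) unlock.
rewrite !tail; apply: ge0_le_integral => //.
- exact: measurable_funTS (@ccdf_measurable _ _ _ mu X).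
- exact: measurable_funTS (@ccdf_measurable _ _ _ nu X).
move=> r _; rewrite !ccdf_1_cdf leeB//.
have cdfE (m : probability R R) : cdf (X : {RV m >-> R}) r = m [set y | f y <= r - M].
  rewrite /cdf /distribution /pushforward; congr (m _).
  by apply/seteqP; split=> y /=; rewrite in_itv/= lerBrDr.
rewrite !cdfE; apply: le_measure_sublevel => //; exact: klipschitz_continuous Lf.
Qed.

End distribution_function.

Section law_of_distribution_function.
Context {R : realType}.

Lemma exists_law (F : R -> R) : {homo F : s t / s <= t} -> right_continuous F ->
  F @ -oo --> (0 : R) -> F @ +oo --> (1 : R) ->
  exists mu : probability R R, distr_fun mu =1 F.
Proof.
move=> F_homo F_rc F_Ny F_y.
pose f : cumulativeBounded (0 : R) (1 : R) := HB.pack F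
  (isCumulative.Build R _ R F F_homo F_rc) (isCumulativeBounded.Build R 0 1 F F_Ny F_y).
pose X : {mfun measurableTypeR R >-> R} := HB.pack (idfun : measurableTypeR R -> R)
  (isMeasurableFun.Build _ _ (measurableTypeR R) R _ (@measurable_id _ _ setT)).
pose m : probability (measurableTypeR R) R := lebesgue_stieltjes_measure f.
exists (distribution m X) => t; apply: EFin_inj; rewrite -distr_funE.
exact: (cdf_lebesgue_stieltjes_id f t).
Qed.

Variables (I : Type) (i0 : I) (F : I -> R -> R) (b : R).
Hypotheses (F_homo : forall i, {homo F i : s t / s <= t})
  (F_rc : forall i, right_continuous (F i)) (F_ge : forall i t, b <= F i t).

Lemma range_has_inf t : has_inf (range (F ^~ t)).
Proof. by split; [exists (F i0 t); exists i0 | exists b => _ [i _ <-]; exact: F_ge]. Qed.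

Lemma inf_range_le i t : inf (range (F ^~ t)) <= F i t.
Proof. by apply: ge_inf; [case: (range_has_inf t) | exists i]. Qed.

Lemma le_inf_range t c : (forall i, c <= F i t) -> c <= inf (range (F ^~ t)).
Proof. by move=> cF; apply: lb_le_inf => [|_ [i _ <-]//]; case: (range_has_inf t). Qed.

Lemma inf_range_homo : {homo (fun t => inf (range (F ^~ t))) : s t / s <= t}.
Proof.
by move=> s t st; apply: le_inf_range => i; apply: le_trans (inf_range_le i s) _; exact: F_homo.
Qed.

Lemma inf_range_right_continuous : right_continuous (fun t => inf (range (F ^~ t))).
Proof.
move=> t; apply/cvgrPdist_le => e e0; have e2 : 0 < e / 2 by rewrite divr_gt0.
have [_ [i _ <-] Fi_inf] := inf_adherent e2 (range_has_inf t).
near=> s; have ts : t <= s by apply: ltW; near: s; exact: nbhs_right_gt.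
rewrite distrC ger0_norm ?subr_ge0 ?inf_range_homo// lerBlDl.
apply: le_trans (inf_range_le i s) _.
have : `|F i t - F i s| <= e / 2 by near: s; move/cvgrPdist_le: (@F_rc i t); exact.
by rewrite ler_norml => /andP[? _]; lra.
Unshelve. all: by end_near. Qed.

End law_of_distribution_function.

(** * Sums of independent messages *)

Section clipped_sums.
Context {R : realType}.
Implicit Types (mu nu : probability R R) (f u : R -> R) (y s : R).

Lemma measurable_pospart : measurable_fun setT (@pospart R).
Proof. exact: measurable_maxr. Qed.

Lemma measurable_clip01 : measurable_fun setT (@clip01 R).
Proof. by have [] := bdd_lipschitz_measurable (@bdd_lipschitz_clip01 R). Qed.

Lemma measurable_invr : measurable_fun setT (fun s : R => s^-1).
Proof.
have -> : (fun s : R => s^-1) = (fun s => s * ((s ^+ 2) `^ (-1))).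
  apply/funext => s; rewrite powR_inv1 ?sqr_ge0//.
  by have [->|s0] := eqVneq s 0; [rewrite invr0 mul0r | field].
apply: measurable_funM => //; apply: (measurableT_comp (@measurable_powR R (-1))).
exact: exprn_measurable.
Qed.

Lemma measurable_cavity (c : R) : measurable_fun setT (cavity c).
Proof.
apply: measurable_funM => //; apply: (measurableT_comp measurable_invr).
by apply: measurable_funD => //; exact: measurable_pospart.
Qed.

HB.instance Definition _ (c : R) :=
  isMeasurableFun.Build _ _ _ _ (cavity c) (measurable_cavity c).

Definition clip_add (p : R * R) : R := clip01 p.1 + pospart p.2.

Lemma measurable_clip_add : measurable_fun setT clip_add.
Proof.
apply: measurable_funD.
  exact: (measurableT_comp measurable_clip01 measurable_fst).
exact: (measurableT_comp measurable_pospart measurable_snd).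
Qed.

HB.instance Definition _ := isMeasurableFun.Build _ _ _ _ clip_add measurable_clip_add.

Lemma clip_add_ge0 y s : 0 <= clip01 y + pospart s.
Proof. by rewrite addr_ge0 ?clip01_ge0 ?pospart_ge0. Qed.

Lemma pospart_clip_add y s : pospart (clip01 y + pospart s) = clip01 y + pospart s.
Proof. exact/pospart_id/clip_add_ge0. Qed.

(* On laws carried by [0, 1] and [0, +oo[ the truncations in [clip_add] are
   invisible; they make all identities below hold without almost-sure provisos. *)
Definition add_law mu nu : probability R R := distribution (mu \x nu)%E clip_add.

Fixpoint sum_law mu (k : nat) : probability R R :=
  if k is k'.+1 then add_law mu (sum_law mu k') else \d_(0 : R).

Lemma bdd_measurable_clip_add f y : bdd_measurable f ->
  bdd_measurable (fun s => f (clip01 y + pospart s)).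
Proof. by move=> /bdd_measurable_comp/(_ measurable_clip_add)/(bdd_measurable_pair1 y). Qed.

Lemma bdd_measurable_Ex_clip_add nu f : bdd_measurable f ->
  bdd_measurable (fun y => Ex nu (fun s => f (clip01 y + pospart s))).
Proof. by move=> /bdd_measurable_comp/(_ measurable_clip_add)/(bdd_measurable_Ex nu). Qed.

Lemma Ex_add_law mu nu f : bdd_measurable f ->
  Ex (add_law mu nu) f = Ex mu (fun y => Ex nu (fun s => f (clip01 y + pospart s))).
Proof.
move=> bf; have bfc := bdd_measurable_comp bf measurable_clip_add.
rewrite -(Ex_prod mu nu bfc); apply: EFin_inj; rewrite -!Ex_EFin//.
rewrite integral_distribution//; first by apply/measurable_EFinP; case: bf.
exact: bdd_measurable_integrable.
Qed.

Lemma measurable_iint mu (k : nat) :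
  forall (d : measure_display) (T : measurableType d) (h : T * R -> \bar R),
  measurable_fun setT h ->
  measurable_fun setT (fun t => iint mu k (fun s : seq R => h (t, \sum_(y <- s) y))).
Proof.
elim: k => [|k IH] d T h mh.
  by rewrite /= big_nil; apply: (measurableT_comp mh); exact: measurable_fun_pair.
have mh_add : measurable_fun setT (fun p : (T * R) * R => h (p.1.1, p.1.2 + p.2)).
  apply: (measurableT_comp mh); apply: measurable_fun_pair.
    exact: (measurableT_comp measurable_fst).
  apply: measurable_funD; last exact: measurable_snd.
  exact: (measurableT_comp measurable_snd).
have := measurable_integral_param mu (IH _ _ _ mh_add); apply: eq_measurable_fun => t _ /=.
by apply: eq_integral => y _; congr iint; apply/funext => s; rewrite big_cons.
Qed.

Lemma iint_sum_law mu k F f a : supp01 mu -> measurable_fun setT F -> bdd_measurable f ->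
  (forall s, 0 <= s -> F s = f s) -> 0 <= a ->
  iint mu k (fun t : seq R => (F (a + \sum_(y <- t) y))%:E) =
  (Ex (sum_law mu k) (fun s => f (a + pospart s)))%:E.
Proof.
move=> mu01 mF bf Ff.
have bfa b : bdd_measurable (fun s => f (b + pospart s)).
  by apply: (bdd_measurable_comp bf); apply: measurable_funD => //; exact: measurable_pospart.
elim: k a => [|k IH] a a0 /=.
  by rewrite big_nil Ff ?addr0// Ex_dirac// pospart_id ?addr0.
rewrite Ex_add_law// -Ex_EFin; last exact: bdd_measurable_Ex_clip_add (bfa a).
apply: ae_eq_integral => //.
- have mFa : measurable_fun setT (fun p : R * R => (F (a + (p.1 + p.2)))%:E).
    apply/measurable_EFinP/(measurableT_comp mF); apply: measurable_funD => //.
    by apply: measurable_funD; [exact: measurable_fst | exact: measurable_snd].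
  have := measurable_iint mu k mFa; apply: eq_measurable_fun => y _ /=.
  by congr iint; apply/funext => s; rewrite big_cons.
- by apply/measurable_EFinP; exact: (bdd_measurable_Ex_clip_add _ (bfa a)).1.
exists (~` [set y | 0 <= y <= 1]); split.
- by apply: measurableC; exact: measurable_01.
- by rewrite [LHS]probability_setC ?mu01 ?subee//; exact: measurable_01.
apply: subsetC => y y01 /= _; have y0 : 0 <= y by case/andP: y01.
under eq_fun do rewrite big_cons addrA.
rewrite IH ?addr_ge0//; congr (Ex _ _)%:E; apply/funext => s.
by rewrite pospart_clip_add clip01_id// addrA.
Qed.

Lemma le_Ex_sum_law mu k f g : bdd_measurable f -> bdd_measurable g ->
  (forall s, 0 <= s <= k%:R -> f s <= g s) -> Ex (sum_law mu k) f <= Ex (sum_law mu k) g.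
Proof.
elim: k f g => [|k IH] f g bf bg fg /=; first by rewrite !Ex_dirac// fg// lexx.
rewrite !Ex_add_law//; apply: le_Ex; try exact: bdd_measurable_Ex_clip_add.
move=> y; apply: IH; try exact: bdd_measurable_clip_add.
move=> s /andP[s0 sk]; apply: fg; rewrite clip_add_ge0/= pospart_id//.
by rewrite -natr1 addrC lerD ?clip01_le1.
Qed.

Lemma bdd_measurable_pospartM u y :
  bdd_measurable u -> bdd_measurable (fun s => pospart s * u s) ->
  bdd_measurable (fun s => pospart s * u (clip01 y + pospart s)).
Proof.
move=> bu bpu; have := bdd_measurableB (bdd_measurable_clip_add y bpu)
  (bdd_measurableZ (clip01 y) (bdd_measurable_clip_add y bu)).
congr bdd_measurable; apply/funext => s.
by rewrite pospart_clip_add mulrDl addrAC subrr add0r.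
Qed.

Lemma bdd_measurable_Ex_clip01M mu u : bdd_measurable u ->
  bdd_measurable (fun y => Ex mu (fun s => clip01 y * u (clip01 y + pospart s))).
Proof.
move=> bu; apply: (bdd_measurable_Ex _ (h := fun p : R * R => clip01 p.1 * u (clip_add p))).
apply: bdd_measurableM; last exact: (bdd_measurable_comp bu measurable_clip_add).
have bclip := bdd_lipschitz_measurable (@bdd_lipschitz_clip01 R).
exact: (bdd_measurable_comp bclip measurable_fst).
Qed.

(* Exchangeability of the [k.+1] summands. *)
Lemma Ex_sum_law_size_bias mu k u :
  bdd_measurable u -> bdd_measurable (fun s => pospart s * u s) ->
  Ex (sum_law mu k.+1) (fun s => pospart s * u s) =
  k.+1%:R * Ex mu (fun y => Ex (sum_law mu k) (fun s => clip01 y * u (clip01 y + pospart s))).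
Proof.
elim: k u => [|k IH] u bu bpu.
  rewrite mul1r -[sum_law mu 1]/(add_law mu (sum_law mu 0)) (Ex_add_law _ _ bpu).
  congr Ex; apply/funext => y.
  have bZ := bdd_measurableZ (clip01 y) (bdd_measurable_clip_add y bu).
  by rewrite !Ex_dirac ?pospart_clip_add ?pospart_id ?addr0//; exact: bdd_measurable_clip_add bpu.
pose tagged y := Ex (sum_law mu k.+1) (fun s => clip01 y * u (clip01 y + pospart s)).
pose tagged2 (p : R * R) :=
  Ex (sum_law mu k) (fun s => clip01 p.2 * u (clip01 p.1 + pospart (clip01 p.2 + pospart s))).
have bclip := bdd_lipschitz_measurable (@bdd_lipschitz_clip01 R).
have btagged : bdd_measurable tagged by exact: bdd_measurable_Ex_clip01M.
have btagged2 : bdd_measurable tagged2.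
  apply: (bdd_measurable_Ex _ (h := fun q : (R * R) * R =>
    clip01 q.1.2 * u (clip_add (q.1.1, clip_add (q.1.2, q.2))))).
  apply: bdd_measurableM.
    exact: (bdd_measurable_comp bclip (measurableT_comp measurable_snd measurable_fst)).
  apply: (bdd_measurable_comp bu); apply: (measurableT_comp measurable_clip_add).
  apply: measurable_fun_pair; first exact: (measurableT_comp measurable_fst measurable_fst).
  apply: (measurableT_comp measurable_clip_add); apply: measurable_fun_pair => //.
  exact: (measurableT_comp measurable_snd measurable_fst).
have first_summand y : Ex (sum_law mu k.+1)
      (fun s => pospart (clip01 y + pospart s) * u (clip01 y + pospart s)) =
    tagged y + k.+1%:R * Ex mu (fun z => tagged2 (y, z)).
  have buy := bdd_measurable_clip_add y bu.
  have bpuy := bdd_measurable_pospartM y bu bpu.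
  rewrite -(IH _ buy bpuy) -ExD//; last exact: bdd_measurableZ.
  by congr Ex; apply/funext => s; rewrite pospart_clip_add mulrDl.
rewrite -[sum_law mu k.+2]/(add_law mu (sum_law mu k.+1)) (Ex_add_law _ _ bpu).
under eq_fun do rewrite first_summand.
have btagged2E := bdd_measurable_Ex mu btagged2.
rewrite (ExD _ btagged (bdd_measurableZ _ btagged2E)) (ExZ _ _ btagged2E).
rewrite -[k.+2%:R]natr1 [RHS]mulrDl mul1r addrC; congr (_ * _ + _).
rewrite (Ex_exchange mu mu btagged2); congr Ex; apply/funext => z.
rewrite /tagged -[sum_law mu k.+1]/(add_law mu (sum_law mu k)) Ex_add_law; last first.
  exact/bdd_measurableZ/bdd_measurable_clip_add.
congr Ex; apply/funext => y; congr Ex; apply/funext => s /=.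
by rewrite !pospart_clip_add addrCA.
Qed.

End clipped_sums.

Section order_of_sums.
Context {R : realType}.
Implicit Types (mu nu : probability R R) (f : R -> R).

Lemma clip_add_lipschitz y : 1.-lipschitz (fun s : R => clip01 y + pospart s).
Proof.
by apply/klipschitzP => s t; rewrite opprD addrACA subrr add0r mul1r pospart_nonexpansive.
Qed.

Lemma bdd_lipschitz_clip_add f y : bdd_lipschitz f ->
  bdd_lipschitz (fun s => f (clip01 y + pospart s)).
Proof. by move=> bf; exact: bdd_lipschitz_comp bf (clip_add_lipschitz y). Qed.

Lemma bdd_lipschitz_Ex_clip_add nu f : bdd_lipschitz f ->
  bdd_lipschitz (fun y => Ex nu (fun s => f (clip01 y + pospart s))).
Proof.
move=> bf; have bm y := bdd_measurable_clip_add y (bdd_lipschitz_measurable bf).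
case: (bf) => [[L Lf] [M fM]]; split; last by exists M => y; exact: normr_Ex_le.
exists L; apply/klipschitzP => y z; rewrite -ExB//; apply: normr_Ex_le => [|s].
  exact: bdd_measurableB.
apply: le_trans ((klipschitzP L f).1 Lf _ _) _; rewrite ler_wpM2l ?(klipschitz_ge0 Lf)//.
by rewrite opprD addrACA subrr addr0 clip01_nonexpansive.
Qed.

Lemma st_le_sum_law mu nu k : st_le mu nu -> st_le (sum_law mu k) (sum_law nu k).
Proof.
move=> mn; elim: k => [|k IH] f bf f_homo //=; have bm := bdd_lipschitz_measurable bf.
rewrite !Ex_add_law//; apply: (@le_trans _ _
  (Ex mu (fun y => Ex (sum_law nu k) (fun s => f (clip01 y + pospart s))))).
  apply: le_Ex => [| |y]; try exact: bdd_measurable_Ex_clip_add.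
  apply: IH; first exact: bdd_lipschitz_clip_add.
  by move=> s t st; apply: f_homo; rewrite lerD2l pospart_homo.
apply: mn; first exact: bdd_lipschitz_Ex_clip_add.
move=> y z yz; apply: le_Ex => [| |s]; try exact: bdd_measurable_clip_add.
by apply: f_homo; rewrite lerD2r clip01_homo.
Qed.

Lemma Ex_sum_law_cavity_anti c mu nu k : 0 < c -> st_le mu nu ->
  Ex (sum_law nu k) (cavity c) <= Ex (sum_law mu k) (cavity c).
Proof.
move=> c0 mn; apply: (st_le_anti (st_le_sum_law k mn)); first exact: bdd_lipschitz_cavity.
exact: cavity_anti.
Qed.

(* The factor is the smallest slope of [- cavity c] on [0, k + 1]. *)
Lemma Ex_sum_law_cavity_gap c mu nu k : 0 < c -> st_le mu nu ->
  c / (c + k.+1%:R) ^+ 2 * (mean01 nu - mean01 mu) <=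
  Ex (sum_law mu k.+1) (cavity c) - Ex (sum_law nu k.+1) (cavity c).
Proof.
move=> c0 mn; have bc := bdd_lipschitz_cavity c0; have bm := bdd_lipschitz_measurable bc.
set L := c / _; pose phi y := Ex (sum_law nu k) (fun s => cavity c (clip01 y + pospart s)).
have bphi : bdd_lipschitz phi by exact: bdd_lipschitz_Ex_clip_add.
have bL := bdd_lipschitzZ L (@bdd_lipschitz_clip01 R).
have phi_le : Ex mu phi <= Ex (sum_law mu k.+1) (cavity c).
  rewrite /= Ex_add_law//; apply: le_Ex => [| |y]; try exact: bdd_measurable_Ex_clip_add.
  apply: (st_le_anti (st_le_sum_law k mn)); first exact: bdd_lipschitz_clip_add.
  by move=> s t st; apply: cavity_anti => //; rewrite lerD2l pospart_homo.
have -> : Ex (sum_law nu k.+1) (cavity c) = Ex nu phi by rewrite /= Ex_add_law.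
suff : Ex nu (fun y => phi y + L * clip01 y) <= Ex mu (fun y => phi y + L * clip01 y).
  rewrite !ExD ?(ExZ _ L)//; try exact: bdd_lipschitz_measurable.
  - by rewrite mulrBr /mean01 => ?; lra.
  - exact/bdd_lipschitz_measurable/bdd_lipschitz_clip01.
  - exact/bdd_lipschitz_measurable/bdd_lipschitz_clip01.
apply: (st_le_anti mn) => [|z y yz]; first exact: bdd_lipschitzD.
rewrite -lerBrDr -addrA -mulrBr /phi -[X in _ <= _ + X](Ex_cst (sum_law nu k)) -ExD; last 2 first.
- exact: bdd_measurable_clip_add.
- exact: bdd_measurable_cst.
apply: le_Ex_sum_law; first exact: bdd_measurable_clip_add.
  by apply: bdd_measurableD; [exact: bdd_measurable_clip_add | exact: bdd_measurable_cst].
move=> s /andP[s0 sk]; rewrite pospart_id// -lerBlDl -lerN2 opprB -mulrN opprB.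
have -> : clip01 z - clip01 y = (clip01 z + s) - (clip01 y + s) by lra.
have k1 : k.+1%:R = k%:R + 1 :> R by rewrite natr1.
have ys := clip01_homo yz; have y0 := clip01_ge0 y; have z1 := clip01_le1 z.
by apply: cavity_slope => //; rewrite ?k1; lra.
Qed.

End order_of_sums.

(** * The distributional recursion *)

Lemma partial_sum_le_lim {R : realType} (u : nat -> R) (l : R) n :
  (forall k, 0 <= u k) -> (fun N => \sum_(k < N) u k) @ \oo --> l -> \sum_(k < n) u k <= l.
Proof.
move=> u0 u_cvg; apply: (cvgr_to_ge u_cvg); exists n => // m /= nm.
by rewrite -!(big_mkord xpredT u) [leRHS](big_cat_nat (leq0n n) nm)//= lerDl sumr_ge0.
Qed.

Record offspring_law (R : realType) := OffspringLaw {
  offspring_prob :> nat -> R;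
  offspring_ge0 : forall k, 0 <= offspring_prob k;
  offspring_sum1 : (fun n => \sum_(k < n) offspring_prob k) @ \oo --> (1 : R) }.

Definition unimodular {R : realType} (P rho : nat -> R) (Pbar : R) : Prop :=
  forall k, k.+1%:R * P k.+1 = Pbar * rho k.

Section cavity_law.
Context {R : realType}.
Variables (q : offspring_law R) (c : R).
Implicit Types (mu nu : probability R R) (f g : R -> R) (A : set R).

Definition cavity_law_measure mu : set R -> \bar R :=
  mseries (fun k => mscale (NngNum (offspring_ge0 q k))
    (distribution (sum_law mu k) (cavity c : {mfun R >-> R}))) 0.

HB.instance Definition _ mu := Measure.on (cavity_law_measure mu).

Lemma offspring_eseries1 : (\sum_(k <oo) (q k)%:E)%E = 1%E.
Proof.
apply/cvg_lim => //.
rewrite (_ : (fun n => _) = EFin \o (fun n => \sum_(k < n) q k)); last first.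
  by apply/funext => n /=; rewrite -sumEFin big_mkord.
by apply/cvg_EFin; [exact: nearW | exact: offspring_sum1].
Qed.

Lemma cavity_law_setT mu : cavity_law_measure mu setT = 1%E.
Proof.
rewrite -offspring_eseries1 /cavity_law_measure /mseries; apply: eq_eseriesr => k _.
rewrite /mscale -[RHS]mule1; congr (_ * _)%E; exact: (probability_setT (distribution _ _)).
Qed.

HB.instance Definition _ mu :=
  Measure_isProbability.Build _ _ _ (cavity_law_measure mu) (cavity_law_setT mu).

(* The law of [c / (c + X_1 + ... + X_K)] for [K ~ q] and independent [X_i ~ mu]. *)
Definition cavity_law mu : probability R R := cavity_law_measure mu.

Lemma cavity_lawE mu A :
  cavity_law mu A = (\sum_(k <oo) (q k)%:E * sum_law mu k (cavity c @^-1` A))%E.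
Proof. by []. Qed.

Lemma bdd_measurable_cavity f : bdd_measurable f -> bdd_measurable (f \o cavity c).
Proof. by move=> /bdd_measurable_comp; apply; exact: measurable_cavity. Qed.

Lemma Ex_cavity_law mu f : bdd_measurable f ->
  (fun n => \sum_(k < n) q k * Ex (sum_law mu k) (f \o cavity c)) @ \oo --> Ex (cavity_law mu) f.
Proof.
move=> bf; wlog f0 : f bf / forall y, 0 <= f y.
  move=> ge0_case; have [mf [M fM]] := bf; have bM := @bdd_measurable_cst _ R R M.
  have bg : bdd_measurable (fun y => f y + M) by exact: bdd_measurableD.
  have g0 y : 0 <= f y + M by have := fM y; rewrite ler_norml => /andP[+ _]; lra.
  have shifted := cvgB (ge0_case _ bg g0) (cvgM (offspring_sum1 q) (cvg_cst M)).
  rewrite ExD// Ex_cst mul1r addrK in shifted.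
  rewrite (_ : (fun n => _) = (fun n =>
    \sum_(k < n) q k * Ex (sum_law mu k) ((fun y => f y + M) \o cavity c) -
    (\sum_(k < n) q k) * M)).
    exact: shifted.
  apply/funext => n /=; rewrite mulr_suml -sumrB; apply: eq_bigr => k _.
  by rewrite (ExD _ (bdd_measurable_cavity bf) bM) Ex_cst mulrDr addrK.
have seriesE : (\int[cavity_law mu]_y (f y)%:E)%E =
    (\sum_(k <oo) (q k * Ex (sum_law mu k) (f \o cavity c))%:E)%E.
  have mf : measurable_fun setT (fun y => (f y)%:E) by apply/measurable_EFinP; case: bf.
  have fE0 y : (0 <= (f y)%:E)%E by rewrite lee_fin.
  rewrite [LHS]ge0_integral_measure_series//; apply: eq_eseriesr => k _.
  rewrite ge0_integral_mscale// EFinM; congr (_ * _)%E.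
  by rewrite ge0_integral_distribution// -Ex_EFin//; exact: bdd_measurable_cavity.
have : (fun n => (\sum_(k < n) q k * Ex (sum_law mu k) (f \o cavity c))%:E) @ \oo -->
    (Ex (cavity_law mu) f)%:E.
  rewrite -Ex_EFin// seriesE.
  pose term k := (q k * Ex (sum_law mu k) (f \o cavity c))%:E.
  under eq_fun do rewrite -sumEFin -(big_mkord xpredT term).
  by apply: is_cvg_nneseries => k _ _; rewrite lee_fin mulr_ge0 ?offspring_ge0// Ex_ge0//= => y.
by move=> /fine_cvg; exact.
Qed.

Lemma cavity_law_partial_sum_le mu f n : bdd_measurable f -> (forall y, 0 <= f y) ->
  \sum_(k < n) q k * Ex (sum_law mu k) (f \o cavity c) <= Ex (cavity_law mu) f.
Proof.
move=> bf f0; pose term k := q k * Ex (sum_law mu k) (f \o cavity c).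
apply: (@partial_sum_le_lim R term) => [k|]; last exact: Ex_cavity_law.
by rewrite mulr_ge0 ?offspring_ge0// Ex_ge0//= => y.
Qed.

Lemma le_Ex_cavity_law mu nu f g : bdd_measurable f -> bdd_measurable g ->
  (forall k, Ex (sum_law mu k) (f \o cavity c) <= Ex (sum_law nu k) (g \o cavity c)) ->
  Ex (cavity_law mu) f <= Ex (cavity_law nu) g.
Proof.
move=> bf bg fg; apply: (ler_cvg_to (Ex_cavity_law (mu := mu) bf) (Ex_cavity_law (mu := nu) bg)).
by apply: nearW => n; apply: ler_sum => k _; rewrite ler_wpM2l ?offspring_ge0.
Qed.

Hypothesis c0 : 0 < c.

Lemma supp01_cavity_law mu : supp01 (cavity_law mu).
Proof.
rewrite /supp01 cavity_lawE -offspring_eseries1; apply: eq_eseriesr => k _.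
rewrite (_ : cavity c @^-1` _ = setT) ?probability_setT ?mule1//.
by apply/seteqP; split => // s _ /=; exact: cavity_bounds.
Qed.

Lemma cavity_law_anti mu nu : st_le mu nu -> st_le (cavity_law nu) (cavity_law mu).
Proof.
move=> mn f bf f_homo; have bm := bdd_lipschitz_measurable bf.
apply: le_Ex_cavity_law => // k; apply: (st_le_anti (st_le_sum_law k mn)).
  exact: bdd_lipschitz_comp bf (cavity_lipschitz c0).
by move=> s t st /=; apply: f_homo; exact: cavity_anti.
Qed.

Lemma clip01_cavity : clip01 \o cavity c = cavity c.
Proof. by apply/funext => s /=; rewrite clip01_id// cavity_bounds. Qed.

Lemma mean01_cavity_law mu :
  (fun n => \sum_(k < n) q k * Ex (sum_law mu k) (cavity c)) @ \oo --> mean01 (cavity_law mu).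
Proof.
have := Ex_cavity_law (mu := mu) (bdd_lipschitz_measurable (@bdd_lipschitz_clip01 R)).
by rewrite clip01_cavity.
Qed.

Lemma mean01_cavity_law_gap mu nu k : st_le mu nu ->
  q k.+1 * (c / (c + k.+1%:R) ^+ 2) * (mean01 nu - mean01 mu) <=
  mean01 (cavity_law mu) - mean01 (cavity_law nu).
Proof.
move=> mn; pose gap n := \sum_(k < n) q k * Ex (sum_law mu k) (cavity c) -
  \sum_(k < n) q k * Ex (sum_law nu k) (cavity c).
have gap_cvg : gap @ \oo --> mean01 (cavity_law mu) - mean01 (cavity_law nu).
  by apply: cvgB; exact: mean01_cavity_law.
apply: (cvgr_to_ge gap_cvg); exists k.+2 => // n /= kn.
rewrite /gap -sumrB (bigD1 (Ordinal kn))//= -mulrBr -[leLHS]addr0 lerD//.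
  by rewrite -mulrA ler_wpM2l ?offspring_ge0// Ex_sum_law_cavity_gap.
apply: sumr_ge0 => i _; rewrite -mulrBr mulr_ge0 ?offspring_ge0// subr_ge0.
exact: Ex_sum_law_cavity_anti.
Qed.

End cavity_law.

Section recursion_equation.
Context {R : realType} (q : offspring_law R) (x : R).
Hypothesis x0 : 0 < x.
Implicit Types (mu : probability R R) (A : set R).
Let c0 : 0 < x ^+ 2 := exprn_gt0 2 x0.

Lemma measurable_fraction (c : R) : measurable_fun setT (fun s : R => c / (c + s)).
Proof.
apply: measurable_funM => //; apply: (measurableT_comp measurable_invr).
exact: measurable_funD.
Qed.

Lemma iint_cavity mu k (F f : R -> R) : supp01 mu -> measurable_fun setT F -> bdd_measurable f ->
  (forall y, 0 <= y <= 1 -> F y = f y) ->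
  iint mu k (fun s => (F (x ^+ 2 / (x ^+ 2 + \sum_(y <- s) y)))%:E) =
  (Ex (sum_law mu k) (f \o cavity (x ^+ 2)))%:E.
Proof.
move=> mu01 mF bf Ff.
pose frac s := x ^+ 2 / (x ^+ 2 + s).
have fracE s : 0 <= s -> (F \o frac) s = (f \o cavity (x ^+ 2)) s.
  by move=> s0 /=; rewrite /frac -cavityE// Ff// cavity_bounds.
have mfrac := measurableT_comp mF (measurable_fraction (x ^+ 2)).
transitivity (iint mu k (fun t : seq R => ((F \o frac) (0 + \sum_(y <- t) y))%:E)).
  by congr iint; apply/funext => t; rewrite add0r.
rewrite (iint_sum_law k mu01 mfrac (bdd_measurable_cavity _ bf) fracE)//.
by congr (Ex _ _)%:E; apply/funext => s /=; rewrite add0r /cavity pospartK.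
Qed.

Lemma EY_cavity_law mu : supp01 mu -> EY q x mu = (mean01 (cavity_law q (x ^+ 2) mu))%:E.
Proof.
move=> mu01; apply/cvg_lim => //.
rewrite (_ : (fun n => _) =
    EFin \o (fun n => \sum_(k < n) q k * Ex (sum_law mu k) (cavity (x ^+ 2)))).
  by apply/cvg_EFin; [exact: nearW | exact: mean01_cavity_law].
apply/funext => n /=; rewrite -sumEFin big_mkord; apply: eq_bigr => k _.
rewrite EFinM -(clip01_cavity c0); congr (_ * _)%E.
apply: (iint_cavity k (F := id)) => // [|y y01]; last by rewrite clip01_id.
exact/bdd_lipschitz_measurable/bdd_lipschitz_clip01.
Qed.

Lemma rde_rhs_cavity_law mu A : supp01 mu -> measurable A ->
  rde_rhs q x mu A = cavity_law q (x ^+ 2) mu A.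
Proof.
move=> mu01 mA; rewrite cavity_lawE; apply: eq_eseriesr => k _; congr (_ * _)%E.
have mcA : measurable (cavity (x ^+ 2) @^-1` A).
  by rewrite -[X in measurable X]setTI; apply: measurable_cavity.
rewrite (iint_cavity k mu01 (measurable_indic mA) (bdd_measurable_indic mA))//.
by rewrite -(Ex_indic _ mcA).
Qed.

Lemma is_rde_solP mu : is_rde_sol q x mu <->
  supp01 mu /\ eq_law mu (cavity_law q (x ^+ 2) mu).
Proof.
by split=> -[mu01 fix_mu]; split=> // A mA; have := fix_mu A mA; rewrite rde_rhs_cavity_law.
Qed.

End recursion_equation.

Section edge_reversal.
Context {R : realType} (c : R).
Hypothesis c0 : 0 < c.
Implicit Types (mu nu : probability R R) (y s a b : R).

(* The probability that an edge is covered, given the messages along it in the two directions. *)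
Definition edge_cover (p : R * R) : R := 1 - cavity c (clip01 p.1 * clip01 p.2).

Definition mean_edge_cover mu a : R := Ex mu (fun y => edge_cover (y, a)).

Lemma bdd_measurable_edge_cover : bdd_measurable edge_cover.
Proof.
apply: bdd_measurableB; first exact: bdd_measurable_cst.
apply: (bdd_measurable_comp (bdd_lipschitz_measurable (bdd_lipschitz_cavity c0))).
by apply: measurable_funM; apply: (measurableT_comp measurable_clip01).
Qed.

Lemma mean_edge_cover_dist mu a b :
  `|mean_edge_cover mu a - mean_edge_cover mu b| <= c^-1 * `|clip01 a - clip01 b|.
Proof.
have bK e := bdd_measurable_pair2 e bdd_measurable_edge_cover.
rewrite /mean_edge_cover -ExB//; apply: normr_Ex_le => [|y]; first exact: bdd_measurableB.
rewrite /edge_cover /= opprB addrC addrA subrK.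
rewrite (le_trans (cavityB_le _ _ c0))// ler_wpM2l ?invr_ge0 ?(ltW c0)//.
by rewrite -mulrBr normrM (ger0_norm (clip01_ge0 y)) distrC ler_piMl// clip01_le1.
Qed.

Lemma bdd_lipschitz_mean_edge_cover mu : bdd_lipschitz (mean_edge_cover mu).
Proof.
split; last first.
  have [_ [M coverM]] := bdd_measurable_edge_cover; exists M => a; apply: normr_Ex_le => //.
  exact: bdd_measurable_pair2 bdd_measurable_edge_cover.
exists c^-1; apply/klipschitzP => a b; apply: le_trans (mean_edge_cover_dist mu a b) _.
by rewrite ler_wpM2l ?invr_ge0 ?(ltW c0)// clip01_nonexpansive.
Qed.

Lemma Ex_mean_edge_cover_sym mu nu :
  Ex mu (mean_edge_cover nu) = Ex nu (mean_edge_cover mu).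
Proof.
rewrite /mean_edge_cover -(Ex_exchange nu mu bdd_measurable_edge_cover).
congr Ex; apply/funext => a; congr Ex; apply/funext => y.
by rewrite /edge_cover/= mulrC.
Qed.

Lemma edge_cover_cavity y s :
  edge_cover (y, cavity c s) = clip01 y * (c + (clip01 y + pospart s))^-1.
Proof.
have y0 := clip01_ge0 y; have s0 := pospart_ge0 s; have d0 := cavity_den_gt0 s c0.
rewrite /edge_cover /= (clip01_id (cavity_bounds _ c0)) [cavity c (_ * _)]cavityE; last first.
  by rewrite mulr_ge0// cavity_ge0.
have yc0 : 0 <= clip01 y * c by rewrite mulr_ge0// ltW.
by rewrite /cavity; field; rewrite !gt_eqF// ltr_wpDr ?mulr_gt0 ?addr_ge0.
Qed.

Lemma Ex_sum_law_covered mu k : Ex (sum_law mu k.+1) (fun s => 1 - cavity c s) =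
  k.+1%:R * Ex (sum_law mu k) (mean_edge_cover mu \o cavity c).
Proof.
pose u s := (c + pospart s)^-1.
have bcav := bdd_lipschitz_measurable (bdd_lipschitz_cavity c0).
have coverE s : 1 - cavity c s = pospart s * u s.
  by rewrite /u /cavity; field; rewrite gt_eqF// cavity_den_gt0.
have bu : bdd_measurable u.
  rewrite (_ : u = fun s => c^-1 * cavity c s); first exact: bdd_measurableZ.
  by apply/funext => s; rewrite /cavity mulrA mulVf ?mul1r// gt_eqF.
have bpu : bdd_measurable (fun s => pospart s * u s).
  under eq_fun do rewrite -coverE.
  by apply: bdd_measurableB => //; exact: bdd_measurable_cst.
under eq_fun do rewrite coverE.
rewrite (Ex_sum_law_size_bias mu k bu bpu); congr (_ * _).
have bK : bdd_measurable (fun p : R * R => edge_cover (p.1, cavity c p.2)).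
  apply: (bdd_measurable_comp bdd_measurable_edge_cover); apply: measurable_fun_pair => //.
  exact: (measurableT_comp (@measurable_cavity _ c)).
rewrite -(Ex_exchange _ _ bK); congr Ex; apply/funext => y; congr Ex; apply/funext => s.
by rewrite edge_cover_cavity /u pospart_clip_add.
Qed.

(* Counting covered half-edges from both endpoints: unimodularity turns the
   root degree bias into an independent pair of messages along one edge. *)
Lemma mean01_cavity_law_unimodular (P rho : offspring_law R) (Pbar : R) mu :
  unimodular P rho Pbar ->
  mean01 (cavity_law P c mu) = 1 - Pbar * Ex (cavity_law rho c mu) (mean_edge_cover mu).
Proof.
move=> P_rho; have bclip := bdd_lipschitz_measurable (@bdd_lipschitz_clip01 R).
have bcover : bdd_measurable (fun y : R => 1 - clip01 y).
  by apply: bdd_measurableB => //; exact: bdd_measurable_cst.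
have covered_root := Ex_cavity_law (q := P) (c := c) (mu := mu) bcover.
rewrite ExB// in covered_root; last exact: bdd_measurable_cst.
rewrite Ex_cst -(cvg_shiftn 1) in covered_root.
have covered_edge := Ex_cavity_law (q := rho) (c := c) (mu := mu)
  (bdd_lipschitz_measurable (bdd_lipschitz_mean_edge_cover mu)).
suff : 1 - mean01 (cavity_law P c mu) = Pbar * Ex (cavity_law rho c mu) (mean_edge_cover mu) by lra.
apply: (cvg_unique _ covered_root) => //.
have cover_cavE : (fun y => 1 - clip01 y) \o cavity c = fun s => 1 - cavity c s.
  by apply/funext => s /=; rewrite clip01_id// cavity_bounds.
rewrite cover_cavE (_ : (fun n => _) = (fun n =>
    Pbar * \sum_(k < n) rho k * Ex (sum_law mu k) (mean_edge_cover mu \o cavity c))).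
  by apply: cvgM; [exact: cvg_cst | exact: covered_edge].
apply/funext => n; rewrite /= addn1 big_ord_recl /= Ex_dirac; last first.
  by rewrite -cover_cavE; exact: bdd_measurable_cavity.
rewrite cavityE// addr0 divff ?gt_eqF// subrr mulr0 add0r mulr_sumr.
apply: eq_bigr => k _; rewrite /bump/= add1n Ex_sum_law_covered.
by rewrite mulrA [P k.+1 * _]mulrC P_rho -mulrA.
Qed.

End edge_reversal.

Section iterated_laws.
Context {R : realType} (rho : offspring_law R) (c : R).
Hypothesis c0 : 0 < c.
Implicit Types (mu nu : probability R R).
Local Notation Phi := (cavity_law rho c).

Definition iter_law r : probability R R := iter r Phi (\d_(1 : R)).

Lemma supp01_iter_law r : supp01 (iter_law r).
Proof.
case: r => [|r]; last exact: supp01_cavity_law.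
by rewrite /supp01 /= diracE mem_set//= ler01 lexx.
Qed.

Lemma iter_law_parity nu r : supp01 nu ->
  if odd r then st_le (iter_law r) (iter r Phi nu) else st_le (iter r Phi nu) (iter_law r).
Proof.
move=> nu01; elim: r => [|r]; first exact: st_le_dirac1.
by rewrite /=; case: (odd r) => /= IH; exact: cavity_law_anti IH.
Qed.

Lemma iter_law_add r s :
  if odd r then st_le (iter_law r) (iter_law (r + s)) else st_le (iter_law (r + s)) (iter_law r).
Proof. by rewrite /iter_law iterD; apply: iter_law_parity; exact: supp01_iter_law. Qed.

Lemma iter_law_even_le i j : (i <= j)%N -> st_le (iter_law j.*2) (iter_law i.*2).
Proof.
rewrite -leq_double => /subnKC <-.
by have := iter_law_add i.*2 (j.*2 - i.*2); rewrite odd_double.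
Qed.

Lemma iter_law_odd_le_even i j : st_le (iter_law i.*2.+1) (iter_law j.*2).
Proof.
have [ij|ji] := leqP i.*2.+1 j.*2.
  by have := iter_law_add i.*2.+1 (j.*2 - i.*2.+1); rewrite subnKC//= odd_double.
by have := iter_law_add j.*2 (i.*2.+1 - j.*2); rewrite subnKC ?(ltnW ji)// odd_double.
Qed.

Definition sandwiched mu : Prop :=
  forall j, st_le (iter_law j.*2.+1) mu /\ st_le mu (iter_law j.*2).

Lemma sandwiched_cavity_law mu : sandwiched mu -> sandwiched (Phi mu).
Proof.
move=> mu_sandwiched j; split; first exact: (cavity_law_anti _ c0 (mu_sandwiched j).2).
case: j => [|j]; first exact/st_le_dirac1/supp01_cavity_law.
by rewrite doubleS; exact: (cavity_law_anti _ c0 (mu_sandwiched j).1).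
Qed.

Lemma sandwiched_fixpoint nu : supp01 nu -> eq_law nu (Phi nu) -> sandwiched nu.
Proof.
move=> nu01 nu_fix.
have le_iter : st_le nu (Phi nu) by exact: eq_law_st_le.
have iter_le : st_le (Phi nu) nu by apply: eq_law_st_le => A mA; rewrite -nu_fix.
have parity r : if odd r then st_le (iter_law r) nu else st_le nu (iter_law r).
  elim: r => [|r] /=; first exact: st_le_dirac1.
  case: (odd r) => /= IH; first exact: st_le_trans le_iter (cavity_law_anti _ c0 IH).
  exact: st_le_trans (cavity_law_anti _ c0 IH) iter_le.
move=> j; split; first by have := parity j.*2.+1; rewrite /= odd_double.
by have := parity j.*2; rewrite odd_double.
Qed.

Lemma exists_sandwiched : exists mu : probability R R, sandwiched mu.
Proof.
pose F j t := distr_fun (iter_law j.*2.+1) t.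
have F_homo j : {homo F j : s t / s <= t} by exact: distr_fun_homo.
have F_rc j : right_continuous (F j) by exact: distr_fun_right_continuous.
have F_ge j t : 0 <= F j t by exact: distr_fun_ge0.
have inf_cst t b : (forall j, F j t = b) -> inf (range (F ^~ t)) = b.
  move=> Fb; suff -> : range (F ^~ t) = [set b] by rewrite inf1.
  by apply/seteqP; split=> [_ [j _ <-]|_ ->]; [exact: Fb | exists 0%N].
have [mu muE] : exists mu : probability R R, distr_fun mu =1 (fun t => inf (range (F ^~ t))).
  apply: exists_law.
  - exact: (@inf_range_homo R _ 0%N F 0).
  - exact: (@inf_range_right_continuous R _ 0%N F 0).
  - apply: cvg_near_cst; exists 0; split=> // t t0; apply: inf_cst => j.
    exact: distr_fun_lt0 (supp01_iter_law _) t0.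
  - apply: cvg_near_cst; exists 1; split=> // t t1; apply: inf_cst => j.
    exact: distr_fun_ge1 (supp01_iter_law _) (ltW t1).
exists mu => j; split; apply: distr_fun_st_le => t; rewrite muE.
  exact: (@inf_range_le R _ 0%N F 0).
apply: (@le_inf_range R _ 0%N F 0) => // i; apply: st_le_distr_fun; exact: iter_law_odd_le_even.
Qed.

End iterated_laws.

Definition root_mean {R : realType} (P rho : offspring_law R) (c : R) r : R :=
  mean01 (cavity_law P c (iter_law rho c r)).

Section unimodular_fixpoint.
Context {R : realType}.
Variables (P rho : offspring_law R) (Pbar c : R).
Hypotheses (Pbar0 : 0 < Pbar) (P_rho : unimodular P rho Pbar) (c0 : 0 < c).
Implicit Types (mu nu : probability R R).
Local Notation iter_law := (iter_law rho c).
Local Notation m r := (mean01 (iter_law r)).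
Local Notation root_mean := (root_mean P rho c).

Lemma root_mean_gap_le j :
  root_mean j.*2.+1 - root_mean j.*2 <= Pbar / c * (m j.*2 - m j.*2.+2).
Proof.
rewrite /root_mean.
rewrite (mean01_cavity_law_unimodular c0 (iter_law j.*2.+1) P_rho).
rewrite (mean01_cavity_law_unimodular c0 (iter_law j.*2) P_rho).
rewrite -[cavity_law rho c (iter_law j.*2.+1)]/(iter_law j.*2.+2).
rewrite -[cavity_law rho c (iter_law j.*2)]/(iter_law j.*2.+1).
rewrite [Ex (iter_law j.*2.+1) _]Ex_mean_edge_cover_sym//.
set A := Ex _ _; set B := Ex _ _.
have -> : 1 - Pbar * A - (1 - Pbar * B) = Pbar * (B - A) by ring.
rewrite -mulrA ler_wpM2l ?(ltW Pbar0)//.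
have le_even := iter_law_even_le rho c0 (leqnSn j).
have := st_le_Ex_dist le_even (mean_edge_cover_dist c0 (iter_law j.*2.+1))
  (bdd_lipschitz_mean_edge_cover c0 _).
by apply: le_trans; exact: ler_norm.
Qed.

Lemma exists_offspring_gt0 : exists k, 0 < rho k.
Proof.
apply/not_existsP => rho0; have : 1 = 0 :> R; last by apply/eqP; rewrite oner_eq0.
apply: (cvg_unique _ (offspring_sum1 rho)) => //.
rewrite (_ : (fun n => _) = (fun=> 0)); first exact: cvg_cst.
apply/funext => n; apply: big1 => k _; apply/eqP; rewrite eq_le offspring_ge0 andbT leNgt.
exact/negP.
Qed.

Lemma mean01_iter_law_gap_le :
  exists2 C, 0 <= C & forall j, m j.*2 - m j.*2.+1 <= C * (m j.*2 - m j.*2.+2).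
Proof.
have [k rho_k] := exists_offspring_gt0.
have P_k : 0 < P k.+1.
  by rewrite -(pmulr_rgt0 (x := k.+1%:R))// P_rho mulr_gt0.
set slope := P k.+1 * (c / (c + k.+1%:R) ^+ 2).
have slope0 : 0 < slope by rewrite mulr_gt0// divr_gt0// exprn_gt0// ltr_wpDr.
exists (Pbar / c / slope); first by rewrite !divr_ge0// ltW.
move=> j; rewrite mulrAC ler_pdivlMr// mulrC.
apply: le_trans (root_mean_gap_le j); apply: mean01_cavity_law_gap => //.
exact: iter_law_odd_le_even.
Qed.

Lemma mean01_iter_law_even_cvg : cvgn (fun j => m j.*2).
Proof.
apply: nonincreasing_is_cvgn.
  by move=> i j ij; apply: st_le_mean01; exact: iter_law_even_le.
by exists 0 => _ [j _ <-]; apply: Ex_ge0 => y; exact: clip01_ge0.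
Qed.

Lemma mean01_iter_law_gap2_cvg : (fun j => m j.*2 - m j.*2.+2) @ \oo --> (0 : R).
Proof.
have even_cvg := mean01_iter_law_even_cvg.
have shift_cvg := even_cvg; rewrite /= -(cvg_shiftn 1) in shift_cvg.
have diff_cvg := cvgB even_cvg shift_cvg; rewrite subrr in diff_cvg.
rewrite (_ : (fun j => _) = (fun j => m j.*2 - m (j + 1).*2)); first exact: diff_cvg.
by apply/funext => j; rewrite addn1 doubleS.
Qed.

Lemma squeeze_gap (u : nat -> R) C : (forall j, 0 <= u j <= C * (m j.*2 - m j.*2.+2)) ->
  u @ \oo --> (0 : R).
Proof.
move=> u_le; apply: (squeeze_cvgr (nearW _ u_le)); first exact: cvg_cst.
by rewrite -(mulr0 C); apply: cvgM; [exact: cvg_cst | exact: mean01_iter_law_gap2_cvg].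
Qed.

Lemma mean01_iter_law_gap_cvg : (fun j => m j.*2 - m j.*2.+1) @ \oo --> (0 : R).
Proof.
have [C _ le_C] := mean01_iter_law_gap_le; apply: (squeeze_gap (C := C)) => j.
by rewrite le_C andbT subr_ge0; apply: st_le_mean01; exact: iter_law_odd_le_even.
Qed.

Lemma root_mean_gap_cvg : (fun j => root_mean j.*2.+1 - root_mean j.*2) @ \oo --> (0 : R).
Proof.
apply: (squeeze_gap (C := Pbar / c)) => j; rewrite root_mean_gap_le andbT subr_ge0.
by apply/st_le_mean01/cavity_law_anti => //; exact: iter_law_odd_le_even.
Qed.

Lemma sandwiched_le mu nu : sandwiched rho c mu -> sandwiched rho c nu -> st_le mu nu.
Proof.
move=> mu_sandwiched nu_sandwiched f bf f_homo; have [[L Lf] _] := bf.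
have bound_cvg : (fun j => Ex nu f + L * (m j.*2 - m j.*2.+1)) @ \oo --> Ex nu f.
  rewrite -[X in _ --> X]addr0 -(mulr0 L); apply: cvgD; first exact: cvg_cst.
  by apply: cvgM; [exact: cvg_cst | exact: mean01_iter_law_gap_cvg].
apply: (cvgr_to_ge bound_cvg); apply: nearW => j.
apply: le_trans ((mu_sandwiched j).2 f bf f_homo) _; rewrite -lerBlDl.
apply: le_trans (_ : Ex (iter_law j.*2) f - Ex (iter_law j.*2.+1) f <= _).
  by rewrite lerD2l lerN2; exact: (nu_sandwiched j).1.
rewrite -!(Ex_clip01 (supp01_iter_law _ c0 _) bf); apply: le_trans (ler_norm _) _.
apply: (st_le_Ex_dist (iter_law_odd_le_even rho c0 j j)) => [y z|].
  exact: (klipschitzP L f).1 Lf _ _.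
exact: bdd_lipschitz_comp bf clip01_lipschitz.
Qed.

Lemma exists_cavity_fixpoint : exists mu : probability R R,
  [/\ supp01 mu, eq_law mu (cavity_law rho c mu),
      forall nu : probability R R, supp01 nu -> eq_law nu (cavity_law rho c nu) -> eq_law nu mu &
      forall j, root_mean j.*2 <= mean01 (cavity_law P c mu) <= root_mean j.*2.+1].
Proof.
have [mu mu_sandwiched] := exists_sandwiched rho c0.
have Phi_sandwiched := sandwiched_cavity_law c0 mu_sandwiched.
have mu_fix : eq_law mu (cavity_law rho c mu).
  by apply: st_le_eq_law; exact: sandwiched_le.
exists mu; split=> // [|nu nu01 nu_fix|j].
- by rewrite /supp01 mu_fix; [exact: supp01_cavity_law | exact: measurable_01].
- have nu_sandwiched := sandwiched_fixpoint c0 nu01 nu_fix.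
  by apply: st_le_eq_law; exact: sandwiched_le.
- have [odd_le le_even] := mu_sandwiched j.
  by apply/andP; split; apply: st_le_mean01; exact: cavity_law_anti.
Qed.

End unimodular_fixpoint.

(** * Galton--Watson sums and local convergence *)

Section tree_sums.
Context {R : realType}.

Lemma kseqs_le_Ex_sum_law (A : Type) (L : seq A) (w val : A -> R) (mu : probability R R) :
  (forall t, 0 <= w t) -> (forall t, 0 <= val t <= 1) ->
  (forall g, bdd_measurable g -> (forall y, 0 <= g y) ->
     \sum_(t <- L) w t * g (val t) <= Ex mu g) ->
  forall k f, bdd_measurable f -> (forall y, 0 <= f y) ->
    \sum_(ts <- kseqs k L) (\prod_(t <- ts) w t) * f (\sum_(t <- ts) val t)
    <= Ex (sum_law mu k) f.
Proof.
move=> w0 val01 le_mu; elim=> [|k IH] f bf f0.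
  by rewrite /= big_seq1 !big_nil mul1r Ex_dirac.
rewrite big_kseqs [Ex _ _]/= Ex_add_law//.
apply: le_trans (le_mu _ (bdd_measurable_Ex_clip_add _ bf) _); last by move=> y; apply: Ex_ge0.
apply: ler_sum => a _; under eq_bigr do rewrite !big_cons -mulrA.
rewrite -mulr_sumr ler_wpM2l//.
apply: le_trans (IH _ (bdd_measurable_clip_add (val a) bf) _) => //.
apply: ler_sum => l _; rewrite clip01_id// pospart_id//.
by apply: sumr_ge0 => t _; case/andP: (val01 t).
Qed.

Lemma mixture_pow_cvg (q : offspring_law R) (m : nat -> R) :
  (forall n, 0 <= m n <= 1) -> m @ \oo --> (1 : R) ->
  (fun n => \sum_(k < n) q k * m n ^+ k) @ \oo --> (1 : R).
Proof.
move=> m01 m_cvg; apply/cvgrPdist_le => e e0; have e2 : 0 < e / 2 by rewrite divr_gt0.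
have q_cvg := offspring_sum1 q; have q0 := offspring_ge0 q.
have mass_le1 n : \sum_(k < n) q k * m n ^+ k <= 1.
  apply: (@le_trans _ _ (\sum_(k < n) q k)).
    by apply: ler_sum => k _; rewrite ler_piMr// exprn_ile1//; case/andP: (m01 n).
  exact: (@partial_sum_le_lim R q).
have /cvgrPdist_lt/(_ _ e2)[K _ /(_ K (leqnn K))] := q_cvg.
rewrite /= ltr_norml => /andP[_ tail_K].
have head_cvg : (fun n => (\sum_(k < K) q k) * m n ^+ K) @ \oo --> \sum_(k < K) q k.
  rewrite -[X in _ --> X]mulr1 -(expr1n R K); apply: cvgM; first exact: cvg_cst.
  exact: (cvg_comp _ _ m_cvg (@exprn_continuous R K 1)).
have /cvgrPdist_lt/(_ _ e2) near_head := head_cvg.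
near=> n; rewrite ger0_norm ?subr_ge0 ?mass_le1//.
have : `|\sum_(k < K) q k - (\sum_(k < K) q k) * m n ^+ K| < e / 2.
  by near: n; exact: near_head.
rewrite ltr_norml => /andP[_ head_n].
have Kn : (K <= n)%N by near: n; exact: nbhs_infty_ge.
suff : (\sum_(k < K) q k) * m n ^+ K <= \sum_(k < n) q k * m n ^+ k by lra.
have /andP[m0 m1] := m01 n.
rewrite -(big_mkord xpredT (fun k => q k * m n ^+ k)) (big_cat_nat (leq0n K) Kn)//= big_mkord.
rewrite -[leLHS]addr0 lerD//; last by apply: sumr_ge0 => k _; rewrite mulr_ge0 ?exprn_ge0.
by rewrite mulr_suml; apply: ler_sum => k _; rewrite ler_wpM2l// ler_wiXn2l// ltnW.
Unshelve. all: by end_near. Qed.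

Variables (rho : offspring_law R) (c : R).
Hypothesis c0 : 0 < c.
Implicit Types (q : offspring_law R) (g : R -> R).

Lemma trees_sum_root N r (q : nat -> R) g :
  \sum_(t <- trees N r.+1) gw_weight q rho r.+1 t * g (tree_cavity c r.+1 t [::]) =
  \sum_(k < N) q k * \sum_(ts <- kseqs k (trees N r))
    (\prod_(t <- ts) gw_weight rho rho r t) * g (cavity c (\sum_(t <- ts) tree_cavity c r t [::])).
Proof.
rewrite big_trees; apply: eq_bigr => k _; rewrite mulr_sumr.
rewrite big_seq [RHS]big_seq; apply: eq_bigr => ts /kseqs_ptree[pts sz].
by rewrite gw_weight_node// tree_cavity_node// sz -mulrA.
Qed.

Lemma trees_root_le q N r g : bdd_measurable g -> (forall y, 0 <= g y) ->
  (forall h, bdd_measurable h -> (forall y, 0 <= h y) ->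
    \sum_(t <- trees N r) gw_weight rho rho r t * h (tree_cavity c r t [::])
    <= Ex (iter_law rho c r) h) ->
  \sum_(t <- trees N r.+1) gw_weight q rho r.+1 t * g (tree_cavity c r.+1 t [::])
  <= Ex (cavity_law q c (iter_law rho c r)) g.
Proof.
move=> bg g0 subtrees_le; rewrite trees_sum_root.
apply: le_trans (cavity_law_partial_sum_le q c (iter_law rho c r) N bg g0).
apply: ler_sum => k _; rewrite ler_wpM2l ?offspring_ge0//.
apply: (@kseqs_le_Ex_sum_law _ _ (gw_weight rho rho r) (fun t => tree_cavity c r t [::])
  _ _ _ subtrees_le k (g \o cavity c)) => [t|t||y].
- by apply: gw_weight_ge0; exact: offspring_ge0.
- exact: tree_cavity_bounds.
- exact: bdd_measurable_cavity.
- exact: g0.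
Qed.

Lemma trees_le_iter_law N r g : bdd_measurable g -> (forall y, 0 <= g y) ->
  \sum_(t <- trees N r) gw_weight rho rho r t * g (tree_cavity c r t [::])
  <= Ex (iter_law rho c r) g.
Proof.
elim: r g => [|r IH] g bg g0; last exact: trees_root_le.
by rewrite /= big_seq1 gw_weight_height0 mul1r Ex_dirac.
Qed.

Definition tree_mass (q : nat -> R) N r : R := \sum_(t <- trees N r) gw_weight q rho r t.

Lemma tree_massS (q : nat -> R) N r :
  tree_mass q N r.+1 = \sum_(k < N) q k * tree_mass rho N r ^+ k.
Proof.
rewrite /tree_mass; have := @trees_sum_root N r q (fun=> 1).
under eq_bigr do rewrite mulr1; move=> ->; apply: eq_bigr => k _; congr (_ * _).
by under eq_bigr do rewrite mulr1; rewrite sum_kseqs_prod.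
Qed.

Lemma tree_mass_bounds N r : 0 <= tree_mass rho N r <= 1.
Proof.
apply/andP; split.
  by apply: sumr_ge0 => t _; apply: gw_weight_ge0; exact: offspring_ge0.
have := @trees_le_iter_law N r (fun=> 1) (bdd_measurable_cst 1) (fun=> ler01).
by rewrite Ex_cst; under eq_bigr do rewrite mulr1.
Qed.

Lemma tree_mass_root_cvg q r :
  (fun N => tree_mass rho N r) @ \oo --> (1 : R) ->
  (fun N => tree_mass q N r.+1) @ \oo --> (1 : R).
Proof.
move=> mass_cvg; under eq_fun do rewrite tree_massS.
by apply: mixture_pow_cvg => // n; exact: tree_mass_bounds.
Qed.

Lemma tree_mass_cvg r : (fun N => tree_mass rho N r) @ \oo --> (1 : R).
Proof.
elim: r => [|r IH]; last exact: tree_mass_root_cvg.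
rewrite (_ : (fun N => _) = (fun=> 1)); first exact: cvg_cst.
by apply/funext => N; rewrite /tree_mass /= big_seq1 gw_weight_height0.
Qed.

Lemma trees_root_cvg q r g : bdd_measurable g -> (forall y, 0 <= g y <= 1) ->
  (fun N => \sum_(t <- trees N r.+1) gw_weight q rho r.+1 t * g (tree_cavity c r.+1 t [::]))
    @ \oo --> Ex (cavity_law q c (iter_law rho c r)) g.
Proof.
move=> bg g01; have b1g : bdd_measurable (fun y => 1 - g y).
  by apply: bdd_measurableB => //; exact: bdd_measurable_cst.
set law := cavity_law _ _ _; set S := fun N => _.
have S_le N : S N <= Ex law g.
  by apply: trees_root_le => // [y|]; [case/andP: (g01 y) | exact: trees_le_iter_law].
have S_ge N : Ex law g - (1 - tree_mass q N r.+1) <= S N.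
  have : tree_mass q N r.+1 - S N <= 1 - Ex law g; last by lra.
  rewrite -[X in _ <= X - _](Ex_cst law) -ExB//; last exact: bdd_measurable_cst.
  have g_le1 y : 0 <= 1 - g y by rewrite subr_ge0; case/andP: (g01 y).
  apply: le_trans (trees_root_le q b1g g_le1 (@trees_le_iter_law N r)).
  by rewrite /tree_mass /S -sumrB; under eq_bigr do rewrite -[X in X - _]mulr1 -mulrBr.
apply: (@squeeze_cvgr _ _ _ _ (fun N => Ex law g - (1 - tree_mass q N r.+1)) (fun=> Ex law g)).
- by apply: nearW => N; rewrite S_ge S_le.
- rewrite -[X in _ --> X]subr0 -[X in _ - X](subrr 1); apply: cvgB; first exact: cvg_cst.
  by apply: cvgB; [exact: cvg_cst | exact/tree_mass_root_cvg/tree_mass_cvg].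
- exact: cvg_cst.
Qed.

End tree_sums.

Section tree_isomorphism_classes.
Implicit Types (t s T : {fset word}) (L : seq {fset word}).

Definition tree_iso t s : bool :=
  `[< rooted_iso (fun w => w \in t) tadj [::] (fun w => w \in s) tadj [::] >].

Lemma tree_iso_refl t : tree_iso t t.
Proof. exact/asboolP/rooted_iso_refl. Qed.

Lemma tree_iso_sym t s : is_ptree t -> tree_iso t s -> tree_iso s t.
Proof. by move=> [rt _] /asboolP ts; apply/asboolP; exact: rooted_iso_sym ts. Qed.

Lemma tree_iso_trans t s u : tree_iso t s -> tree_iso s u -> tree_iso t u.
Proof. by move=> /asboolP ts /asboolP su; apply/asboolP; exact: rooted_iso_trans su. Qed.

Definition ball_iso (G : simple_graph) r (v : 'I_(nv G)) T : bool :=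
  `[< rooted_iso (fun x => x \in gball v r) (@adj G) v (fun w => w \in T) tadj [::] >].

Lemma ball_iso_tree_iso (G : simple_graph) r (v : 'I_(nv G)) T T' :
  ball_iso r v T -> ball_iso r v T' -> tree_iso T T'.
Proof.
move=> /asboolP vT /asboolP vT'; apply/asboolP; apply: rooted_iso_trans vT'.
by apply: rooted_iso_sym vT; exact: gball_center.
Qed.

(* The first tree of [L] isomorphic to [t], for [t] in [L]. *)
Definition iso_rep L t : {fset word} := nth t L (find (tree_iso t) L).

Lemma iso_repP L t : t \in L -> iso_rep L t \in L /\ tree_iso t (iso_rep L t).
Proof.
move=> tL; have iso_t : has (tree_iso t) L by apply/hasP; exists t => //; exact: tree_iso_refl.
by split; [rewrite mem_nth -?has_find | exact: nth_find].
Qed.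

Lemma eq_iso_rep L t s : is_ptree t -> is_ptree s -> t \in L -> tree_iso t s ->
  iso_rep L t = iso_rep L s.
Proof.
move=> pt ps tL ts; have st := tree_iso_sym pt ts.
have iso_eq : tree_iso t =1 tree_iso s.
  by move=> u; apply/idP/idP => iso_u; exact: tree_iso_trans iso_u.
rewrite /iso_rep (eq_find iso_eq); apply: set_nth_default.
by rewrite -has_find; apply/hasP; exists t.
Qed.

Definition iso_reps L : seq {fset word} := undup (map (iso_rep L) L).

Lemma iso_reps_uniq L : uniq (iso_reps L).
Proof. exact: undup_uniq. Qed.

Lemma mem_iso_rep L t : t \in L -> iso_rep L t \in iso_reps L.
Proof. by move=> tL; rewrite mem_undup; exact: map_f. Qed.

Lemma iso_repsP L s : (forall t, t \in L -> is_ptree t) -> s \in iso_reps L ->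
  s \in L /\ iso_rep L s = s.
Proof.
move=> pL; rewrite mem_undup => /mapP[t tL ->]; have [rL tr] := iso_repP tL.
by split=> //; rewrite -(eq_iso_rep (pL _ tL) (pL _ rL) tL tr).
Qed.

Lemma iso_reps_inj L s s' : (forall t, t \in L -> is_ptree t) ->
  s \in iso_reps L -> s' \in iso_reps L -> tree_iso s s' -> s = s'.
Proof.
move=> pL /(iso_repsP pL)[sL sE] /(iso_repsP pL)[s'L s'E] ss'.
by rewrite -sE (eq_iso_rep (pL _ sL) (pL _ s'L) sL ss').
Qed.

Lemma sum_iso_reps (R : nmodType) L (F : {fset word} -> R) :
  \sum_(t <- L) F t = \sum_(s <- iso_reps L) \sum_(t <- L | iso_rep L t == s) F t.
Proof.
rewrite (exchange_big_dep xpredT)//= big_seq [RHS]big_seq; apply: eq_bigr => t tL.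
rewrite -big_filter (_ : [seq s <- _ | _] = [:: iso_rep L t]) ?big_seq1//.
rewrite -(filter_pred1_uniq (iso_reps_uniq L) (mem_iso_rep tL)); apply: eq_filter => s.
by rewrite /= eq_sym.
Qed.

End tree_isomorphism_classes.

Section local_frequencies.
Context {R : realType}.
Variables (P rho : nat -> R).
Implicit Types (t s T : {fset word}) (G : simple_graph).

Definition vertex_mean (f : forall G, 'I_(nv G) -> R) G : R :=
  (\sum_(v : 'I_(nv G)) f G v) / (nv G)%:R.

Lemma gw_prob_ge r T (s : seq {fset word}) : uniq s ->
  (forall t, t \in s -> [/\ is_ptree t, height_le t r & tree_iso t T]) ->
  ((\sum_(t <- s) gw_weight P rho r t)%:E <= gw_prob P rho r T)%E.
Proof.
move=> us sP; apply: esum_ge; exists [set` s].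
  split; first exact: finite_seq.
  by move=> t /= /sP[pt ht /asboolP tT]; split.
by rewrite -fsbig_seq// sumEFin.
Qed.

Lemma loc_freqE G r T : loc_freq G r T = vertex_mean (fun G v => (ball_iso r v T)%:R) G.
Proof.
congr (_ / _); rewrite -sum1_card big_mkcond natr_sum; apply: eq_bigr => v _.
rewrite (_ : (v \in _) = ball_iso r v T); first by case: (ball_iso r v T).
exact: asboolb.
Qed.

Lemma loc_freq_le1 G r T : loc_freq G r T <= 1 :> R.
Proof.
rewrite /loc_freq; have [nv0|nv0] := posnP (nv G).
  have -> : (nv G)%:R = 0 :> R by rewrite nv0.
  by rewrite invr0 mulr0.
by rewrite ler_pdivrMr ?ltr0n// mul1r ler_nat (leq_trans (max_card _))// card_ord.
Qed.

Definition locally_converges (Gs : nat -> simple_graph) : Prop :=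
  forall r T, is_ptree T -> height_le T r ->
    (fun n => (loc_freq (Gs n) r T)%:E) @ \oo --> gw_prob P rho r T.

Variable Gs : nat -> simple_graph.
Hypothesis Gs_cvg : locally_converges Gs.

Lemma gw_prob_fin_num r T : is_ptree T -> height_le T r -> gw_prob P rho r T \is a fin_num.
Proof.
move=> pT hT; have freq_cvg := Gs_cvg pT hT; rewrite ge0_fin_numE.
  apply: (@le_lt_trans _ _ 1%E); last exact: ltry.
  rewrite -(cvg_lim _ freq_cvg)//; apply: lime_le; first exact: cvgP freq_cvg.
  by apply: nearW => n; rewrite lee_fin loc_freq_le1.
by have := @gw_prob_ge r T [::] isT; rewrite big_nil; apply => t; rewrite inE.
Qed.

(* [phi] is an isomorphism invariant of trees that computes [psi] on tree-like balls. *)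
Variables (r : nat) (phi : {fset word} -> R) (psi : forall G, 'I_(nv G) -> R).
Hypotheses (phi_ge0 : forall t, 0 <= phi t) (psi_ge0 : forall G (v : 'I_(nv G)), 0 <= psi v)
  (phi_iso : forall t s, is_ptree t -> is_ptree s -> tree_iso t s -> phi t = phi s)
  (psi_phi : forall G (v : 'I_(nv G)) T, is_ptree T -> ball_iso r v T -> psi v = phi T).

Lemma sum_loc_freq_le (reps : seq {fset word}) G : uniq reps ->
  (forall s, s \in reps -> is_ptree s) ->
  {in reps &, forall s s', tree_iso s s' -> s = s'} ->
  \sum_(s <- reps) loc_freq G r s * phi s <= vertex_mean psi G.
Proof.
move=> ureps preps reps_inj; rewrite /vertex_mean.
under eq_bigr do rewrite loc_freqE /vertex_mean mulrAC.
rewrite -mulr_suml ler_wpM2r ?invr_ge0//.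
under eq_bigr do rewrite mulr_suml.
rewrite exchange_big /=; apply: ler_sum => v _.
have [/hasP[s sr vs]|/hasPn no_rep] := boolP (has (ball_iso r v) reps); last first.
  by rewrite big_seq big1 ?psi_ge0// => s /no_rep/negbTE ->; rewrite mul0r.
rewrite (bigD1_seq s)//= vs mul1r big_seq_cond big1 ?addr0.
  by rewrite (psi_phi (preps s sr) vs).
move=> s' /andP[s'r ne]; case: (boolP (ball_iso r v s')) => [vs'|]; last by rewrite mul0r.
by case/eqP: ne; apply: reps_inj => //; exact: ball_iso_tree_iso vs' vs.
Qed.

Lemma sum_gw_weight_le L : uniq L -> (forall t, t \in L -> is_ptree t /\ height_le t r) ->
  \sum_(t <- L) gw_weight P rho r t * phi t <=
  \sum_(s <- iso_reps L) fine (gw_prob P rho r s) * phi s.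
Proof.
move=> uL pL; rewrite sum_iso_reps big_seq [leRHS]big_seq; apply: ler_sum => s sr.
have [sL _] := iso_repsP (fun t tL => (pL t tL).1) sr; have [ps hs] := pL s sL.
have -> : \sum_(t <- L | iso_rep L t == s) gw_weight P rho r t * phi t =
    (\sum_(t <- [seq t <- L | iso_rep L t == s]) gw_weight P rho r t) * phi s.
  rewrite big_filter mulr_suml big_seq_cond [RHS]big_seq_cond.
  apply: eq_bigr => t /andP[tL /eqP ts]; congr (_ * _).
  by apply: phi_iso => //; [case: (pL t tL) | rewrite -ts; case: (iso_repP tL)].
rewrite ler_wpM2r// -lee_fin fineK ?gw_prob_fin_num//; apply: gw_prob_ge.
  exact: filter_uniq.
move=> t; rewrite mem_filter => /andP[/eqP ts tL]; have [pt ht] := pL t tL.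
by split => //; rewrite -ts; case: (iso_repP tL).
Qed.

Lemma vertex_mean_near_ge L e : uniq L ->
  (forall t, t \in L -> is_ptree t /\ height_le t r) -> 0 < e ->
  \forall n \near \oo,
    \sum_(t <- L) gw_weight P rho r t * phi t - e <= vertex_mean psi (Gs n).
Proof.
move=> uL pL e0; have ptL t : t \in L -> is_ptree t by move=> /pL[].
have repsP s : s \in iso_reps L -> is_ptree s /\ height_le s r.
  by move=> /(iso_repsP ptL)[sL _]; exact: pL.
pose freq_sum n := \sum_(s <- iso_reps L) loc_freq (Gs n) r s * phi s.
have freq_cvg : freq_sum @ \oo --> \sum_(s <- iso_reps L) fine (gw_prob P rho r s) * phi s.
  rewrite /freq_sum big_seq; under eq_fun do rewrite big_seq.
  apply: cvg_big => [|s /repsP[ps hs]]; first exact: add_continuous.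
  apply: cvgM; last exact: cvg_cst.
  by have := Gs_cvg ps hs; rewrite -{1}(fineK (gw_prob_fin_num ps hs)) => /fine_cvg.
have /cvgrPdist_le/(_ _ e0) := freq_cvg; apply: filterS => n.
rewrite ler_norml => /andP[_ freq_n]; have gw_le := sum_gw_weight_le uL pL.
apply: le_trans (sum_loc_freq_le (Gs n) (iso_reps_uniq L) _ _).
- by rewrite -/(freq_sum n); lra.
- by move=> s /repsP[].
- by move=> s s'; exact: iso_reps_inj.
Qed.

End local_frequencies.

Section local_limits.
Context {R : realType}.
Variables (P rho : offspring_law R) (Gs : nat -> simple_graph).
Hypothesis Gs_cvg : locally_converges P rho Gs.

Lemma locally_converges_nonempty : \forall n \near \oo, (0 < nv (Gs n))%N.
Proof.
have half0 : 0 < 2^-1 :> R by rewrite invr_gt0.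
have := vertex_mean_near_ge (phi := fun=> 1) (psi := fun _ _ => 1) Gs_cvg (r := 0)
  (fun=> ler01) (fun _ _ => ler01) (fun _ _ _ _ _ => erefl) (fun _ _ _ _ _ => erefl)
  (uniq_trees 0 0) (@trees_ptree 0 0) half0.
apply: filterS => n; rewrite /= big_seq1 gw_weight_height0 mulr1 /vertex_mean => mean_ge.
rewrite lt0n; apply/eqP => nv0; move: mean_ge.
have -> : (nv (Gs n))%:R = 0 :> R by rewrite nv0.
by rewrite invr0 mulr0; lra.
Qed.

Lemma vertex_mean_compl (psi : forall G, 'I_(nv G) -> R) G : (0 < nv G)%N ->
  vertex_mean (fun G v => 1 - psi G v) G = 1 - vertex_mean psi G.
Proof.
move=> nv0; rewrite /vertex_mean sumrB mulrBl sumr_const card_ord -mulr_natr mul1r divff//.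
by rewrite pnatr_eq0 -lt0n.
Qed.

Variables (r : nat) (phi : {fset word} -> R) (psi : forall G, 'I_(nv G) -> R) (l : R).
Hypotheses (phi01 : forall t, 0 <= phi t <= 1)
  (psi01 : forall G (v : 'I_(nv G)), 0 <= psi v <= 1)
  (phi_iso : forall t s, is_ptree t -> is_ptree s -> tree_iso t s -> phi t = phi s)
  (psi_phi : forall G (v : 'I_(nv G)) T, is_ptree T -> ball_iso r v T -> psi v = phi T)
  (mass_cvg : (fun N => tree_mass rho P N r) @ \oo --> (1 : R))
  (phi_cvg : (fun N => \sum_(t <- trees N r) gw_weight P rho r t * phi t) @ \oo --> l).

Lemma vertex_mean_cvg : (fun n => vertex_mean psi (Gs n)) @ \oo --> l.
Proof.
apply/cvgrPdist_le => e e0; have e2 : 0 < e / 2 by rewrite divr_gt0.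
have e4 : 0 < e / 4 by rewrite divr_gt0.
have /cvgrPdist_le/(_ _ e4) near_phi := phi_cvg.
have /cvgrPdist_le/(_ _ e4) near_mass := mass_cvg.
have [N _ /(_ N (leqnn N))] := filterI near_phi near_mass.
rewrite /= !ler_norml => -[/andP[phi_ge phi_le] /andP[_ mass_ge]].
pose w t := gw_weight P rho r t.
have complE : \sum_(t <- trees N r) w t * (1 - phi t) =
    tree_mass rho P N r - \sum_(t <- trees N r) w t * phi t.
  by rewrite /tree_mass -sumrB; apply: eq_bigr => t _; rewrite mulrBr mulr1.
have near_ge := vertex_mean_near_ge Gs_cvg (fun t => proj1 (andP (phi01 t)))
  (fun G v => proj1 (andP (psi01 v))) phi_iso psi_phi (uniq_trees N r) (@trees_ptree N r) e2.
have near_le : \forall n \near \oo, \sum_(t <- trees N r) w t * (1 - phi t) - e / 2 <=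
    vertex_mean (fun G v => 1 - psi v) (Gs n).
  apply: (vertex_mean_near_ge (phi := fun t => 1 - phi t)
    (psi := fun G v => 1 - psi v) Gs_cvg (r := r)) e2; last 2 first.
  - exact: uniq_trees.
  - exact: trees_ptree.
  - by move=> t; rewrite subr_ge0; case/andP: (phi01 t).
  - by move=> G v; rewrite subr_ge0; case/andP: (psi01 v).
  - by move=> t s pt ps ts; rewrite (phi_iso pt ps ts).
  - by move=> G v T pT vT; rewrite (psi_phi pT vT).
have nonempty := locally_converges_nonempty.
near=> n; have nv0 : (0 < nv (Gs n))%N by near: n.
have ge_n : \sum_(t <- trees N r) w t * phi t - e / 2 <= vertex_mean psi (Gs n) by near: n.
have : \sum_(t <- trees N r) w t * (1 - phi t) - e / 2 <= 1 - vertex_mean psi (Gs n).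
  by rewrite -vertex_mean_compl//; near: n.
by rewrite complE => le_n; rewrite ler_norml; apply/andP; split; lra.
Unshelve. all: by end_near. Qed.

End local_limits.

Lemma saw_cavity_mean_cvg {R : realType} (P rho : offspring_law R) (Gs : nat -> simple_graph)
    (c : R) r : 0 < c -> locally_converges P rho Gs ->
  (fun n => vertex_mean (fun G v => saw_cavity c neighbours r.+1 [::] v) (Gs n)) @ \oo -->
  root_mean P rho c r.
Proof.
move=> c0 Gs_cvg; apply: (vertex_mean_cvg Gs_cvg (r := r.+1)
  (phi := fun t => tree_cavity c r.+1 t [::])).
- by move=> t; exact: tree_cavity_bounds.
- by move=> G v; exact: saw_cavity_bounds.
- by move=> t s pt ps /asboolP; exact: tree_cavity_iso.
- by move=> G v T pT /asboolP; exact: saw_cavity_ball.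
- exact/tree_mass_root_cvg/tree_mass_cvg.
rewrite (_ : (fun N => _) = (fun N =>
    \sum_(t <- trees N r.+1) gw_weight P rho r.+1 t * clip01 (tree_cavity c r.+1 t [::]))).
  apply: trees_root_cvg => // [|y]; last by rewrite clip01_ge0 clip01_le1.
  exact/bdd_lipschitz_measurable/bdd_lipschitz_clip01.
apply/funext => N; apply: eq_bigr => t _.
by rewrite clip01_id// tree_cavity_bounds.
Qed.

Lemma mean_R_cvg {R : realType} (P rho : offspring_law R) (Pbar x : R)
    (Gs : nat -> simple_graph) (l : R) :
  0 < Pbar -> unimodular P rho Pbar -> 0 < x ->
  locally_converges P rho Gs ->
  (forall j, root_mean P rho (x ^+ 2) j.*2 <= l <= root_mean P rho (x ^+ 2) j.*2.+1) ->
  (fun n => mean_R (Gs n) x) @ \oo --> l.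
Proof.
move=> Pbar0 P_rho x0 Gs_cvg l_between; have c0 : 0 < x ^+ 2 by rewrite exprn_gt0.
apply/cvgrPdist_le => e e0; have e2 : 0 < e / 2 by rewrite divr_gt0.
have sandwich_dist (a b u v m : R) : a <= l <= b -> `|0 - (b - a)| <= e / 2 ->
    `|a - u| <= e / 2 -> `|b - v| <= e / 2 -> u <= m <= v -> `|l - m| <= e.
  rewrite sub0r normrN !ler_norml => /andP[? ?] /andP[? ?] /andP[? ?] /andP[? ?] /andP[? ?].
  by apply/andP; split; lra.
have /cvgrPdist_le/(_ _ e2)[j _ /(_ j (leqnn j)) gap] := root_mean_gap_cvg Pbar0 P_rho c0.
have /cvgrPdist_le/(_ _ e2) near_odd := saw_cavity_mean_cvg (r := j.*2) c0 Gs_cvg.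
have /cvgrPdist_le/(_ _ e2) near_even := saw_cavity_mean_cvg (r := j.*2.+1) c0 Gs_cvg.
have le_mean (f g : forall G, 'I_(nv G) -> R) n : (forall v, f (Gs n) v <= g (Gs n) v) ->
    vertex_mean f (Gs n) <= vertex_mean g (Gs n).
  by move=> fg; rewrite ler_wpM2r ?invr_ge0//; apply: ler_sum => v _.
apply: filterS2 near_odd near_even => n odd_n even_n.
apply: (sandwich_dist _ _ _ _ _ (l_between j) gap odd_n even_n); apply/andP; split.
- by apply: (le_mean _ (fun G v => mdR G x v)) => v; case/andP: (mdR_sandwich j v x0).
- by apply: (le_mean (fun G v => mdR G x v)) => v; case/andP: (mdR_sandwich j.+1 v x0).
Qed.

Section size_biased_law.
Context {R : realType}.
Variables (P rho : nat -> R) (Pbar : R).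
Hypotheses (P_ge0 : forall k, 0 <= P k)
  (Pbar_cvg : (fun n => \sum_(k < n) k%:R * P k) @ \oo --> Pbar) (Pbar0 : 0 < Pbar)
  (rhoE : forall k, rho k = k.+1%:R * P k.+1 / Pbar).

Lemma size_biased_ge0 k : 0 <= rho k.
Proof. by rewrite rhoE divr_ge0 ?mulr_ge0// ltW. Qed.

Lemma size_biased_sum1 : (fun n => \sum_(k < n) rho k) @ \oo --> (1 : R).
Proof.
rewrite (_ : (fun n => _) = (fun n => (\sum_(k < n + 1) k%:R * P k) * Pbar^-1)).
  rewrite -[X in _ --> X](divff (lt0r_neq0 Pbar0)); apply: cvgM; last exact: cvg_cst.
  by have shift_cvg := Pbar_cvg; rewrite -(cvg_shiftn 1) in shift_cvg.
apply/funext => n; rewrite addn1 big_ord_recl mul0r add0r mulr_suml.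
by apply: eq_bigr => k _; rewrite rhoE.
Qed.

Lemma size_biased_unimodular : unimodular P rho Pbar.
Proof. by move=> k; rewrite rhoE [RHS]mulrC divfK// gt_eqF. Qed.

End size_biased_law.

Lemma ae_locally_converges {R : realType} (d : measure_display) (Omega : measurableType d)
    (Pr : probability Omega R) (G : nat -> Omega -> simple_graph) (P rho : nat -> R) :
  (forall (r : nat) (T : {fset word}), is_ptree T -> height_le T r ->
     {ae Pr, forall w, (fun n => (loc_freq (G n w) r T)%:E) @ \oo --> gw_prob P rho r T}) ->
  {ae Pr, forall w, locally_converges P rho (G ^~ w)}.
Proof.
move=> ae_freq.
pose freq_cvg (i : nat) w := if @choice.unpickle (nat * {fset word})%type i is Some (r, T)
  then is_ptree T -> height_le T r ->
    (fun n => (loc_freq (G n w) r T)%:E) @ \oo --> gw_prob P rho r T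
  else True.
have ae_freq_cvg i : {ae Pr, forall w, freq_cvg i w}.
  rewrite /freq_cvg; case: (choice.unpickle i) => [[r T]|]; last exact: aeW.
  have [pT|nT] := pselect (is_ptree T); last by apply: aeW => w /nT.
  have [hT|nT] := pselect (height_le T r); last by apply: aeW => w _ /nT.
  by have := ae_freq r T pT hT; apply: filterS => w Tw _ _.
have := ae_foralln ae_freq_cvg; apply: filterS => w all_w r T.
by have := all_w (choice.pickle (r, T)); rewrite /freq_cvg choice.pickleK.
Qed.

Definition limit_message_law {R : realType} (P rho : nat -> R) (x : R)
    (mu : probability R R) : Prop :=
  [/\ is_rde_sol rho x mu,
      forall nu : probability R R, is_rde_sol rho x nu -> eq_law nu mu,
      EY P x mu \is a fin_num &
      forall Gs, locally_converges P rho Gs ->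
        (fun n => mean_R (Gs n) x) @ \oo --> fine (EY P x mu)].

Lemma exists_limit_message_law {R : realType} (P rho : offspring_law R) (Pbar x : R) :
  0 < Pbar -> unimodular P rho Pbar -> 0 < x ->
  exists mu : probability R R, limit_message_law P rho x mu.
Proof.
move=> Pbar0 P_rho x0; have c0 : 0 < x ^+ 2 by rewrite exprn_gt0.
have [mu [mu01 mu_fix mu_unique mu_between]] := exists_cavity_fixpoint Pbar0 P_rho c0.
exists mu; rewrite /limit_message_law (EY_cavity_law P x0 mu01); split=> //.
- by apply/(is_rde_solP _ x0).
- by move=> nu /(is_rde_solP _ x0)[nu01 nu_fix]; exact: mu_unique.
- by move=> Gs Gs_cvg; exact: (mean_R_cvg Pbar0 P_rho x0 Gs_cvg mu_between).
Qed.

Theorem theorem4p7 (R : realType) (d : measure_display) (Omega : measurableType d)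
  (Pr : probability Omega R) (G : nat -> Omega -> simple_graph) (P rho : nat -> R) :
  (* P is a probability distribution on nat *)
  (forall k, 0 <= P k) ->
  (fun n => \sum_(k < n) P k) @ \oo --> (1 : R) ->
  (* 0 < Pbar < oo *)
  cvg ((fun n => \sum_(k < n) k%:R * P k) @ \oo) ->
  0 < limn (fun n => \sum_(k < n) k%:R * P k) ->
  (* unimodularity: rho_k = (k+1) P_{k+1} / Pbar *)
  (forall k, rho k = k.+1%:R * P k.+1 / limn (fun n => \sum_(i < n) i%:R * P i)) ->
  (* finite second moment *)
  cvg ((fun n => \sum_(k < n) (k ^ 2)%:R * P k) @ \oo) ->
  (* almost sure local convergence of G_n to T(P, rho) *)
  (forall (r : nat) (T : {fset word}), is_ptree T -> height_le T r ->
     {ae Pr, forall w : Omega,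
        (fun n => (loc_freq (G n w) r T)%:E) @ \oo --> gw_prob P rho r T}) ->
  exists mu : R -> probability R R,
    [/\ (* mu x is the unique [0,1]-supported solution of the RDE *)
        forall x, 0 < x ->
          is_rde_sol rho x (mu x) /\
          (forall nu : probability R R, is_rde_sol rho x nu ->
             forall A, measurable A -> nu A = mu x A),
        (* x |-> E[Y(x)] is analytic on (0, oo) *)
        real_analytic_on [set x : R | 0 < x] (fun x => fine (EY P x (mu x))),
        (* eps_{G_n}(x) = x d/dx (log Z_{G_n}(x) / |V_n|) = (1/|V_n|) sum_v R_x(G_n, v) *)
        forall n (w : Omega) (x : R), 0 < x ->
          x * derive1 (fun y => ln (mdZ (G n w) y) / (nv (G n w))%:R) x = mean_R (G n w) x &
        (* almost surely, for all x > 0, eps_{G_n}(x) -> E[Y(x)] *)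
        {ae Pr, forall w : Omega, forall x : R, 0 < x ->
           (fun n => (mean_R (G n w) x)%:E) @ \oo --> EY P x (mu x)}].
Proof.
move=> P0 P1 Pbar_cvg Pbar0 rhoE _ ae_freq.
pose P_law := OffspringLaw P0 P1.
pose rho_law := OffspringLaw (size_biased_ge0 P0 Pbar0 rhoE) (size_biased_sum1 Pbar_cvg Pbar0 rhoE).
have ae_cvg := ae_locally_converges ae_freq.
have /choice[mu muP] x : exists mu : probability R R, 0 < x -> limit_message_law P rho x mu.
  have [x0|nx0] := pselect (0 < x); last by exists (\d_(0 : R)).
  have [mu muP] := exists_limit_message_law (P := P_law) (rho := rho_law) Pbar0
    (size_biased_unimodular Pbar0 rhoE) x0.
  by exists mu.
exists mu; split.
- by move=> x /muP[].
- have Pr_gt0 : (0 < Pr setT)%E by rewrite probability_setT.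
  have [w w_cvg] := @filter_ex _ _ (ae_properfilter_algebraOfSetsType Pr_gt0) _ ae_cvg.
  by apply: (mean_R_limit_analytic (G := G ^~ w)) => x /muP[_ _ _]; apply.
- by move=> n w x; exact: derive_ln_mdZ.
- apply: filterS ae_cvg => w w_cvg x /muP[_ _ EY_fin /(_ _ w_cvg) mean_cvg].
  by rewrite -(fineK EY_fin); apply/cvg_EFin; [exact: nearW | exact: mean_cvg].
Qed.
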